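(* Let $M=S^{2n+1}\subset\mathbb{C}^{n+1}$ ($n\ge1$) with the standard contact form $\theta=\frac{i}{2}(\overline\partial-\partial)|z|^2$ (pulled back to the sphere). Consider, for a constant $k$, the statements: (i) $k>0$ and $\rho(X,X)+2A(X,JX)\ge k\,G_\theta(X,X)$ for all $X\in H(M)$; (ii) $-2nk/(2n-1)\in\mathrm{Spec}(\Delta_b)$; (iii) $\mathrm{Eigen}(\Delta_b;-2nk/(2n-1))\cap\mathrm{Ker}(T)\neq(0)$. If (i), (ii), (iii) hold for some $k$, then $k=4$ and $n=1$. Conversely, (i)-(iii) hold on $S^3$ (that is, for $n=1$ and $k=4$). Moreover, let $M=S^3$ and let $$H=a(x_1^2+y_1^2-x_2^2-y_2^2)+2b(x_1x_2+y_1y_2),\qquad f=H|_{S^3},\qquad a,b\in\mathbb{R},\ b\neq0,$$ (a spherical harmonic of degree $2$ on $S^3$ such that $T(f)=0$). Then $\alpha=\sup_{x\in S^3}f(x)=\sqrt{a^2+b^2}$, and $f(\gamma(s))=\alpha\cos(2s)$ for any lengthy geodesic $\gamma:\mathbb{R}\to S^3$ of the Tanaka-Webster connection $\nabla$ of $S^3$ parametrized by arc length and such that $\gamma(0)$ is a maximum point of $f$. Moreover, for $x_0$ a maximum point of $f$, let $M_{\pi/2}$ be the set of all $x\in S^3$ such that there is a lengthy geodesic $\gamma:\mathbb{R}\to S^3$ of $\nabla$, parametrized by arc length, with $\gamma(0)=x_0$ and $\gamma(\pi/2)=x$. Then $$M_{\pi/2}=\Big\{\Big(\lambda,\mu,-\frac{b\lambda}{\alpha-a},-\frac{b\mu}{\alpha-a}\Big):\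 \lambda^2+\mu^2=\frac{\alpha-a}{2\alpha},\ \lambda,\mu\in\mathbb{R}\Big\}$$ (points written in coordinates $(x_1,y_1,x_2,y_2)$), and $M_{\pi/2}$ consists solely of degenerate critical points of $f$.
   Context: $S^{2n+1}$ carries the CR structure induced from $\mathbb{C}^{n+1}$, $T_{1,0}(S^{2n+1})=T^{1,0}(\mathbb{C}^{n+1})\cap(T(S^{2n+1})\otimes\mathbb{C})$, of CR dimension $n$; coordinates $z_j=x_j+iy_j$. For a CR manifold $M$: $H(M)=\mathrm{Re}\{T_{1,0}(M)\oplus T_{0,1}(M)\}$ with $T_{0,1}(M)=\overline{T_{1,0}(M)}$, and $J(Z+\overline Z)=i(Z-\overline Z)$, $Z\in T_{1,0}(M)$. For a contact form $\theta$ with $\mathrm{Ker}(\theta)=H(M)$, the Levi form is $G_\theta(X,Y)=(d\theta)(X,JY)$, $X,Y\in H(M)$ (exterior derivative normalized by $2\,d\theta(X,Y)=X(\theta(Y))-Y(\theta(X))-\theta([X,Y])$). $T$ is the vector field with $\theta(T)=1$, $T\rfloor d\theta=0$ (on the sphere $T=\sum_j(x_j\partial/\partial y_j-y_j\partial/\partial x_j)$); $J$ is extended by $JT=0$. The Webster metric $g_\theta$ equals $G_\theta$ on $H(M)$, with $g_\theta(X,T)=0$ for $X\in H(M)$, $g_\theta(T,T)=1$. The Tanaka-Webster connection $\nabla$ is the unique linear connection such that $H(M)$ is $\nabla$-parallel, $\nabla g_\theta=0$, $\nabla J=0$, and its torsion $T_\nabla$ satisfies $T_\nabla(Z,W)=0$,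 $T_\nabla(Z,\overline W)=2iG_\theta(Z,\overline W)T$ for $Z,W\in T_{1,0}(M)$ ($G_\theta$ extended $\mathbb{C}$-bilinearly), and $\tau\circ J+J\circ\tau=0$, where $\tau(X)=T_\nabla(T,X)$. The sublaplacian is $\Delta_bf=\mathrm{div}(\nabla^Hf)$, where $\nabla^Hf$ is the $H(M)$-component (relative to $T(M)=H(M)\oplus\mathbb{R}T$) of the $g_\theta$-gradient of $f$ and the divergence is with respect to $g_\theta$. $\mathrm{Eigen}(\Delta_b;\lambda)=\{f\in C^\infty(M):\Delta_bf=\lambda f\}$ (real-valued functions), and $\mathrm{Spec}(\Delta_b)$ is the set of eigenvalues. $\rho(X,Y)=\mathrm{trace}\{Z\mapsto R(Z,Y)X\}$ with $R(X,Y)=\nabla_X\nabla_Y-\nabla_Y\nabla_X-\nabla_{[X,Y]}$ the curvature of $\nabla$, and $A(X,Y)=g_\theta(\tau X,Y)$. A curve $\gamma$ is lengthy if $\dot\gamma(t)\in H(M)_{\gamma(t)}$ for all $t$ at which it is defined; a lengthy geodesic of $\nabla$ is a lengthy curve with $\nabla_{\dot\gamma}\dot\gamma=0$. A critical point of $f$ is degenerate if the Hessian bilinear form of $f$ at that point is degenerate. *)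

(* Defs.v *)
From HB Require Import structures.
From mathcomp Require Import all_boot all_order all_algebra.
From mathcomp Require Import all_classical all_reals all_analysis.
From mathcomp Require Import complex.
From mathcomp Require Import -(notations) mpoly.
Import numFieldNormedType.Exports.
Import Order.TTheory GRing.Theory Num.Theory.

Set Implicit Arguments.
Unset Strict Implicit.
Unset Printing Implicit Defensive.

Local Open Scope classical_set_scope.
Local Open Scope complex_scope.
Local Open Scope ring_scope.

(* C^(n+1) as R^(2n+2): z_j = x_j + i y_j is stored as the row
   (x_0, ..., x_n, y_0, ..., y_n). *)
Notation ambient R n := 'rV[R]_(n.+1 + n.+1).

Definition xcoord (K : Type) (n : nat) (p : ambient K n) (j : 'I_n.+1) : K :=
  p 0 (lshift n.+1 j).
Definition ycoord (K : Type) (n : nat) (p : ambient K n) (j : 'I_n.+1) : K :=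
  p 0 (rshift n.+1 j).

Definition dx_vec (K : pzRingType) (n : nat) (j : 'I_n.+1) : ambient K n :=
  delta_mx 0 (lshift n.+1 j).
Definition dy_vec (K : pzRingType) (n : nat) (j : 'I_n.+1) : ambient K n :=
  delta_mx 0 (rshift n.+1 j).

Definition dot (R : realType) (n : nat) (u v : ambient R n) : R :=
  \sum_i u 0 i * v 0 i.

Definition sphere (R : realType) (n : nat) : set (ambient R n) :=
  [set p | dot p p = 1].

(** * Calculus on the sphere *)

Fixpoint Ck_on (R : realType) (V W : normedModType R) (U : set V) (k : nat)
    (F : V -> W) : Prop :=
  if k is k'.+1 then
    (forall x, U x -> differentiable F x) /\
    (forall v : V, Ck_on U k' (fun x => 'D_v F x))
  else forall x, U x -> {for x, continuous F}.

Definition smooth_on (R : realType) (V W : normedModType R) (U : set V)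
    (F : V -> W) : Prop := forall k, Ck_on U k F.

Definition retract (R : realType) (n : nat) (x : ambient R n) : ambient R n :=
  (Num.sqrt (dot x x))^-1 *: x.

(* Functions and vector fields on the sphere are represented by total functions
   on the ambient space, of which only the values on the sphere matter.
   Smoothness and differentials are read off the composite with the smooth
   retraction x |-> x / |x| of the punctured space onto the sphere. *)
Definition smooth_fun (R : realType) (n : nat) (W : normedModType R)
    (F : ambient R n -> W) : Prop :=
  smooth_on [set x : ambient R n | x != 0] (F \o @retract R n).

Definition dS (R : realType) (n : nat) (W : normedModType R)
    (F : ambient R n -> W) (p v : ambient R n) : W :=
  'D_v (F \o @retract R n) p.

Definition tangent (R : realType) (n : nat) (p v : ambient R n) : Prop :=
  dot p v = 0.

Definition tproj (R : realType) (n : nat) (p v : ambient R n) : ambient R n :=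
  v - dot p v *: p.

Definition vfield (R : realType) (n : nat) (X : ambient R n -> ambient R n) :
    Prop :=
  smooth_fun X /\ forall p, sphere p -> tangent p (X p).

(* A smooth vector field on the sphere whose value at p is v when v is tangent
   at p; it serves to evaluate tensors, given on vector fields, on vectors. *)
Definition extend (R : realType) (n : nat) (v : ambient R n) :
    ambient R n -> ambient R n := fun x => tproj x v.

Definition bracket (R : realType) (n : nat) (X Y : ambient R n -> ambient R n)
    (p : ambient R n) : ambient R n :=
  dS Y p (X p) - dS X p (Y p).

(* The trace of a linear endomorphism L of the tangent space at p: composing L
   with a projection onto the tangent space does not change its trace. *)
Definition tangent_trace (R : realType) (n : nat) (p : ambient R n)
    (L : ambient R n -> ambient R n) : R :=
  \tr (lin1_mx (fun v : ambient R n => L (tproj p v))).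

(** * CR structure, contact form, Webster metric *)

Definition cplx_of (R : realType) (n : nat) (u v : ambient R n) :
    ambient R[i] n :=
  map_mx (real_complex R) u + 'i%C *: map_mx (real_complex R) v.
Definition re_vec (R : realType) (n : nat) (Z : ambient R[i] n) : ambient R n :=
  map_mx (@complex.Re R) Z.
Definition im_vec (R : realType) (n : nat) (Z : ambient R[i] n) : ambient R n :=
  map_mx (@complex.Im R) Z.
Definition conj_vec (R : realType) (n : nat) (Z : ambient R[i] n) :
    ambient R[i] n := map_mx (@conjc R) Z.

Definition dz (R : realType) (n : nat) (j : 'I_n.+1) (v : ambient R n) : R[i] :=
  xcoord v j +i* ycoord v j.

(* The vector d/dz_j = (d/dx_j - i d/dy_j) / 2. *)
Definition dz_vec (R : realType) (n : nat) (j : 'I_n.+1) : ambient R[i] n :=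
  2^-1 *: (dx_vec R[i] j - 'i%C *: dy_vec R[i] j).

Definition T10 (R : realType) (n : nat) (p : ambient R n)
    (Z : ambient R[i] n) : Prop :=
  (exists c : 'I_n.+1 -> R[i], Z = \sum_j c j *: dz_vec R j) /\
  (tangent p (re_vec Z) /\ tangent p (im_vec Z)).

Definition levi_distribution (R : realType) (n : nat) (p v : ambient R n) :
    Prop :=
  exists2 Z : ambient R[i] n, T10 p Z & cplx_of v 0 = Z + conj_vec Z.

Definition del (R : realType) (n : nat) (u : ambient R n -> R)
    (p v : ambient R n) : R[i] :=
  \sum_j ('D_(dx_vec R j) u p -i* 'D_(dy_vec R j) u p) / 2 * dz j v.
Definition delbar (R : realType) (n : nat) (u : ambient R n -> R)
    (p v : ambient R n) : R[i] :=
  \sum_j ('D_(dx_vec R j) u p +i* 'D_(dy_vec R j) u p) / 2 * conjc (dz j v).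

(* The value on v of (i/2) (delbar - del) |z|^2, which is a real number. *)
Definition theta (R : realType) (n : nat) (p v : ambient R n) : R :=
  complex.Re ('i%C / 2 * (delbar (fun z : ambient R n => dot z z) p v
                          - del (fun z : ambient R n => dot z z) p v)).

(* Exterior derivative with 2 dtheta(X,Y) = X theta(Y) - Y theta(X) -
   theta([X,Y]), evaluated on constant (hence commuting) ambient fields;
   exterior differentiation commutes with the pullback to the sphere. *)
Definition dtheta (R : realType) (n : nat) (p v w : ambient R n) : R :=
  ('D_v (fun x : ambient R n => theta x w) p
   - 'D_w (fun x : ambient R n => theta x v) p) / 2.

Definition reeb (R : realType) (n : nat) (p : ambient R n) : ambient R n :=
  \sum_j (xcoord p j *: dy_vec R j - ycoord p j *: dx_vec R j).

(* The H(M)-component relative to T(M) = H(M) + R T, as Ker theta = H(M). *)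
Definition projH (R : realType) (n : nat) (p v : ambient R n) : ambient R n :=
  v - theta p v *: reeb p.

(* [Z] is the (1,0)-component of the H(M)-component [h] of v, so that
   h = Z + conj Z and J v = J h = i (Z - conj Z); in particular J T = 0. *)
Definition cxJ (R : realType) (n : nat) (p v : ambient R n) : ambient R n :=
  let Z := \sum_j dz j (projH p v) *: dz_vec R j in
  re_vec ('i%C *: (Z - conj_vec Z)).

Definition levi_form (R : realType) (n : nat) (p v w : ambient R n) : R :=
  dtheta p v (cxJ p w).

Definition webster (R : realType) (n : nat) (p v w : ambient R n) : R :=
  levi_form p (projH p v) (projH p w) + theta p v * theta p w.

Definition levi_formC (R : realType) (n : nat) (p : ambient R n)
    (Z W : ambient R[i] n) : R[i] :=
  (levi_form p (re_vec Z) (re_vec W) - levi_form p (im_vec Z) (im_vec W)) +i*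
  (levi_form p (re_vec Z) (im_vec W) + levi_form p (im_vec Z) (re_vec W)).

Definition Hfield (R : realType) (n : nat) (X : ambient R n -> ambient R n) :
    Prop :=
  vfield X /\ forall p, sphere p -> levi_distribution p (X p).

Definition T10field (R : realType) (n : nat)
    (Z : ambient R n -> ambient R[i] n) : Prop :=
  [/\ smooth_fun (fun x : ambient R n => re_vec (Z x)),
      smooth_fun (fun x : ambient R n => im_vec (Z x))
    & forall p, sphere p -> T10 p (Z p)].

(** * Linear connections on the sphere *)

Definition connection (R : realType) (n : nat) : Type :=
  (ambient R n -> ambient R n) -> (ambient R n -> ambient R n) ->
  ambient R n -> ambient R n.

Record is_linear_connection (R : realType) (n : nat) (nabla : connection R n) :
    Prop := IsLinearConnection {
  conn_vfield : forall X Y, vfield X -> vfield Y -> vfield (nabla X Y);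
  conn_tensorial : forall (f : ambient R n -> R) X X' Y,
    smooth_fun f -> vfield X -> vfield X' -> vfield Y ->
    forall p, sphere p ->
    nabla (fun x => f x *: X x + X' x) Y p =
    f p *: nabla X Y p + nabla X' Y p;
  conn_leibniz : forall (f : ambient R n -> R) X Y Y',
    smooth_fun f -> vfield X -> vfield Y -> vfield Y' ->
    forall p, sphere p ->
    nabla X (fun x => f x *: Y x + Y' x) p =
    dS f p (X p) *: Y p + f p *: nabla X Y p + nabla X Y' p }.

Definition torsion (R : realType) (n : nat) (nabla : connection R n)
    (X Y : ambient R n -> ambient R n) (p : ambient R n) : ambient R n :=
  nabla X Y p - nabla Y X p - bracket X Y p.

Definition torsionC (R : realType) (n : nat) (nabla : connection R n)
    (Z W : ambient R n -> ambient R[i] n) (p : ambient R n) : ambient R[i] n :=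
  let reZ x := re_vec (Z x) in let imZ x := im_vec (Z x) in
  let reW x := re_vec (W x) in let imW x := im_vec (W x) in
  cplx_of (torsion nabla reZ reW p - torsion nabla imZ imW p)
          (torsion nabla reZ imW p + torsion nabla imZ reW p).

Definition curvature (R : realType) (n : nat) (nabla : connection R n)
    (X Y Z : ambient R n -> ambient R n) (p : ambient R n) : ambient R n :=
  nabla X (nabla Y Z) p - nabla Y (nabla X Z) p - nabla (bracket X Y) Z p.

Definition is_metric (R : realType) (n : nat) (nabla : connection R n) : Prop :=
  forall X Y Z, vfield X -> vfield Y -> vfield Z -> forall p, sphere p ->
  dS (fun x : ambient R n => webster x (Y x) (Z x)) p (X p) =
  webster p (nabla X Y p) (Z p) + webster p (Y p) (nabla X Z p).

Definition tau (R : realType) (n : nat) (nabla : connection R n)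
    (X : ambient R n -> ambient R n) : ambient R n -> ambient R n :=
  torsion nabla (@reeb R n) X.

Record is_tanaka_webster (R : realType) (n : nat) (nabla : connection R n) :
    Prop := IsTanakaWebster {
  tw_connection : is_linear_connection nabla;
  tw_H_parallel : forall X Y, vfield X -> Hfield Y -> Hfield (nabla X Y);
  tw_metric : is_metric nabla;
  tw_J_parallel : forall X Y, vfield X -> vfield Y -> forall p, sphere p ->
    nabla X (fun x => cxJ x (Y x)) p = cxJ p (nabla X Y p);
  tw_torsion20 : forall Z W, T10field Z -> T10field W ->
    forall p, sphere p -> torsionC nabla Z W p = 0;
  tw_torsion11 : forall Z W, T10field Z -> T10field W ->
    forall p, sphere p ->
    torsionC nabla Z (fun x => conj_vec (W x)) p =
    (2 * 'i%C * levi_formC p (Z p) (conj_vec (W p))) *: cplx_of (reeb p) 0;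
  tw_tau : forall X, vfield X -> forall p, sphere p ->
    tau nabla (fun x => cxJ x (X x)) p + cxJ p (tau nabla X p) = 0 }.

(* "The" connection with these properties; its values on vector fields of the
   sphere are uniquely determined at the points of the sphere. *)
Definition tanaka_webster (R : realType) (n : nat) : connection R n :=
  xget (fun _ _ _ => 0) [set nabla : connection R n | is_tanaka_webster nabla].

Record is_levi_civita (R : realType) (n : nat) (nabla : connection R n) :
    Prop := IsLeviCivita {
  lc_connection : is_linear_connection nabla;
  lc_metric : is_metric nabla;
  lc_torsion_free : forall X Y, vfield X -> vfield Y ->
    forall p, sphere p -> torsion nabla X Y p = 0 }.

Definition levi_civita (R : realType) (n : nat) : connection R n :=
  xget (fun _ _ _ => 0) [set nabla : connection R n | is_levi_civita nabla].

Definition pseudo_ricci (R : realType) (n : nat)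
    (X Y : ambient R n -> ambient R n) (p : ambient R n) : R :=
  tangent_trace p
    (fun v => curvature (@tanaka_webster R n) (extend v) Y X p).

Definition pseudo_torsion (R : realType) (n : nat)
    (X Y : ambient R n -> ambient R n) (p : ambient R n) : R :=
  webster p (tau (@tanaka_webster R n) X p) (Y p).

(** * The sublaplacian and its spectrum *)

Definition gradient (R : realType) (n : nat) (f : ambient R n -> R)
    (p : ambient R n) : ambient R n :=
  xget 0 [set u : ambient R n | tangent p u /\
    forall v, tangent p v -> webster p u v = dS f p v].

Definition divergence (R : realType) (n : nat)
    (X : ambient R n -> ambient R n) (p : ambient R n) : R :=
  tangent_trace p (fun v => levi_civita (extend v) X p).

Definition sublaplacian (R : realType) (n : nat) (f : ambient R n -> R) :
    ambient R n -> R :=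
  divergence (fun x => projH x (gradient f x)).

Definition eigen (R : realType) (n : nat) (lambda : R) :
    set (ambient R n -> R) :=
  [set f | smooth_fun f /\
    forall p, sphere p -> sublaplacian f p = lambda * f p].
Arguments eigen {R} n lambda _.

Definition nonzero_on_sphere (R : realType) (n : nat)
    (f : ambient R n -> R) : Prop :=
  exists2 p : ambient R n, sphere p & f p != 0.

Definition spectrum (R : realType) (n : nat) : set R :=
  [set lambda | exists2 f, eigen n lambda f & nonzero_on_sphere f].

Definition kerT (R : realType) (n : nat) : set (ambient R n -> R) :=
  [set f | smooth_fun f /\ forall p, sphere p -> dS f p (reeb p) = 0].

Definition condition_i (R : realType) (n : nat) (k : R) : Prop :=
  0 < k /\
  forall X : ambient R n -> ambient R n, Hfield X -> forall p, sphere p ->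
  pseudo_ricci X X p + 2 * pseudo_torsion X (fun x => cxJ x (X x)) p >=
  k * levi_form p (X p) (X p).

Definition condition_ii (R : realType) (n : nat) (k : R) : Prop :=
  spectrum n (- (2 * n%:R * k / (2 * n%:R - 1))).

Definition condition_iii (R : realType) (n : nat) (k : R) : Prop :=
  exists2 f : ambient R n -> R,
    (eigen n (- (2 * n%:R * k / (2 * n%:R - 1))) `&` @kerT R n) f
    & nonzero_on_sphere f.

(** * Lengthy geodesics *)

(* The covariant derivative along gamma of a tangent field Y along gamma.
   Writing Y(t) as the combination of the fields [extend e_i] at gamma(t) with
   coefficients the ambient coordinates Y_i(t), this is the usual expansion
   sum_i (Y_i' E_i + Y_i nabla_gamma' E_i). *)
Definition cov_along (R : realType) (n : nat) (nabla : connection R n)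
    (gamma Y : R -> ambient R n) (t : R) : ambient R n :=
  \sum_i (derive1 (fun s => Y s 0 i) t *: extend (delta_mx 0 i) (gamma t)
          + Y t 0 i *: nabla (extend (derive1 gamma t))
                             (extend (delta_mx 0 i)) (gamma t)).

Record lengthy_geodesic (R : realType) (n : nat) (gamma : R -> ambient R n) :
    Prop := LengthyGeodesic {
  geod_smooth : smooth_on [set: R] gamma;
  geod_sphere : forall t, sphere (gamma t);
  geod_lengthy : forall t, levi_distribution (gamma t) (derive1 gamma t);
  geod_eq : forall t,
    cov_along (@tanaka_webster R n) gamma (derive1 gamma) t = 0 }.

Definition arc_length_param (R : realType) (n : nat)
    (gamma : R -> ambient R n) : Prop :=
  forall t, webster (gamma t) (derive1 gamma t) (derive1 gamma t) = 1.

(** * Critical points and spherical harmonics *)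

Definition max_point (R : realType) (n : nat) (f : ambient R n -> R)
    (p : ambient R n) : Prop :=
  sphere p /\ forall q, sphere q -> f q <= f p.

Definition critical_point (R : realType) (n : nat) (f : ambient R n -> R)
    (p : ambient R n) : Prop :=
  sphere p /\ forall v, tangent p v -> dS f p v = 0.

(* V(W f)(p) for vector fields V, W with values v, w at p; at a critical point
   it does not depend on the choice of V and W. *)
Definition hessian (R : realType) (n : nat) (f : ambient R n -> R)
    (p v w : ambient R n) : R :=
  dS (fun x : ambient R n => dS f x (extend w x)) p v.

Definition degenerate_critical_point (R : realType) (n : nat)
    (f : ambient R n -> R) (p : ambient R n) : Prop :=
  critical_point f p /\
  exists v, [/\ tangent p v, v != 0 &
                forall w, tangent p w -> hessian f p v w = 0].

Definition spherical_harmonic (R : realType) (n d : nat)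
    (f : ambient R n -> R) : Prop :=
  exists P : mpoly (n.+1 + n.+1) R,
    [/\ P \is ishomog1 d mdeg,
        \sum_i mderiv i (mderiv i P) = 0
      & forall p, sphere p -> f p = meval (fun i => p 0 i) P].

Definition point4 (R : realType) (x1 y1 x2 y2 : R) : ambient R 1 :=
  row_mx (\row_(j < 2) [:: x1; x2]`_j) (\row_(j < 2) [:: y1; y2]`_j).

Definition harmH (R : realType) (a b : R) (p : ambient R 1) : R :=
  let x1 := xcoord p ord0 in let x2 := xcoord p ord_max in
  let y1 := ycoord p ord0 in let y2 := ycoord p ord_max in
  a * (x1 ^+ 2 + y1 ^+ 2 - x2 ^+ 2 - y2 ^+ 2) + 2 * b * (x1 * x2 + y1 * y2).

(* The points reached at arc length s from x0 along lengthy geodesics. *)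
Definition geodesic_sphere (R : realType) (n : nat) (x0 : ambient R n) (s : R) :
    set (ambient R n) :=
  [set x | exists gamma : R -> ambient R n,
    [/\ lengthy_geodesic gamma, arc_length_param gamma,
        gamma 0 = x0 & gamma s = x]].

(* Main.v *)
Require Import Defs.
From HB Require Import structures.
From mathcomp Require Import all_boot all_order all_algebra.
From mathcomp Require Import all_classical all_reals all_analysis.
From mathcomp Require Import ring lra.
From mathcomp Require Import complex.
From mathcomp Require Import -(notations) mpoly.
Import numFieldNormedType.Exports.
Import Order.TTheory GRing.Theory Num.Theory.

Set Implicit Arguments.
Unset Strict Implicit.
Unset Printing Implicit Defensive.

Local Open Scope classical_set_scope.
Local Open Scope ring_scope.

(** For a function that is constant along the rays from the origin and along
    the Reeb flow, the sublaplacian is the Euclidean Laplacian on the sphere.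
    The Tanaka-Webster connection is explicit; its curvature gives
    rho(X,X) = 2(n+1) G(X,X) on H(M) and tau = 0, so that (i) means
    0 < k <= 2(n+1).

    Let f satisfy (iii), F(x) = f(x/|x|), lambda = 2nk/(2n-1) and
    c = lambda/(2n). A Bochner computation gives, on the sphere,
      (1/2) Lap(|x|^2 |grad F|^2 + c F^2) = |B|^2 + (2(n+1) - k) |grad F|^2,
    where B is the horizontal Hessian of f plus c f times the identity of H(M).
    At a maximum the left-hand side is nonpositive, which excludes
    k < 2(n+1). When k = 2(n+1) the strong maximum principle gives B = 0 near a
    maximum, so that the third derivatives of F are known there; their symmetry
    on the plane spanned by grad f and J grad f forces c = 4, that is n = 1.

    The lengthy geodesics of unit speed are the great circles
    cos(t) p + sin(t) u with u horizontal at p. On S^3, f(p) = <p, Q p> with Q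
    symmetric, complex linear and Q^2 = alpha^2: the maximum points are the
    unit alpha-eigenvectors, their horizontal vectors are the
    (-alpha)-eigenvectors, and M_{pi/2} is the unit circle of the latter. *)

(** * Differential calculus *)

(** All computations take place in the punctured space, with Euclidean partial derivatives of the
    degree-0 function F instead of covariant derivatives. Partial derivatives commute, so no
    curvature term arises when they are exchanged; what curvature contributes comes from the factor
    |x|^2 and from the radial and Reeb entries of the Euclidean Hessian, which are first-order
    expressions in F. Maximising over an open set also avoids charts. Both canonical connections are
    picked by choice from their axioms, so uniqueness must be proved before any explicit formula can
    be used. At a maximum, the Bochner identity with the constant c alone forces grad F = 0 but
    leaves the value of f free. Hence c is lowered to some c' < c: a positive multiple of f^2 then
    appears, and the strict case ends with f = 0. In the equality case there is no room for such a
    c', since the coefficient of |grad F|^2 would become negative; this is where a strong maximum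
    principle is required, and Hopf's argument for the Euclidean Laplacian gives it. *)

Section SmoothFunctions.
Context {R : realType} {V : normedModType R}.

(** The difference g - f vanishes near x, so the zero map serves as its differential there. *)
Lemma near_eq_differentiable {W : normedModType R} (f g : V -> W) (x : V) :
  (\near x, f x = g x) -> differentiable f x -> differentiable g x.
Proof.
move=> fg df; suff gfd : differentiable (g - f) x.
  by rewrite -[g](subrK f); exact: differentiableD.
have k0 : (g - f) \o shift x = cst ((g - f) x) + (\0 : V -> W) +o_ 0 id.
  apply/eqaddoP => _/posnumP[e].
  have fgx := nbhs_singleton fg.
  have fg0 : \forall y \near (0 : V), f (y + x) = g (y + x).
    by move: fg; rewrite (near_shift 0) subr0.
  near=> y.
  have fgy : f (y + x) = g (y + x) by near: y; exact: fg0.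
  rewrite !fctE /= fgx fgy !subrr ?(addr0, oppr0, subr0, subrr) normr0.
  by rewrite mulr_ge0.
have c0 : continuous (\0 : V -> W) by move=> y; exact: cvg_cst.
apply/diff_locallyP; have h := diff_unique c0 k0.
by rewrite h; split.
Unshelve. all: by end_near. Qed.

Section Ck.
Variables (U : set V) (oU : open U).

(** Openness of [U] turns equality on [U] into equality near each of its points, and only the latter
    is inherited by derivatives. *)
Lemma Ck_on_eq {W : normedModType R} k (F G : V -> W) :
  (forall x, U x -> F x = G x) -> Ck_on U k F -> Ck_on U k G.
Proof.
move=> FG.
have near_FG x : U x -> \near x, F x = G x.
  move=> Ux; have := open_nbhs_nbhs (conj oU Ux).
  by rewrite -nbhs_nearE; apply: filterS => y; exact: FG.
elim: k F G FG near_FG => [|k IHk] F G FG near_FG /=.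
  move=> cF x Ux; rewrite /prop_for/= /continuous_at -(FG _ Ux).
  have := cF x Ux; rewrite /prop_for/= /continuous_at.
  apply: cvg_trans.
  by apply: near_eq_cvg; exact: near_FG.
move=> [dF CF]; split=> [x Ux|v].
  by apply: near_eq_differentiable (dF x Ux); exact: near_FG.
have DFG x : U x -> 'D_v F x = 'D_v G x.
  by move=> Ux; apply: near_eq_derive; exact: near_FG.
apply: IHk (CF v) => // x Ux.
have := open_nbhs_nbhs (conj oU Ux).
by rewrite -nbhs_nearE; apply: filterS => y; exact: DFG.
Qed.

Lemma Ck_on_pred {W : normedModType R} k (F : V -> W) :
  Ck_on U k.+1 F -> Ck_on U k F.
Proof.
elim: k F => [|k IHk] F /=.
  by move=> [dF _] x Ux; apply: differentiable_continuous; exact: dF.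
by move=> [dF CF]; split=> // v; exact/IHk/CF.
Qed.

Lemma Ck_on_cst {W : normedModType R} k (a : W) : Ck_on U k (cst a).
Proof.
elim: k a => [|k IHk] a /=; first by move=> x _; exact: cst_continuous.
split=> [x _|v]; first exact: differentiable_cst.
by apply: Ck_on_eq (IHk 0) => x _ /=; rewrite derive_cst.
Qed.

Lemma Ck_onD {W : normedModType R} k (F G : V -> W) :
  Ck_on U k F -> Ck_on U k G -> Ck_on U k (F + G).
Proof.
elim: k F G => [|k IHk] F G /=.
  by move=> cF cG x Ux; apply: continuousD; [exact: cF|exact: cG].
move=> [dF CF] [dG CG]; split=> [x Ux|v].
  by apply: differentiableD; [exact: dF|exact: dG].
apply: Ck_on_eq (IHk _ _ (CF v) (CG v)) => x Ux.
by rewrite deriveD//; apply: diff_derivable; [exact: dF|exact: dG].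
Qed.

Lemma Ck_onM k (F G : V -> R) :
  Ck_on U k F -> Ck_on U k G -> Ck_on U k (F * G).
Proof.
elim: k F G => [|k IHk] F G CF CG.
  by move=> x Ux; apply: continuousM; [exact: CF|exact: CG].
have [dF DF] := CF; have [dG DG] := CG; split=> [x Ux|v].
  by apply: differentiableM; [exact: dF|exact: dG].
apply: (@Ck_on_eq _ _ ((F * 'D_v G) + (G * 'D_v F))) => [x Ux|].
  by rewrite deriveM//; apply: diff_derivable; [exact: dF|exact: dG].
by apply: Ck_onD; apply: IHk; (exact: Ck_on_pred || exact: DG || exact: DF).
Qed.

Lemma Ck_on_lin {W W' : normedModType R} (f : {linear W -> W'}) k (F : V -> W) :
  continuous f -> Ck_on U k F -> Ck_on U k (f \o F).
Proof.
move=> cf; elim: k F => [|k IHk] F.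
  by move=> CF x Ux; apply: continuous_comp; [exact: CF|exact: cf].
move=> [dF DF]; split=> [x Ux|v].
  by apply: differentiable_comp; [exact: dF|exact: (linear_differentiable _ cf)].
apply: Ck_on_eq (IHk _ (DF v)) => x Ux /=.
have dFx := dF x Ux; have dfx := linear_differentiable (F x) cf.
rewrite [RHS]deriveE; last exact: differentiable_comp.
by rewrite diff_comp//= diff_lin// deriveE.
Qed.

End Ck.

Lemma is_derive_line {W : normedModType R} (f : V -> W) (x v : V) (t : R) (d : W) :
  is_derive (x + t *: v) v f d -> is_derive t 1 (fun s => f (x + s *: v)) d.
Proof.
have E h : h^-1 *: (((fun s => f (x + s *: v)) \o shift t) (h *: 1) - f (x + t *: v))
    = h^-1 *: ((f \o shift (x + t *: v)) (h *: v) - f (x + t *: v)).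
  by rewrite /= [h *: 1]mulr1 scalerDl addrCA.
move=> [df <-]; split; rewrite /derivable /derive.
  by under eq_fun do rewrite E.
by under eq_fun do rewrite E.
Qed.

(* Two applications of the mean value theorem to a second difference; comparing
   both orders yields Schwarz's theorem [derive_comm]. *)
Lemma second_difference (U : set V) (f : V -> R) (x v w : V) (h : R) :
  smooth_on U f -> 0 < h ->
  (forall s t, 0 <= s <= h -> 0 <= t <= h -> U (x + s *: v + t *: w)) ->
  exists s t, [/\ 0 <= s <= h, 0 <= t <= h &
    f (x + h *: v + h *: w) - f (x + h *: v) - (f (x + h *: w) - f x)
    = 'D_w ('D_v f) (x + s *: v + t *: w) * h * h].
Proof.
move=> sf h0 Ux.
have [df /(_ v)[dDf _]] := sf 2%N.
have hh : 0 <= h <= h by rewrite ltW ?lexx.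
have h00 : 0 <= (0 : R) <= h by rewrite lexx ltW.
pose g s := f (x + h *: w + s *: v) - f (x + s *: v).
have gd s : 0 <= s <= h ->
    is_derive s 1 g ('D_v f (x + h *: w + s *: v) - 'D_v f (x + s *: v)).
  move=> sh; apply: is_deriveB; apply/is_derive_line/derivableP/diff_derivable/df.
    by rewrite addrAC; exact: Ux.
  by have := Ux s 0 sh h00; rewrite scale0r addr0.
have sub (a : R) : a \in `]0, h[ -> 0 <= a <= h.
  by rewrite in_itv/= => /andP[/ltW -> /ltW ->].
have [s sh gs] : exists2 s, s \in `]0, h[ & g h - g 0 =
    ('D_v f (x + h *: w + s *: v) - 'D_v f (x + s *: v)) * (h - 0).
  apply: (MVT h0) => [s /sub sh|]; first exact: gd.
  apply: derivable_within_continuous => s; rewrite in_itv/= => sh.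
  by have [] := gd s sh.
pose k t := 'D_v f (x + s *: v + t *: w).
have kd t : 0 <= t <= h -> is_derive t 1 k ('D_w ('D_v f) (x + s *: v + t *: w)).
  move=> th; apply: (@is_derive_line _ ('D_v f) (x + s *: v)); apply/derivableP/diff_derivable/dDf.
  by apply: Ux => //; exact: sub.
have [t th kt] : exists2 t, t \in `]0, h[ & k h - k 0 =
    'D_w ('D_v f) (x + s *: v + t *: w) * (h - 0).
  apply: (MVT h0) => [t /sub th|]; first exact: kd.
  apply: derivable_within_continuous => t; rewrite in_itv/= => th.
  by have [] := kd t th.
exists s, t; split; [exact: sub|exact: sub|].
move: gs kt; rewrite /g /k !scale0r !addr0 !subr0 => gs kt.
rewrite [x + h *: w + s *: v]addrAC kt [x + h *: w + h *: v]addrAC in gs.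
by rewrite -gs; ring.
Qed.

Lemma mixed_cancel (p q r s a b h : R) : h != 0 ->
  p - q - (r - s) = a * h * h -> p - r - (q - s) = b * h * h -> a = b.
Proof.
move=> h0 E1 E2; apply: (mulIf h0); apply: (mulIf h0).
by rewrite -E1 -E2; ring.
Qed.

Lemma dist_le_split (p q a e : R) :
  `|p - a| <= e / 2 -> `|q - a| <= e / 2 -> `|p - q| <= e.
Proof. by rewrite !ler_norml => ? ?; lra. Qed.

Lemma derive_comm (U : set V) (f : V -> R) (x v w : V) :
  open U -> smooth_on U f -> U x -> 'D_v ('D_w f) x = 'D_w ('D_v f) x.
Proof.
move=> oU sf Ux.
have cf a b : {for x, continuous ('D_a ('D_b f))}.
  by have [_ /(_ b)[_ /(_ a)]] := sf 2%N; apply.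
apply/eqP; rewrite -subr_eq0 -normr_le0; apply/ler_addgt0Pr => e e0.
rewrite add0r.
have e20 : 0 < e / 2 by rewrite divr_gt0.
have Ux' : \forall y \near x, U y by exact: (open_nbhs_nbhs (conj oU Ux)).
have n1 : \forall y \near x, `|'D_v ('D_w f) x - 'D_v ('D_w f) y| < e / 2.
  by move/cvgrPdist_lt : (cf v w) => /(_ _ e20).
have n2 : \forall y \near x, `|'D_w ('D_v f) x - 'D_w ('D_v f) y| < e / 2.
  by move/cvgrPdist_lt : (cf w v) => /(_ _ e20).
have [d /= d0 dP] := (nbhs_ballP _ _).1 (filterI Ux' (filterI n1 n2)).
(* The parallelogram at x with sides h v and h w then lies in the ball of radius d; the summand 1
   covers v = w = 0. *)
pose h := d / (`|v| + `|w| + 1).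
have n0 : 0 < `|v| + `|w| + 1 by rewrite ltr_wpDl// addr_ge0.
have h0 : 0 < h by rewrite divr_gt0.
have near_x s t : 0 <= s <= h -> 0 <= t <= h -> ball x d (x + s *: v + t *: w).
  move=> /andP[s0 sh] /andP[t0 th].
  rewrite -ball_normE /= -addrA opprD addNKr normrN.
  rewrite (le_lt_trans (ler_normD _ _))// !normrZ !ger0_norm//.
  rewrite (@le_lt_trans _ _ (h * `|v| + h * `|w|))//.
    by rewrite lerD// ler_wpM2r.
  by rewrite -mulrDr /h mulrAC ltr_pdivrMr// ltr_pM2l// ltrDl.
have [s1 [t1 [hs1 ht1 E1]]] : exists s t, [/\ 0 <= s <= h, 0 <= t <= h &
    f (x + h *: v + h *: w) - f (x + h *: v) - (f (x + h *: w) - f x)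
    = 'D_w ('D_v f) (x + s *: v + t *: w) * h * h].
  apply: (second_difference sf) => // s t hs ht.
  by have [] := dP _ (near_x s t hs ht).
have [s2 [t2 [hs2 ht2 E2]]] : exists s t, [/\ 0 <= s <= h, 0 <= t <= h &
    f (x + h *: w + h *: v) - f (x + h *: w) - (f (x + h *: v) - f x)
    = 'D_v ('D_w f) (x + s *: w + t *: v) * h * h].
  apply: (second_difference sf) => // s t hs ht.
  by rewrite addrAC; have [] := dP _ (near_x t s ht hs).
(* The two second differences are the same number with the two middle terms exchanged. *)
have E : 'D_w ('D_v f) (x + s1 *: v + t1 *: w) = 'D_v ('D_w f) (x + t2 *: v + s2 *: w).
  rewrite [x + h *: w + h *: v]addrAC [x + s2 *: w + _]addrAC in E2.
  exact: mixed_cancel (lt0r_neq0 h0) E1 E2.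
have [_ [_ A1]] := dP _ (near_x _ _ hs1 ht1).
have [_ [A2 _]] := dP _ (near_x _ _ ht2 hs2).
rewrite -E in A2.
set a := 'D_w ('D_v f) (x + s1 *: v + t1 *: w) in A1 A2.
exact: dist_le_split (ltW A2) (ltW A1).
Qed.

End SmoothFunctions.

Section SmoothOn.
Context {R : realType} {V : normedModType R}.
Variables (U : set V) (oU : open U).

Lemma smooth_on_eq {W : normedModType R} (F G : V -> W) :
  (forall x, U x -> F x = G x) -> smooth_on U F -> smooth_on U G.
Proof. by move=> FG sF k; exact: (Ck_on_eq oU FG (sF k)). Qed.

Lemma smooth_on_differentiable {W : normedModType R} (F : V -> W) x :
  smooth_on U F -> U x -> differentiable F x.
Proof. by move=> /(_ 1%N) /= [dF _]; exact: dF. Qed.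

Lemma smooth_on_is_derive {W : normedModType R} (F : V -> W) x v :
  smooth_on U F -> U x -> is_derive x v F ('D_v F x).
Proof.
by move=> sF Ux; apply/derivableP/diff_derivable/(smooth_on_differentiable sF).
Qed.

Lemma smooth_on_derive {W : normedModType R} (F : V -> W) v :
  smooth_on U F -> smooth_on U ('D_v F).
Proof. by move=> sF k; have /= [_] := sF k.+1; exact. Qed.

Lemma smooth_on_cst {W : normedModType R} (a : W) : smooth_on U (fun _ => a).
Proof. by move=> k; exact: (Ck_on_cst oU). Qed.

Lemma smooth_onD {W : normedModType R} (F G : V -> W) :
  smooth_on U F -> smooth_on U G -> smooth_on U (fun x => F x + G x).
Proof. by move=> sF sG k; exact: (Ck_onD oU (sF k) (sG k)). Qed.

Lemma smooth_onM (F G : V -> R) :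
  smooth_on U F -> smooth_on U G -> smooth_on U (fun x => F x * G x).
Proof. by move=> sF sG k; exact: (Ck_onM oU (sF k) (sG k)). Qed.

Lemma smooth_on_lin {W W' : normedModType R} (f : {linear W -> W'}) (F : V -> W) :
  continuous f -> smooth_on U F -> smooth_on U (fun x => f (F x)).
Proof. by move=> cf sF k; exact: (Ck_on_lin oU cf (sF k)). Qed.

Lemma smooth_onN {W : normedModType R} (F : V -> W) :
  smooth_on U F -> smooth_on U (fun x => - F x).
Proof. by apply: smooth_on_lin => x; exact: continuousN. Qed.

Lemma smooth_onB {W : normedModType R} (F G : V -> W) :
  smooth_on U F -> smooth_on U G -> smooth_on U (fun x => F x - G x).
Proof. by move=> sF sG; apply: smooth_onD => //; exact: smooth_onN. Qed.

Lemma smooth_onX (F : V -> R) k :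
  smooth_on U F -> smooth_on U (fun x => F x ^+ k).
Proof.
move=> sF; elim: k => [|k IHk].
  by apply: smooth_on_eq (smooth_on_cst (1 : R)) => x _.
apply: smooth_on_eq (smooth_onM sF IHk) => x _.
by rewrite exprS.
Qed.

Lemma smooth_on_sum {W : normedModType R} (I : Type) (r : seq I) (P : pred I)
    (F : I -> V -> W) : (forall i, smooth_on U (F i)) ->
  smooth_on U (fun x => \sum_(i <- r | P i) F i x).
Proof.
move=> sF; elim: r => [|i r IHr].
  by apply: smooth_on_eq (smooth_on_cst (0 : W)) => x _; rewrite big_nil.
case Pi: (P i).
  by apply: smooth_on_eq (smooth_onD (sF i) IHr) => x _; rewrite big_cons Pi.
by apply: smooth_on_eq IHr => x _; rewrite big_cons Pi.
Qed.

Lemma smooth_on_scalel {W : normedModType R} (f : V -> R) (a : W) :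
  smooth_on U f -> smooth_on U (fun x => f x *: a).
Proof.
have lin : linear ( *:%R^~ a : R -> W).
  by move=> k u v /=; rewrite scalerDl -scalerA.
pose aM := GRing.isLinear.Build _ _ _ _ _ lin.
pose aL : {linear R -> W} := HB.pack ( *:%R^~ a : R -> W) aM.
by move=> sf; apply: (@smooth_on_lin _ _ aL) => //; exact: scalel_continuous.
Qed.

Lemma smooth_on_coord m (F : V -> 'rV[R]_m) i :
  smooth_on U F -> smooth_on U (fun x => F x 0 i).
Proof.
have lin : linear (fun M : 'rV[R]_m => M 0 i).
  by move=> k u v /=; rewrite !mxE.
pose iM := GRing.isLinear.Build _ _ _ _ _ lin.
pose iL : {linear 'rV[R]_m -> R} := HB.pack (fun M : 'rV[R]_m => M 0 i) iM.
by apply: (@smooth_on_lin _ _ iL) => //; exact: coord_continuous.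
Qed.

Lemma smooth_on_rowP m (F : V -> 'rV[R]_m) :
  (forall i, smooth_on U (fun x => F x 0 i)) -> smooth_on U F.
Proof.
move=> sF; apply: (@smooth_on_eq _ (fun x => \sum_i F x 0 i *: delta_mx 0 i)).
  by move=> x _; rewrite -row_sum_delta.
by apply: smooth_on_sum => i; exact: smooth_on_scalel.
Qed.

Lemma smooth_onZ m (f : V -> R) (F : V -> 'rV[R]_m) :
  smooth_on U f -> smooth_on U F -> smooth_on U (fun x => f x *: F x).
Proof.
move=> sf sF; apply: smooth_on_rowP => i.
apply: smooth_on_eq (smooth_onM sf (smooth_on_coord i sF)) => x _.
by rewrite mxE.
Qed.

Lemma smooth_on_id : smooth_on U (fun x : V => x).
Proof.
case=> [|k] /=; first by move=> x _; exact: cvg_id.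
split=> [x _|v]; first exact: ex_diff.
by apply: (Ck_on_eq oU _ (Ck_on_cst oU k v)) => x _; rewrite derive_id.
Qed.

End SmoothOn.

Lemma smooth_onS {R : realType} {V W : normedModType R} (U U' : set V) (F : V -> W) :
  U' `<=` U -> smooth_on U F -> smooth_on U' F.
Proof.
move=> UU' sF k; have := sF k; elim: k F {sF} => [|k IHk] F /=.
  by move=> cF x /UU'; exact: cF.
move=> [dF CF]; split=> [x /UU'|v]; [exact: dF|exact/IHk/CF].
Qed.

Section Derive.
Context {R : realType} {V : normedModType R}.

Lemma deriveDv {W : normedModType R} (F : V -> W) x a v w :
  differentiable F x -> 'D_(a *: v + w) F x = a *: 'D_v F x + 'D_w F x.
Proof. by move=> dF; rewrite !deriveE// linearP. Qed.

Lemma derive_sumv {W : normedModType R} (F : V -> W) x (I : Type) (r : seq I)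
    (P : pred I) (a : I -> R) (v : I -> V) : differentiable F x ->
  'D_(\sum_(i <- r | P i) a i *: v i) F x = \sum_(i <- r | P i) a i *: 'D_(v i) F x.
Proof.
move=> dF; rewrite deriveE// linear_sum; apply: eq_bigr => i _.
by rewrite linearZ/= deriveE.
Qed.

Lemma is_derive_eqE {W : normedModType R} (F : V -> W) x v d d' :
  is_derive x v F d -> is_derive x v F d' -> d = d'.
Proof. by move=> [_ <-] [_ <-]. Qed.

Lemma is_derive_rowP m (F : V -> 'rV[R]_m) x v (d : 'rV[R]_m) :
  is_derive x v F d <-> forall i, is_derive x v (fun y => F y 0 i) (d 0 i).
Proof.
split=> [[dF <-] i|H].
  split; first by move/derivable_mxP : dF => /(_ 0 i).
  by rewrite derive_mx// mxE.
have dF : derivable F x v.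
  by apply/derivable_mxP => i j; rewrite ord1; have [] := H j.
split=> //; rewrite derive_mx//; apply/rowP => i; rewrite !mxE.
by have [] := H i.
Qed.

Lemma is_derive_scale m (f : V -> R) (F : V -> 'rV[R]_m) x v df (dF : 'rV[R]_m) :
  is_derive x v f df -> is_derive x v F dF ->
  is_derive x v (fun y => f y *: F y) (df *: F x + f x *: dF).
Proof.
move=> Hf /is_derive_rowP HF; apply/is_derive_rowP => i.
have -> : (fun y => (f y *: F y) 0 i) = f * (fun y => F y 0 i).
  by apply/funext => y; rewrite mxE.
have := HF i => HFi; apply: is_derive_eq.
by rewrite !mxE /GRing.scale/= addrC [df * _]mulrC.
Qed.

Lemma is_derive_sumr (I : Type) (r : seq I) (P : pred I) {W : normedModType R}
    (F : I -> V -> W) x v (dF : I -> W) :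
  (forall i, is_derive x v (F i) (dF i)) ->
  is_derive x v (fun y => \sum_(i <- r | P i) F i y) (\sum_(i <- r | P i) dF i).
Proof.
move=> H; elim: r => [|i r IHr].
  under eq_fun do rewrite big_nil; rewrite big_nil; exact: is_derive_cst.
rewrite big_cons; case Pi: (P i); last first.
  by under eq_fun do rewrite big_cons Pi.
under eq_fun do rewrite big_cons Pi; exact: is_deriveD.
Qed.

End Derive.

Lemma derive_rowE {R : realType} m {W : normedModType R} (F : 'rV[R]_m -> W) x v :
  differentiable F x -> 'D_v F x = \sum_i v 0 i *: 'D_(delta_mx 0 i) F x.
Proof.
move=> dF; have := derive_sumv (index_enum 'I_m) xpredT (v 0) (delta_mx 0) dF.
by rewrite -row_sum_delta.
Qed.

(** * Calculus on the sphere *)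

Section Dot.
Context {R : realType} {n : nat}.
Implicit Types (u v w x y p : ambient R n) (a b : R).

Lemma dotC u v : dot u v = dot v u.
Proof. by apply: eq_bigr => i _; rewrite mulrC. Qed.

Lemma dotDl u v w : dot (u + v) w = dot u w + dot v w.
Proof. by rewrite -big_split; apply: eq_bigr => i _; rewrite mxE mulrDl. Qed.

Lemma dotZl a u w : dot (a *: u) w = a * dot u w.
Proof. by rewrite /dot mulr_sumr; apply: eq_bigr => i _; rewrite mxE mulrA. Qed.

Lemma dotNl u w : dot (- u) w = - dot u w.
Proof. by rewrite -scaleN1r dotZl mulN1r. Qed.

Lemma dotDr u v w : dot w (u + v) = dot w u + dot w v.
Proof. by rewrite ![dot w _]dotC dotDl. Qed.

Lemma dotZr a u w : dot w (a *: u) = a * dot w u.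
Proof. by rewrite ![dot w _]dotC dotZl. Qed.

Lemma dotNr u w : dot w (- u) = - dot w u.
Proof. by rewrite ![dot w _]dotC dotNl. Qed.

Lemma dot0l u : dot 0 u = 0.
Proof. by rewrite -(scale0r 0) dotZl mul0r. Qed.

Lemma dot0r u : dot u 0 = 0.
Proof. by rewrite dotC dot0l. Qed.

Lemma dot_suml (I : Type) (r : seq I) (P : pred I) (F : I -> ambient R n) w :
  dot (\sum_(i <- r | P i) F i) w = \sum_(i <- r | P i) dot (F i) w.
Proof.
elim: r => [|i r IHr]; first by rewrite !big_nil dot0l.
by rewrite !big_cons; case: (P i); rewrite // dotDl IHr.
Qed.

Lemma dot_sumr (I : Type) (r : seq I) (P : pred I) (F : I -> ambient R n) w :
  dot w (\sum_(i <- r | P i) F i) = \sum_(i <- r | P i) dot w (F i).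
Proof. by rewrite dotC dot_suml; apply: eq_bigr => i _; rewrite dotC. Qed.

Lemma dot_delta i v : dot (delta_mx 0 i) v = v 0 i.
Proof.
rewrite /dot (bigD1 i)//= big1 => [|j ji]; first by rewrite mxE !eqxx mul1r addr0.
by rewrite mxE eqxx (negPf ji) mul0r.
Qed.

Lemma dot_delta2 i j : dot (delta_mx 0 i : ambient R n) (delta_mx 0 j) = (i == j)%:R.
Proof. by rewrite dot_delta mxE eqxx. Qed.

Lemma dotP u v : (forall w, dot u w = dot v w) -> u = v.
Proof.
by move=> uv; apply/rowP => i; rewrite -!dot_delta ![dot (delta_mx _ _) _]dotC uv.
Qed.

Lemma dot_ge0 u : 0 <= dot u u.
Proof. by apply: sumr_ge0 => i _; rewrite -expr2 sqr_ge0. Qed.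

Lemma dot_eq0 u : (dot u u == 0) = (u == 0).
Proof.
apply/eqP/eqP => [|->]; last exact: dot0l.
move=> /psumr_eq0P u0; apply/rowP => i; rewrite mxE; apply/eqP.
by rewrite -[_ == 0]orbb -mulf_eq0; apply/eqP/u0 => // j _; rewrite -expr2 sqr_ge0.
Qed.

Lemma dot_gt0 u : (0 < dot u u) = (u != 0).
Proof. by rewrite lt_def dot_ge0 dot_eq0 andbT. Qed.

(** Multiplication by i on C^(n+1). The Reeb field at p is [mulI p] and theta is the inner product
    with it, so that all CR data becomes algebra with [dot] and [mulI]. *)
Definition mulI u : ambient R n := row_mx (- rsubmx u) (lsubmx u).

Lemma mulI_lshift u j : mulI u 0 (lshift _ j) = - u 0 (rshift _ j).
Proof. by rewrite /mulI row_mxEl !mxE. Qed.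

Lemma mulI_rshift u j : mulI u 0 (rshift _ j) = u 0 (lshift _ j).
Proof. by rewrite /mulI row_mxEr !mxE. Qed.

Lemma mulI_is_linear : linear mulI.
Proof.
move=> a u v; apply/rowP => i; rewrite -(splitK i); case: (fintype.split i) => j /=.
  by rewrite !(mulI_lshift, mxE) opprD mulrN.
by rewrite !(mulI_rshift, mxE).
Qed.

HB.instance Definition _ := GRing.isLinear.Build R (ambient R n) (ambient R n) _
  mulI mulI_is_linear.

Lemma mulIK u : mulI (mulI u) = - u.
Proof.
apply/rowP => i; rewrite -(splitK i); case: (fintype.split i) => j /=.
  by rewrite mulI_lshift mulI_rshift mxE.
by rewrite mulI_rshift mulI_lshift mxE.
Qed.

Lemma dotE u v : dot u v = \sum_j (xcoord u j * xcoord v j + ycoord u j * ycoord v j).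
Proof. by rewrite /dot big_split_ord big_split. Qed.

Lemma xcoordI u j : xcoord (mulI u) j = - ycoord u j.
Proof. exact: mulI_lshift. Qed.

Lemma ycoordI u j : ycoord (mulI u) j = xcoord u j.
Proof. exact: mulI_rshift. Qed.

Lemma dot_mulI u v : dot (mulI u) (mulI v) = dot u v.
Proof.
rewrite !dotE; apply: eq_bigr => j _.
by rewrite !xcoordI !ycoordI mulrNN addrC.
Qed.

Lemma dot_mulIl u v : dot (mulI u) v = - dot u (mulI v).
Proof. by rewrite -dot_mulI mulIK dotNl. Qed.

Lemma dot_mulIr u : dot u (mulI u) = 0.
Proof.
have : dot u (mulI u) = - dot u (mulI u) by rewrite {1}dotC dot_mulIl.
by move=> /eqP; rewrite -addr_eq0 -mulr2n mulrn_eq0 => /eqP.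
Qed.

Lemma dot_mulIl0 u : dot (mulI u) u = 0.
Proof. by rewrite dotC dot_mulIr. Qed.

Lemma mulIDl u v : mulI (u + v) = mulI u + mulI v. Proof. by rewrite linearD. Qed.
Lemma mulIZ a u : mulI (a *: u) = a *: mulI u.
Proof. by rewrite linearZ. Qed.
Lemma mulIN u : mulI (- u) = - mulI u. Proof. by rewrite linearN. Qed.

End Dot.

Section DotSmooth.
Context {R : realType} {n : nat} {V : normedModType R}.
Variables (U : set V) (oU : open U).

Lemma smooth_on_dot (F G : V -> ambient R n) :
  smooth_on U F -> smooth_on U G -> smooth_on U (fun x => dot (F x) (G x)).
Proof.
move=> sF sG; apply: smooth_on_sum => // i.
by apply: smooth_onM => //; exact: smooth_on_coord.
Qed.

Lemma smooth_on_mulI (F : V -> ambient R n) :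
  smooth_on U F -> smooth_on U (fun x => mulI (F x)).
Proof.
move=> sF; apply: smooth_on_rowP => // i.
rewrite -(splitK i); case: (fintype.split i) => j /=.
  apply: smooth_on_eq (smooth_onN oU (smooth_on_coord oU (rshift n.+1 j) sF)) => // x _.
  by rewrite mulI_lshift.
apply: smooth_on_eq (smooth_on_coord oU (lshift n.+1 j) sF) => // x _.
by rewrite mulI_rshift.
Qed.

Lemma is_derive_dot (F G : V -> ambient R n) x v dF dG :
  is_derive x v F dF -> is_derive x v G dG ->
  is_derive x v (fun y => dot (F y) (G y)) (dot dF (G x) + dot (F x) dG).
Proof.
move=> /is_derive_rowP HF /is_derive_rowP HG; rewrite /dot -big_split.
apply: is_derive_sumr => i; have hF := HF i; have hG := HG i.
have := is_deriveM (f := fun y => F y 0 i) (g := fun y => G y 0 i) hF hG.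
by move=> H; apply: (is_derive_eq H); rewrite /GRing.scale/= addrC [G x 0 i * _]mulrC.
Qed.

Lemma is_derive_mulI (F : V -> ambient R n) x v dF :
  is_derive x v F dF -> is_derive x v (fun y => mulI (F y)) (mulI dF).
Proof.
move=> /is_derive_rowP HF; apply/is_derive_rowP => i.
rewrite -(splitK i); case: (fintype.split i) => j /=.
  under eq_fun do rewrite mulI_lshift; rewrite mulI_lshift.
  exact: is_deriveN.
under eq_fun do rewrite mulI_rshift; rewrite mulI_rshift.
exact: HF.
Qed.

End DotSmooth.

Definition punctured (R : realType) (n : nat) : set (ambient R n) := [set x | x != 0].

(** * The radial retraction onto the sphere *)

Section Retract.
Context {R : realType} {n : nat}.
Implicit Types (u v w x y p : ambient R n) (a b : R).
Local Notation U0 := (@punctured R n).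

Lemma open_punctured : open U0.
Proof.
rewrite (_ : U0 = ~` [set 0]);
  first by apply: closed_openC; exact/accessible_closed_set1/hausdorff_accessible/norm_hausdorff.
by apply/seteqP; split => x /=; rewrite /punctured/= => /eqP.
Qed.

Definition ninv x : R := (Num.sqrt (dot x x))^-1.

Lemma ninv_gt0 x : x != 0 -> 0 < ninv x.
Proof. by move=> x0; rewrite invr_gt0 sqrtr_gt0 dot_gt0. Qed.

Lemma ninv_sqr x : x != 0 -> ninv x ^+ 2 * dot x x = 1.
Proof.
by move=> x0; rewrite exprVn sqr_sqrtr ?dot_ge0// mulVf// dot_eq0.
Qed.

Lemma retractE x : retract x = ninv x *: x. Proof. by []. Qed.

Lemma sphere_neq0 p : sphere p -> p != 0.
Proof. by rewrite /sphere/= -dot_eq0 => ->; exact: oner_neq0. Qed.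

Lemma sphere_retract x : x != 0 -> sphere (retract x).
Proof. by move=> x0; rewrite /sphere/= retractE dotZl dotZr mulrA -expr2 ninv_sqr. Qed.

Lemma ninv1 p : sphere p -> ninv p = 1.
Proof. by rewrite /sphere/ninv/= => ->; rewrite sqrtr1 invr1. Qed.

Lemma retract_id p : sphere p -> retract p = p.
Proof. by move=> sp; rewrite retractE ninv1// scale1r. Qed.

Lemma ninvZ a x : 0 < a -> ninv (a *: x) = a^-1 * ninv x.
Proof.
move=> a0; rewrite /ninv dotZl dotZr mulrA -expr2 sqrtrM ?sqr_ge0//.
by rewrite sqrtr_sqr gtr0_norm// invfM.
Qed.

Lemma retractZ a x : 0 < a -> retract (a *: x) = retract x.
Proof.
move=> a0; rewrite !retractE ninvZ// scalerA mulrAC mulVf ?mul1r//.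
exact: lt0r_neq0.
Qed.

Lemma is_derive_sqdot x v : is_derive x v (fun y => dot y y) (2 * dot x v).
Proof.
have H := is_derive_dot (is_derive_id x v) (is_derive_id x v).
by apply: (is_derive_eq H); rewrite dotC; ring.
Qed.

Lemma smooth_on_sqdot U : open U -> smooth_on U (fun y : ambient R n => dot y y).
Proof. by move=> oU; apply: smooth_on_dot => //; exact: smooth_on_id. Qed.

Lemma ninv_differentiable x : x != 0 -> differentiable ninv x.
Proof.
move=> x0; apply: (@differentiableV R (ambient R n) (fun y => Num.sqrt (dot y y))).
  apply: (@differentiable_comp _ _ _ _ (fun y : ambient R n => dot y y) (@Num.sqrt R)).
    exact: (smooth_on_differentiable (smooth_on_sqdot open_punctured)).
  apply/derivable1_diffP; have dx : 0 < dot x x by rewrite dot_gt0.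
  by have [] := is_derive1_sqrt dx.
by rewrite gt_eqF// sqrtr_gt0 dot_gt0.
Qed.

(** Obtained by differentiating the identity [ninv_sqr] instead of the square root. *)
Lemma derive_ninv x v : x != 0 -> 'D_v ninv x = - (dot x v * ninv x ^+ 3).
Proof.
move=> x0.
have Hn : is_derive x v ninv ('D_v ninv x).
  by apply/derivableP/diff_derivable/ninv_differentiable.
have H1 := is_deriveM (is_deriveM Hn Hn) (is_derive_sqdot x v).
have H2 : is_derive x v (ninv * ninv * (fun y => dot y y)) 0.
  apply: (@near_eq_is_derive R (ambient R n) R (fun _ => 1)).
  near=> y; rewrite /= !fctE -expr2 ninv_sqr//.
  by near: y; exact: (open_nbhs_nbhs (conj open_punctured x0)).
have := is_derive_eqE H1 H2; rewrite !fctE /GRing.scale/=.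
set d := 'D_v _ _ => E; have N := ninv_sqr x0; have N0 := lt0r_neq0 (ninv_gt0 x0).
apply: (mulfI N0); apply: (mulIf (x := 2)) => //.
move: E; set m := ninv x in N N0 *; set q := dot x x in N *; set s := dot x v.
move=> E.
have {}E : m ^+ 2 * (2 * s) + 2 * (m * q * d) = 0 by rewrite -E; ring.
(* The extra factor m^2 produces m^2 q, which equals 1 by [N]. *)
have : m ^+ 2 * (m ^+ 2 * (2 * s) + 2 * (m * q * d)) = 0 by rewrite E mulr0.
have -> : m ^+ 2 * (m ^+ 2 * (2 * s) + 2 * (m * q * d)) =
    2 * s * m ^+ 4 + 2 * m * d * (m ^+ 2 * q) by ring.
by rewrite N => E2; apply/eqP; rewrite -subr_eq0; apply/eqP; rewrite -E2; ring.
Unshelve. all: by end_near. Qed.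

(** The derivatives of [ninv] are polynomial in [ninv] and the coordinates, so the induction on the
    order closes on itself. *)
Lemma smooth_on_ninv : smooth_on U0 ninv.
Proof.
elim=> [|k IHk]; first by move=> x x0; exact/differentiable_continuous/ninv_differentiable.
split=> [x|v]; first exact: ninv_differentiable.
have oU := open_punctured.
have Cd : Ck_on U0 k (fun x => dot x v).
  by apply: smooth_on_dot => //; [exact: smooth_on_id|exact: smooth_on_cst].
have C3 := Ck_onM oU Cd (Ck_onM oU IHk (Ck_onM oU IHk IHk)).
have C4 := Ck_onM oU (Ck_on_cst oU k (-1 : R)) C3.
by apply: (Ck_on_eq oU _ C4) => x x0; rewrite derive_ninv// !fctE; ring.
Qed.

Lemma smooth_on_retract : smooth_on U0 (@retract R n).
Proof.
apply: smooth_onZ; [exact: open_punctured|exact: smooth_on_ninv|].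
exact/smooth_on_id/open_punctured.
Qed.

Lemma is_derive_retract p v : sphere p -> tangent p v -> is_derive p v (@retract R n) v.
Proof.
move=> sp tv; have p0 := sphere_neq0 sp.
have Hn : is_derive p v ninv 0.
  have H : is_derive p v ninv _ := derivableP (diff_derivable (ninv_differentiable p0)).
  apply: (is_derive_eq H).
  by rewrite derive_ninv// tv mul0r oppr0.
have H := is_derive_scale Hn (is_derive_id p v).
by apply: (is_derive_eq H); rewrite scale0r add0r ninv1// scale1r.
Qed.

End Retract.

(** * Smooth functions on the sphere and their differentials *)

Section SmoothFun.
Context {R : realType} {n : nat}.
Implicit Types (u v w x y p : ambient R n) (a b : R).
Local Notation U0 := (@punctured R n).
Local Notation oU0 := (@open_punctured R n).

Lemma smooth_funE {W : normedModType R} (F : ambient R n -> W) :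
  smooth_fun F = smooth_on U0 (fun x => F (retract x)).
Proof. by []. Qed.

Lemma smooth_fun_eq {W : normedModType R} (F G : ambient R n -> W) :
  (forall p, sphere p -> F p = G p) -> smooth_fun F -> smooth_fun G.
Proof.
move=> FG; apply: (smooth_on_eq oU0) => x x0 /=; apply: FG.
exact: sphere_retract.
Qed.

Lemma smooth_fun_cst {W : normedModType R} (a : W) :
  smooth_fun (fun _ : ambient R n => a).
Proof. exact: (smooth_on_cst oU0). Qed.

Lemma smooth_funD {W : normedModType R} (F G : ambient R n -> W) :
  smooth_fun F -> smooth_fun G -> smooth_fun (fun x => F x + G x).
Proof. exact: (smooth_onD oU0). Qed.

Lemma smooth_funN {W : normedModType R} (F : ambient R n -> W) :
  smooth_fun F -> smooth_fun (fun x => - F x).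
Proof. exact: (smooth_onN oU0). Qed.

Lemma smooth_funB {W : normedModType R} (F G : ambient R n -> W) :
  smooth_fun F -> smooth_fun G -> smooth_fun (fun x => F x - G x).
Proof. exact: (smooth_onB oU0). Qed.

Lemma smooth_funZ m (f : ambient R n -> R) (F : ambient R n -> 'rV[R]_m) :
  smooth_fun f -> smooth_fun F -> smooth_fun (fun x => f x *: F x).
Proof. exact: (smooth_onZ oU0). Qed.

Lemma smooth_fun_coord m (F : ambient R n -> 'rV[R]_m) i :
  smooth_fun F -> smooth_fun (fun x => F x 0 i).
Proof. exact: (smooth_on_coord oU0). Qed.

Lemma smooth_fun_rowP m (F : ambient R n -> 'rV[R]_m) :
  (forall i, smooth_fun (fun x => F x 0 i)) -> smooth_fun F.
Proof. exact: (smooth_on_rowP oU0). Qed.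

Lemma smooth_fun_dot (F G : ambient R n -> ambient R n) :
  smooth_fun F -> smooth_fun G -> smooth_fun (fun x => dot (F x) (G x)).
Proof. exact: (smooth_on_dot oU0). Qed.

Lemma smooth_fun_mulI (F : ambient R n -> ambient R n) :
  smooth_fun F -> smooth_fun (fun x => mulI (F x)).
Proof. exact: (smooth_on_mulI oU0). Qed.

Lemma smooth_fun_id : smooth_fun (fun x : ambient R n => x).
Proof. exact: smooth_on_retract. Qed.

Lemma smooth_fun_differentiable {W : normedModType R} (F : ambient R n -> W) x :
  smooth_fun F -> x != 0 -> differentiable (F \o @retract R n) x.
Proof. by move=> sF; exact: (smooth_on_differentiable sF). Qed.

Lemma dS_is_derive {W : normedModType R} (F : ambient R n -> W) p v :
  smooth_fun F -> sphere p -> is_derive p v (F \o @retract R n) (dS F p v).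
Proof. by move=> sF sp; apply: (smooth_on_is_derive v sF); exact: sphere_neq0. Qed.

Lemma dS_eq {W : normedModType R} (F G : ambient R n -> W) p v :
  (forall q, sphere q -> F q = G q) -> sphere p -> dS F p v = dS G p v.
Proof.
move=> FG sp; apply: near_eq_derive.
have := open_nbhs_nbhs (conj oU0 (sphere_neq0 sp)).
rewrite -nbhs_nearE; apply: filterS => y y0 /=; apply: FG.
exact: sphere_retract.
Qed.

Section Rules.
Context {p : ambient R n} (sp : sphere p).

Lemma dS_cst {W : normedModType R} (a : W) v : dS (fun _ => a) p v = 0.
Proof. exact: derive_cst. Qed.

Lemma dSD {W : normedModType R} (F G : ambient R n -> W) v :
  smooth_fun F -> smooth_fun G ->
  dS (fun x => F x + G x) p v = dS F p v + dS G p v.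
Proof.
move=> sF sG.
have [_] := is_deriveD (dS_is_derive v sF sp) (dS_is_derive v sG sp).
exact.
Qed.

Lemma dSN {W : normedModType R} (F : ambient R n -> W) v :
  smooth_fun F -> dS (fun x => - F x) p v = - dS F p v.
Proof. by move=> sF; have [_] := is_deriveN (dS_is_derive v sF sp); exact. Qed.

Lemma dSB {W : normedModType R} (F G : ambient R n -> W) v :
  smooth_fun F -> smooth_fun G ->
  dS (fun x => F x - G x) p v = dS F p v - dS G p v.
Proof. by move=> sF sG; rewrite dSD ?dSN//; exact: smooth_funN. Qed.

Lemma dSZ m (f : ambient R n -> R) (F : ambient R n -> 'rV[R]_m) v :
  smooth_fun f -> smooth_fun F ->
  dS (fun x => f x *: F x) p v = dS f p v *: F p + f p *: dS F p v.
Proof.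
move=> sf sF.
have [_] := is_derive_scale (dS_is_derive v sf sp) (dS_is_derive v sF sp).
by rewrite /= !retract_id.
Qed.

Lemma dS_dot (F G : ambient R n -> ambient R n) v :
  smooth_fun F -> smooth_fun G ->
  dS (fun x => dot (F x) (G x)) p v = dot (dS F p v) (G p) + dot (F p) (dS G p v).
Proof.
move=> sF sG.
have [_] := is_derive_dot (dS_is_derive v sF sp) (dS_is_derive v sG sp).
by rewrite /= !retract_id.
Qed.

Lemma dS_mulI (F : ambient R n -> ambient R n) v :
  smooth_fun F -> dS (fun x => mulI (F x)) p v = mulI (dS F p v).
Proof. by move=> sF; have [_] := is_derive_mulI (dS_is_derive v sF sp). Qed.

Lemma dS_id v : tangent p v -> dS (fun x => x) p v = v.
Proof. by move=> tv; have [] := is_derive_retract sp tv. Qed.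

Lemma dS_coord m (F : ambient R n -> 'rV[R]_m) v i :
  smooth_fun F -> dS (fun x => F x 0 i) p v = dS F p v 0 i.
Proof.
move=> sF; have := (is_derive_rowP _ _ _ _).1 (dS_is_derive v sF sp) i.
by case.
Qed.

Lemma dS_lin {W : normedModType R} (F : ambient R n -> W) a v w :
  smooth_fun F -> dS F p (a *: v + w) = a *: dS F p v + dS F p w.
Proof.
by move=> sF; apply/deriveDv/(smooth_fun_differentiable sF)/sphere_neq0.
Qed.

Lemma dS_Dv {W : normedModType R} (F : ambient R n -> W) v w :
  smooth_fun F -> dS F p (v + w) = dS F p v + dS F p w.
Proof. by move=> sF; rewrite -{1}[v]scale1r dS_lin// scale1r. Qed.

Lemma dS_0v {W : normedModType R} (F : ambient R n -> W) : dS F p 0 = 0.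
Proof. exact: derive0. Qed.

Lemma dS_Zv {W : normedModType R} (F : ambient R n -> W) a v :
  smooth_fun F -> dS F p (a *: v) = a *: dS F p v.
Proof. by move=> sF; have := dS_lin a v 0 sF; rewrite dS_0v !addr0. Qed.

Lemma dS_row {W : normedModType R} (F : ambient R n -> W) v :
  smooth_fun F -> dS F p v = \sum_i v 0 i *: dS F p (delta_mx 0 i).
Proof.
by move=> sF; apply/derive_rowE/(smooth_fun_differentiable sF)/sphere_neq0.
Qed.

End Rules.

(** Chain rule for the dilation y -> a y: the derivative of a function of degree 0 has degree -1. *)
Lemma derive_homog {W : normedModType R} (g : ambient R n -> W) a x v :
  a != 0 -> differentiable g x -> differentiable g (a *: x) ->
  (forall y, g (a *: y) = g y) -> 'D_v g (a *: x) = a^-1 *: 'D_v g x.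
Proof.
move=> a0 dg dga gE.
have da : differentiable ( *:%R a : ambient R n -> ambient R n) x by [].
have gg : g \o *:%R a = g by apply/funext => y; exact: gE.
have : 'D_v (g \o *:%R a) x = 'D_v g x by rewrite gg.
rewrite deriveE; last exact: differentiable_comp.
rewrite diff_comp// /= diff_val -deriveE// => <-.
rewrite [X in _ = _ *: X]deriveE// linearZ/= scalerA mulVf// scale1r.
by rewrite -deriveE.
Qed.

Lemma derive_retract {W : normedModType R} (F : ambient R n -> W) x v :
  smooth_fun F -> x != 0 ->
  'D_v (F \o @retract R n) (retract x) = (ninv x)^-1 *: 'D_v (F \o @retract R n) x.
Proof.
move=> sF x0; have N := ninv_gt0 x0.
rewrite retractE; apply: derive_homog; first exact: lt0r_neq0.
- exact: smooth_fun_differentiable.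
- by apply: smooth_fun_differentiable => //; rewrite scaler_eq0 negb_or x0 lt0r_neq0.
- by move=> y /=; rewrite retractZ.
Qed.

(** Writes |x| as a product of functions already known to be smooth off the origin. *)
Lemma ninvV x : x != 0 -> (ninv x)^-1 = ninv x * dot x x.
Proof.
move=> x0; have N0 := lt0r_neq0 (ninv_gt0 x0).
by apply: (mulfI N0); rewrite mulfV// mulrA -expr2 ninv_sqr.
Qed.

(** The degree-0 extension of X F, expressed through partial derivatives at x itself and not at its
    retraction. This form can be differentiated: it yields smoothness in [smooth_fun_dS] and the
    second-order rule [dS_dS]. *)
Lemma dS_retractE (F : ambient R n -> R) (X : ambient R n -> ambient R n) x :
  smooth_fun F -> x != 0 ->
  dS F (retract x) (X (retract x)) =
  (ninv x * dot x x) * \sum_i X (retract x) 0 i * 'D_(delta_mx 0 i) (F \o @retract R n) x.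
Proof.
move=> sF x0; rewrite dS_row//; last exact: sphere_retract.
rewrite mulr_sumr; apply: eq_bigr => i _.
by rewrite /dS derive_retract// ninvV// /GRing.scale/= mulrCA.
Qed.

Lemma smooth_fun_dS (F : ambient R n -> R) (X : ambient R n -> ambient R n) :
  smooth_fun F -> smooth_fun X -> smooth_fun (fun x => dS F x (X x)).
Proof.
move=> sF sX; rewrite smooth_funE.
apply: (@smooth_on_eq _ _ _ oU0 _ (fun x => (ninv x * dot x x) *
   \sum_i X (retract x) 0 i * 'D_(delta_mx 0 i) (F \o @retract R n) x)).
  by move=> x x0; rewrite dS_retractE.
apply: (smooth_onM oU0); first apply: (smooth_onM oU0).
- exact: smooth_on_ninv.
- exact/smooth_on_sqdot/oU0.
apply: (smooth_on_sum oU0) => i; apply: (smooth_onM oU0).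
  exact: (smooth_on_coord oU0).
exact: smooth_on_derive.
Qed.

Lemma smooth_fun_dS_row m (F : ambient R n -> 'rV[R]_m) (X : ambient R n -> ambient R n) :
  smooth_fun F -> smooth_fun X -> smooth_fun (fun x => dS F x (X x)).
Proof.
move=> sF sX; apply: smooth_fun_rowP => i.
apply: (@smooth_fun_eq _ (fun x => dS (fun y => F y 0 i) x (X x))) => [p sp|].
  exact: dS_coord.
by apply: smooth_fun_dS => //; exact: smooth_fun_coord.
Qed.

(** The Euclidean Hessian of the degree-0 extension. It is not the Hessian of the sphere: it also
    has radial entries, computed in [hess_radial]. *)
Definition hess (F : ambient R n -> R) p v w := 'D_v ('D_w (F \o @retract R n)) p.

Lemma hessC (F : ambient R n -> R) x v w :
  smooth_fun F -> x != 0 -> hess F x v w = hess F x w v.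
Proof. by move=> sF x0; exact: (derive_comm v w oU0 sF). Qed.

Lemma hess_linl (F : ambient R n -> R) x a v v' w :
  smooth_fun F -> x != 0 -> hess F x (a *: v + v') w = a * hess F x v w + hess F x v' w.
Proof.
move=> sF x0; rewrite /hess deriveDv//.
exact: (smooth_on_differentiable (smooth_on_derive w sF)).
Qed.

Lemma hess_linr (F : ambient R n -> R) x a v v' w :
  smooth_fun F -> x != 0 -> hess F x w (a *: v + v') = a * hess F x w v + hess F x w v'.
Proof. by move=> sF x0; rewrite ![hess F x w _]hessC// hess_linl. Qed.

Lemma hess0l (F : ambient R n -> R) x w : hess F x 0 w = 0.
Proof. exact: derive0. Qed.

Lemma hess_Zl (F : ambient R n -> R) x a v w :
  smooth_fun F -> x != 0 -> hess F x (a *: v) w = a * hess F x v w.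
Proof. by move=> sF x0; have := hess_linl a v 0 w sF x0; rewrite hess0l !addr0. Qed.

Lemma hess_Zr (F : ambient R n -> R) x a v w :
  smooth_fun F -> x != 0 -> hess F x w (a *: v) = a * hess F x w v.
Proof. by move=> sF x0; rewrite ![hess F x w _]hessC// hess_Zl. Qed.

Lemma hess_sumr (F : ambient R n -> R) x w (I : Type) (r : seq I) (P : pred I)
    (v : I -> ambient R n) :
  smooth_fun F -> x != 0 ->
  hess F x w (\sum_(i <- r | P i) v i) = \sum_(i <- r | P i) hess F x w (v i).
Proof.
move=> sF x0; elim: r => [|i r IHr]; first by rewrite !big_nil hessC// hess0l.
rewrite !big_cons; case: (P i) => //.
by rewrite -{1}[v i]scale1r hess_linr// mul1r IHr.
Qed.

Lemma hess_rowr (F : ambient R n -> R) x v w : smooth_fun F -> x != 0 ->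
  hess F x v w = \sum_i w 0 i * hess F x v (delta_mx 0 i).
Proof.
move=> sF x0; rewrite [w in LHS]row_sum_delta hess_sumr//.
by apply: eq_bigr => i _; rewrite hess_Zr.
Qed.

(** In [dS_retractE] the prefactor |x| is stationary at p in tangent directions, so only the product
    rule for the sum over the coordinates of X remains. *)
Lemma dS_dS (F : ambient R n -> R) (X : ambient R n -> ambient R n) p v :
  smooth_fun F -> smooth_fun X -> sphere p -> tangent p v ->
  dS (fun x => dS F x (X x)) p v = dS F p (dS X p v) + hess F p v (X p).
Proof.
move=> sF sX sp tv; have p0 := sphere_neq0 sp.
pose S x := \sum_i X (retract x) 0 i * 'D_(delta_mx 0 i) (F \o @retract R n) x.
have HS : is_derive p v S (\sum_i (dS X p v 0 i * dS F p (delta_mx 0 i) +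
      X p 0 i * hess F p v (delta_mx 0 i))).
  apply: is_derive_sumr => i.
  have HX : is_derive p v (fun x => X (retract x) 0 i) (dS X p v 0 i).
    exact: (is_derive_rowP _ _ _ _).1 (dS_is_derive v sX sp) i.
  have HD := smooth_on_is_derive v (smooth_on_derive (delta_mx 0 i) sF) p0.
  have := is_deriveM HX HD; rewrite retract_id// => H.
  by apply: (is_derive_eq H); rewrite addrC [dS X p v 0 i * _]mulrC.
have Hq : is_derive p v (fun x => ninv x * dot x x) 0.
  have Hn := smooth_on_is_derive v (@smooth_on_ninv R n) p0.
  have H := is_deriveM Hn (is_derive_sqdot p v).
  by apply: (is_derive_eq H); rewrite derive_ninv// tv /GRing.scale/= mul0r; ring.
have H := is_deriveM Hq HS.
have H2 : is_derive p v ((fun x => dS F x (X x)) \o @retract R n)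
    (dS (fun x => dS F x (X x)) p v).
  by apply: dS_is_derive => //; exact: smooth_fun_dS.
have H3 : is_derive p v ((fun x => ninv x * dot x x) * S)
    (dS (fun x => dS F x (X x)) p v).
  apply: (@near_eq_is_derive _ _ _ _ _ _ _ _ _ H2).
  have := open_nbhs_nbhs (conj oU0 p0).
  by rewrite -nbhs_nearE; apply: filterS => y y0; rewrite /= dS_retractE.
rewrite (is_derive_eqE H3 H) scaler0 addr0 ninv1// mul1r.
have -> : dot p p = 1 by [].
rewrite scale1r big_split; congr (_ + _); first by rewrite [RHS]dS_row.
by rewrite [RHS]hess_rowr.
Qed.

End SmoothFun.

(** * The CR structure of the sphere *)

Section ComplexParts.
Local Open Scope complex_scope.
Context {R : realType}.
Implicit Types z w : R[i].

Lemma ReD z w : complex.Re (z + w) = complex.Re z + complex.Re w.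
Proof. by case: z; case: w. Qed.
Lemma ImD z w : complex.Im (z + w) = complex.Im z + complex.Im w.
Proof. by case: z; case: w. Qed.
Lemma ReN z : complex.Re (- z) = - complex.Re z.
Proof. by case: z. Qed.
Lemma ImN z : complex.Im (- z) = - complex.Im z.
Proof. by case: z. Qed.
Lemma ReM z w :
  complex.Re (z * w) = complex.Re z * complex.Re w - complex.Im z * complex.Im w.
Proof. by case: z; case: w. Qed.
Lemma ImM z w :
  complex.Im (z * w) = complex.Re z * complex.Im w + complex.Im z * complex.Re w.
Proof. by case: z; case: w. Qed.
Lemma Re_conj z : complex.Re z^* = complex.Re z. Proof. by case: z. Qed.
Lemma Im_conj z : complex.Im z^* = - complex.Im z. Proof. by case: z. Qed.

Lemma half_complex : (2^-1 : R[i]) = (2^-1)%:C.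
Proof. by rewrite fmorphV rmorph_nat. Qed.

Lemma Re_half : complex.Re (2^-1 : R[i]) = 2^-1. Proof. by rewrite half_complex. Qed.
Lemma Im_half : complex.Im (2^-1 : R[i]) = 0. Proof. by rewrite half_complex. Qed.

Lemma Re_sum (I : Type) (r : seq I) (P : pred I) (F : I -> R[i]) :
  complex.Re (\sum_(i <- r | P i) F i) = \sum_(i <- r | P i) complex.Re (F i).
Proof. by apply: (big_morph (@complex.Re R)) => // z w; rewrite ReD. Qed.

Lemma eq_complexP z w :
  complex.Re z = complex.Re w -> complex.Im z = complex.Im w -> z = w.
Proof. by case: z; case: w => a b c d /= -> ->. Qed.

Definition partE := (ReD, ImD, ReN, ImN, ReM, ImM, Re_conj, Im_conj, Re_half, Im_half).
End ComplexParts.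

Section CRStructure.
Local Open Scope complex_scope.
Context {R : realType} {n : nat}.
Implicit Types (u v w x y p : ambient R n) (a b : R).

Lemma thetaE p v : theta p v = dot (mulI p) v.
Proof.
rewrite /theta /del /delbar -sumrB mulr_sumr Re_sum dotE; apply: eq_bigr => j _.
have Dj u : 'D_u (fun z : ambient R n => dot z z) p = 2 * dot p u.
  by have [] := is_derive_sqdot p u.
rewrite !Dj ![dot p _]dotC !dot_delta /dz !partE/= xcoordI ycoordI.
rewrite -[p 0 (lshift _ _)]/(xcoord p j) -[p 0 (rshift _ _)]/(ycoord p j).
by field.
Qed.

Lemma reebE p : reeb p = mulI p.
Proof.
apply/dotP => w; rewrite /reeb dot_suml dotE; apply: eq_bigr => j _.
rewrite dotDl dotNl !dotZl !dot_delta xcoordI ycoordI /xcoord /ycoord; ring.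
Qed.

Lemma projHE p v : projH p v = v - dot (mulI p) v *: mulI p.
Proof. by rewrite /projH thetaE reebE. Qed.

Lemma dz_sum_lshift (c : 'I_n.+1 -> R[i]) k :
  (\sum_j c j *: dz_vec R j) 0 (lshift n.+1 k) = c k / 2.
Proof.
rewrite summxE (bigD1 k)//= big1 => [|j jk]; rewrite !mxE eqxx /= !eq_lshift eq_lrshift.
  by rewrite eqxx mulr0 subr0 mulr1 addr0.
by rewrite eq_sym (negPf jk) !(mulr0, subr0).
Qed.

Lemma dz_sum_rshift (c : 'I_n.+1 -> R[i]) k :
  (\sum_j c j *: dz_vec R j) 0 (rshift n.+1 k) = - ('i * c k / 2).
Proof.
rewrite summxE (bigD1 k)//= big1 => [|j jk]; rewrite !mxE eqxx /= !eq_rshift eq_rlshift.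
  by rewrite eqxx mulr1 addr0 sub0r !mulrN mulrA mulrC mulrA.
by rewrite eq_sym (negPf jk) !(mulr0, subr0).
Qed.

Lemma cxJE p v : cxJ p v = mulI (projH p v).
Proof.
rewrite /cxJ; move: (projH p v) => h; apply/rowP => i.
rewrite -(splitK i); case: (fintype.split i) => j /=.
  rewrite mulI_lshift !mxE dz_sum_lshift !partE /dz/= /ycoord /xcoord.
  by field.
rewrite mulI_rshift !mxE dz_sum_rshift !partE /dz/= /ycoord /xcoord.
by field.
Qed.

Lemma dthetaE p v w : dtheta p v w = dot (mulI v) w.
Proof.
have E u z : 'D_u (fun x => theta x z) p = dot (mulI u) z.
  under eq_fun do rewrite thetaE.
  have H := is_derive_dot (is_derive_mulI (is_derive_id p u)) (is_derive_cst z p u).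
  by have [_] := H; rewrite dot0r addr0.
rewrite /dtheta !E [dot (mulI w) _]dot_mulIl [dot w _]dotC; by field.
Qed.

Lemma levi_formE p v w : levi_form p v w = dot v (projH p w).
Proof. by rewrite /levi_form dthetaE cxJE dot_mulI. Qed.

Lemma projH_id p v : dot (mulI p) v = 0 -> projH p v = v.
Proof. by move=> h; rewrite projHE h scale0r subr0. Qed.

(** At points of the sphere |ip| = 1, and the normalisations of [theta] and [dtheta] leave no factor
    behind: the Webster metric is the round one. *)
Lemma websterE p v w : sphere p -> webster p v w = dot v w.
Proof.
rewrite /sphere/= => sp; rewrite /webster levi_formE !thetaE !projHE.
rewrite !(dotDl, dotDr, dotNl, dotNr, dotZl, dotZr) dot_mulI sp.
by rewrite [dot v (mulI p)]dotC; ring.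
Qed.

Lemma re_T10 p (Z : ambient R[i] n) : T10 p Z -> im_vec Z = - mulI (re_vec Z).
Proof.
move=> [[c ->] _]; apply/rowP => i; rewrite -(splitK i); case: (fintype.split i) => j /=.
  rewrite [LHS]mxE [RHS]mxE mulI_lshift ![re_vec _ _ _]mxE /= dz_sum_lshift dz_sum_rshift !partE /=.
  by field.
rewrite [LHS]mxE [RHS]mxE mulI_rshift ![re_vec _ _ _]mxE /= dz_sum_lshift dz_sum_rshift !partE /=.
by field.
Qed.

Lemma T10_intro p (Z : ambient R[i] n) : tangent p (re_vec Z) -> tangent p (im_vec Z) ->
  im_vec Z = - mulI (re_vec Z) -> T10 p Z.
Proof.
move=> tr ti /rowP IE; split=> //.
(* The factor 2 compensates the 1/2 in d/dz_j. *)
exists (fun j => 2 * Z 0 (lshift n.+1 j)); apply/rowP => i.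
rewrite -(splitK i); case: (fintype.split i) => j /=.
  by rewrite dz_sum_lshift mulrAC divff ?mul1r// pnatr_eq0.
rewrite dz_sum_rshift.
have I1 := IE (rshift _ j); rewrite [RHS]mxE mulI_rshift [LHS]mxE [in RHS]mxE in I1.
have I2 := IE (lshift _ j); rewrite [RHS]mxE mulI_lshift [LHS]mxE [in RHS]mxE in I2.
apply: eq_complexP; rewrite !partE /=.
  by rewrite I2; field.
by rewrite I1; field.
Qed.

Lemma cplx_of_re u v : re_vec (cplx_of u v) = u.
Proof. by apply/rowP => i; rewrite !mxE !partE /=; ring. Qed.

Lemma cplx_of_im u v : im_vec (cplx_of u v) = v.
Proof. by apply/rowP => i; rewrite !mxE !partE /=; ring. Qed.

Lemma cplx_ext (Z W : ambient R[i] n) :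
  re_vec Z = re_vec W -> im_vec Z = im_vec W -> Z = W.
Proof.
move=> /rowP rZ /rowP iZ; apply/rowP => i; apply: eq_complexP.
  by have := rZ i; rewrite !mxE.
by have := iZ i; rewrite !mxE.
Qed.

Lemma re_vecD (Z W : ambient R[i] n) : re_vec (Z + W) = re_vec Z + re_vec W.
Proof. by apply/rowP => i; rewrite !mxE ReD. Qed.
Lemma im_vecD (Z W : ambient R[i] n) : im_vec (Z + W) = im_vec Z + im_vec W.
Proof. by apply/rowP => i; rewrite !mxE ImD. Qed.
Lemma re_vec_conj (Z : ambient R[i] n) : re_vec (conj_vec Z) = re_vec Z.
Proof. by apply/rowP => i; rewrite !mxE Re_conj. Qed.
Lemma im_vec_conj (Z : ambient R[i] n) : im_vec (conj_vec Z) = - im_vec Z.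
Proof. by apply/rowP => i; rewrite !mxE Im_conj. Qed.

Lemma levi_distributionP p v :
  levi_distribution p v <-> tangent p v /\ dot (mulI p) v = 0.
Proof.
split.
  move=> [Z TZ E]; have IE := re_T10 TZ; have [_ [tr ti]] := TZ.
  have vE : v = re_vec Z + re_vec Z.
    by rewrite -[LHS](cplx_of_re v 0) E re_vecD re_vec_conj.
  rewrite /tangent in tr ti; split; rewrite ?/tangent vE !dotDr ?tr ?addr0//.
  by move: ti; rewrite IE dotNr => /eqP; rewrite dot_mulIl oppr_eq0 => /eqP ->; rewrite oppr0 addr0.
(* The (1,0)-part of v is (v - iJv)/2; its imaginary part is tangent because v is orthogonal to
   ip. *)
move=> [tv hv]; exists (cplx_of (2^-1 *: v) (- mulI (2^-1 *: v))).
  apply: T10_intro; rewrite ?cplx_of_re ?cplx_of_im//.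
    by rewrite /tangent dotZr tv mulr0.
  by rewrite /tangent mulIZ dotNr dotZr -[dot p _]opprK -dot_mulIl hv oppr0 mulr0 oppr0.
apply: cplx_ext; rewrite ?(re_vecD, im_vecD, re_vec_conj, im_vec_conj, cplx_of_re, cplx_of_im).
  by rewrite -scalerDl [2^-1 + _](_ : _ = 1) ?scale1r//; by field.
by rewrite subrr.
Qed.

Lemma T10P p u v : T10 p (cplx_of u v) <->
  [/\ tangent p u, dot (mulI p) u = 0 & v = - mulI u].
Proof.
split.
  move=> TZ; have := re_T10 TZ; have [_ []] := TZ.
  rewrite cplx_of_re cplx_of_im => tu tv E; split=> //.
  by move: tv; rewrite E /tangent dotNr -dot_mulIl.
move=> [tu hu E]; apply: T10_intro; rewrite ?cplx_of_re ?cplx_of_im//.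
by rewrite E /tangent dotNr -dot_mulIl.
Qed.

End CRStructure.

(** * Vector fields, tensoriality and difference of connections *)

Section Fields.
Context {R : realType} {n : nat}.
Implicit Types (u v w x y p : ambient R n) (a b : R).
Implicit Types (X Y Z : ambient R n -> ambient R n).

Lemma cxJI p v : cxJ p v = mulI v + dot (mulI p) v *: p.
Proof. by rewrite cxJE projHE mulIDl mulIN mulIZ mulIK scalerN opprK. Qed.

Lemma smooth_fun_cxJ X : smooth_fun X -> smooth_fun (fun x => cxJ x (X x)).
Proof.
move=> sX; under eq_fun do rewrite cxJI.
apply: smooth_funD; first exact: smooth_fun_mulI.
apply: smooth_funZ; last exact: smooth_fun_id.
by apply: smooth_fun_dot => //; exact/smooth_fun_mulI/smooth_fun_id.
Qed.

Lemma smooth_fun_tproj X : smooth_fun X -> smooth_fun (fun x => tproj x (X x)).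
Proof.
move=> sX; apply: smooth_funB => //; apply: smooth_funZ; last exact: smooth_fun_id.
by apply: smooth_fun_dot => //; exact: smooth_fun_id.
Qed.

Lemma smooth_fun_projH X : smooth_fun X -> smooth_fun (fun x => projH x (X x)).
Proof.
move=> sX; under eq_fun do rewrite projHE.
have sI : smooth_fun (fun x => mulI x) by exact/smooth_fun_mulI/smooth_fun_id.
by apply: smooth_funB => //; apply: smooth_funZ => //; exact: smooth_fun_dot.
Qed.

Lemma tproj_tangent p v : sphere p -> tangent p (tproj p v).
Proof. by move=> sp; rewrite /tangent dotDr dotNr dotZr sp mulr1 subrr. Qed.

Lemma tproj_id p v : tangent p v -> tproj p v = v.
Proof. by move=> tv; rewrite /tproj tv scale0r subr0. Qed.

Lemma extend_id p v : tangent p v -> extend v p = v.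
Proof. exact: tproj_id. Qed.

Lemma extend_vfield v : vfield (extend v).
Proof.
split; last by move=> p sp; exact: tproj_tangent.
exact/smooth_fun_tproj/smooth_fun_cst.
Qed.

Lemma reeb_tangent p : tangent p (reeb p).
Proof. by rewrite /tangent reebE dot_mulIr. Qed.

Lemma reeb_vfield : vfield (@reeb R n).
Proof.
split; last by move=> p _; exact: reeb_tangent.
apply: smooth_fun_eq (smooth_fun_mulI (@smooth_fun_id R n)) => p _.
by rewrite reebE.
Qed.

(** Horizontal counterpart of [extend], used to evaluate at a vector those axioms that only speak of
    fields in H(M). *)
Definition extendH v x := projH x (tproj x v).

Lemma projH_tangent p v : tangent p v -> tangent p (projH p v).
Proof. by rewrite /tangent projHE dotDr dotNr dotZr dot_mulIr mulr0 subr0. Qed.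

Lemma dot_projH p v : sphere p -> dot (mulI p) (projH p v) = 0.
Proof.
by move=> sp; rewrite projHE dotDr dotNr dotZr dot_mulI sp mulr1 subrr.
Qed.

Lemma extendH_Hfield v : Hfield (extendH v).
Proof.
have tan p : sphere p -> tangent p (extendH v p).
  by move=> sp; exact/projH_tangent/tproj_tangent.
split; last by move=> p sp; apply/levi_distributionP; split; [exact: tan|exact: dot_projH].
split=> //; apply: smooth_fun_projH; exact/smooth_fun_tproj/smooth_fun_cst.
Qed.

Lemma extendH_id p v : tangent p v -> dot (mulI p) v = 0 -> extendH v p = v.
Proof. by move=> tv hv; rewrite /extendH tproj_id// projH_id. Qed.

Lemma cxJ_tangent p v : sphere p -> tangent p v -> tangent p (cxJ p v).
Proof.
rewrite /tangent/sphere/= => sp tv; rewrite cxJI dotDr dotZr sp mulr1.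
by rewrite dot_mulIl subrr.
Qed.

Lemma cxJ_vfield X : vfield X -> vfield (fun x => cxJ x (X x)).
Proof.
move=> [sX tX]; split; first exact: smooth_fun_cxJ.
by move=> p sp; exact/cxJ_tangent/tX.
Qed.

Lemma vfieldZ (f : ambient R n -> R) X : smooth_fun f -> vfield X ->
  vfield (fun x => f x *: X x).
Proof.
move=> sf [sX tX]; split; first exact: smooth_funZ.
by move=> p sp; rewrite /tangent dotZr tX// mulr0.
Qed.

Lemma vfieldD X Y : vfield X -> vfield Y -> vfield (fun x => X x + Y x).
Proof.
move=> [sX tX] [sY tY]; split; first exact: smooth_funD.
by move=> p sp; rewrite /tangent dotDr tX// tY// addr0.
Qed.

Lemma vfieldN X : vfield X -> vfield (fun x => - X x).
Proof.
move=> [sX tX]; split; first exact: smooth_funN.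
by move=> p sp; rewrite /tangent dotNr tX// oppr0.
Qed.

Lemma vfieldB X Y : vfield X -> vfield Y -> vfield (fun x => X x - Y x).
Proof. by move=> vX vY; apply: vfieldD => //; exact: vfieldN. Qed.

Lemma vfield0 : vfield (fun _ => 0 : ambient R n).
Proof. by split; [exact: smooth_fun_cst|move=> p _; rewrite /tangent dot0r]. Qed.

Lemma vfield_sum (I : Type) (r : seq I) (F : I -> ambient R n -> ambient R n) :
  (forall i, vfield (F i)) -> vfield (fun x => \sum_(i <- r) F i x).
Proof.
move=> vF; elim: r => [|i r IHr].
  by under eq_fun do rewrite big_nil; exact: vfield0.
by under eq_fun do rewrite big_cons; exact: vfieldD.
Qed.

Lemma vfield_eq X Y : (forall p, sphere p -> X p = Y p) -> vfield X -> vfield Y.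
Proof.
move=> XY [sX tX]; split; first exact: smooth_fun_eq sX.
by move=> p sp; rewrite -XY//; exact: tX.
Qed.

(** Differentiate <x, X(x)> = 0 along v. *)
Lemma dot_dS_tangent X p v : vfield X -> sphere p -> tangent p v ->
  dot p (dS X p v) = - dot v (X p).
Proof.
move=> [sX tX] sp tv.
have : dS (fun x => dot x (X x)) p v = dS (fun _ => 0) p v.
  by apply: dS_eq => // q sq; exact: tX.
rewrite dS_cst dS_dot//; last exact: smooth_fun_id.
by rewrite dS_id// => /eqP; rewrite addrC addr_eq0 => /eqP.
Qed.

Lemma bracket_vfield X Y : vfield X -> vfield Y -> vfield (bracket X Y).
Proof.
move=> vX vY; have [sX tX] := vX; have [sY tY] := vY; split.
  by apply: smooth_funB; exact: smooth_fun_dS_row.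
move=> p sp; rewrite /tangent dotDr dotNr dot_dS_tangent ?tX//; last exact: tX.
by rewrite dot_dS_tangent//; [rewrite dotC subrr|exact: tY].
Qed.

(** The projected constant fields generate all tangent fields, with the ambient coordinates as
    coefficients; this global, overcomplete family replaces local frames. *)
Lemma vfield_extend_sum X p : vfield X -> sphere p ->
  X p = \sum_i X p 0 i *: extend (delta_mx 0 i) p.
Proof.
move=> [_ tX] sp.
have := tX p sp; rewrite /tangent => dX.
under eq_bigr do rewrite /extend /tproj scalerBr scalerA [dot p _]dotC dot_delta.
rewrite sumrB -scaler_suml -row_sum_delta.
by rewrite [X in X *: _](_ : _ = 0) ?scale0r ?subr0// -[RHS]dX dotC.
Qed.

Section Tensoriality.
Variables (nabla : connection R n) (H : is_linear_connection nabla).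

(* The C^infinity-linearity axioms only multiply by functions that are smooth on
   the sphere, so the indicator of its complement, equal to 0 there, is allowed: it
   changes the values of a field off the sphere. *)
Let off x : R := (dot x x != 1)%:R.

Let off_sphere p : sphere p -> off p = 0.
Proof. by rewrite /off /sphere/= => ->; rewrite eqxx. Qed.

Let off_notin x : ~ sphere x -> off x = 1.
Proof. by rewrite /off /sphere/= => /eqP ->. Qed.

Let off_smooth : smooth_fun off.
Proof.
by apply: smooth_fun_eq (smooth_fun_cst (0 : R)) => p sp; rewrite off_sphere.
Qed.

Let off_glue X X' : (forall p, sphere p -> X p = X' p) ->
  (fun x => off x *: (X' x - X x) + X x) = X'.
Proof.
move=> XX'; apply/funext => x.
have [sx|nsx] := pselect (sphere x); first by rewrite XX'// subrr scaler0 add0r.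
by rewrite off_notin// scale1r subrK.
Qed.

Lemma conn_eq_left X X' Y p : vfield X -> vfield X' -> vfield Y ->
  (forall q, sphere q -> X q = X' q) -> sphere p -> nabla X Y p = nabla X' Y p.
Proof.
move=> vX vX' vY XX' sp; rewrite -[in RHS](off_glue XX').
rewrite (conn_tensorial H off_smooth (vfieldB vX' vX) vX vY)//.
by rewrite off_sphere// scale0r add0r.
Qed.

Lemma conn_eq_right X Y Y' p : vfield X -> vfield Y -> vfield Y' ->
  (forall q, sphere q -> Y q = Y' q) -> sphere p -> nabla X Y p = nabla X Y' p.
Proof.
move=> vX vY vY' YY' sp; rewrite -[in RHS](off_glue YY').
rewrite (conn_leibniz H off_smooth vX (vfieldB vY' vY) vY)//.
rewrite off_sphere// scale0r YY'// subrr scaler0.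
by rewrite !add0r.
Qed.

Lemma conn_sum_left (I : Type) (r : seq I) (f : I -> ambient R n -> R)
    (F : I -> ambient R n -> ambient R n) Y p :
  (forall i, smooth_fun (f i)) -> (forall i, vfield (F i)) -> vfield Y -> sphere p ->
  nabla (fun x => \sum_(i <- r) f i x *: F i x) Y p = \sum_(i <- r) f i p *: nabla (F i) Y p.
Proof.
move=> sf vF vY sp; have vfF i : vfield (fun x => f i x *: F i x) by exact: vfieldZ.
elim: r => [|i r IHr].
  under eq_fun do rewrite big_nil; rewrite big_nil.
  (* Additivity at 1 * 0 + 0 shows that the value at the zero field equals twice itself. *)
  have := conn_tensorial H (smooth_fun_cst (1 : R)) vfield0 vfield0 vY sp.
  rewrite (_ : (fun x => 1 *: 0 + 0) = fun _ => 0); last first.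
    by apply/funext => x; rewrite scaler0 addr0.
  by rewrite scale1r => /eqP; rewrite addrC -subr_eq subrr eq_sym => /eqP.
under eq_fun do rewrite big_cons; rewrite big_cons.
by rewrite (conn_tensorial H (sf i) (vF i) (vfield_sum r vfF) vY)// IHr.
Qed.

Lemma conn_sum_right (I : Type) (r : seq I) (f : I -> ambient R n -> R)
    (F : I -> ambient R n -> ambient R n) X p :
  (forall i, smooth_fun (f i)) -> (forall i, vfield (F i)) -> vfield X -> sphere p ->
  nabla X (fun x => \sum_(i <- r) f i x *: F i x) p =
  \sum_(i <- r) (dS (f i) p (X p) *: F i p + f i p *: nabla X (F i) p).
Proof.
move=> sf vF vX sp; have vfF i : vfield (fun x => f i x *: F i x) by exact: vfieldZ.
elim: r => [|i r IHr].
  under eq_fun do rewrite big_nil; rewrite big_nil.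
  have := conn_leibniz H (smooth_fun_cst (1 : R)) vX vfield0 vfield0 sp.
  rewrite (_ : (fun x => 1 *: 0 + 0) = fun _ => 0); last first.
    by apply/funext => x; rewrite scaler0 addr0.
  rewrite scale1r scaler0 add0r.
  by move=> /eqP; rewrite addrC -subr_eq subrr eq_sym => /eqP.
under eq_fun do rewrite big_cons; rewrite big_cons.
by rewrite (conn_leibniz H (sf i) vX (vF i) (vfield_sum r vfF))// IHr.
Qed.

(** Only the last summand involves the connection; the derivatives of Y cancel when two connections
    are subtracted, as in [conn_diffE]. *)
Lemma conn_christoffel X Y p : vfield X -> vfield Y -> sphere p ->
  nabla X Y p = \sum_i X p 0 i *: \sum_j
    (dS (fun x => Y x 0 j) p (extend (delta_mx 0 i) p) *: extend (delta_mx 0 j) p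
     + Y p 0 j *: nabla (extend (delta_mx 0 i)) (extend (delta_mx 0 j)) p).
Proof.
move=> vX vY sp; have [sX _] := vX; have [sY _] := vY.
have sc Z i : smooth_fun Z -> smooth_fun (fun x => Z x 0 i) by exact: smooth_fun_coord.
pose E i := extend (delta_mx 0 i : ambient R n).
have vE i : vfield (E i) by exact: extend_vfield.
rewrite (@conn_eq_left X (fun x => \sum_i X x 0 i *: E i x) Y)//; last 2 first.
- by apply: vfield_sum => i; apply: vfieldZ => //; exact: sc.
- by move=> q sq; exact: vfield_extend_sum.
rewrite (conn_sum_left _ (fun i => sc X i sX))//; apply: eq_bigr => i _.
rewrite (@conn_eq_right (E i) Y (fun x => \sum_j Y x 0 j *: E j x))//; last 2 first.
- by apply: vfield_sum => j; apply: vfieldZ => //; exact: sc.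
- by move=> q sq; exact: vfield_extend_sum.
by rewrite (conn_sum_right _ (fun i => sc Y i sY)).
Qed.

End Tensoriality.

Section Difference.
Variables (nabla1 nabla2 : connection R n).

(** The difference tensor as a function of vectors: written in coordinates, it is bilinear by
    construction and needs no choice of extending fields. *)
Definition conn_diff p u v := \sum_i \sum_j (u 0 i * v 0 j) *:
  (nabla1 (extend (delta_mx 0 i)) (extend (delta_mx 0 j)) p
   - nabla2 (extend (delta_mx 0 i)) (extend (delta_mx 0 j)) p).

Lemma conn_diffDl p a u u' v :
  conn_diff p (a *: u + u') v = a *: conn_diff p u v + conn_diff p u' v.
Proof.
rewrite /conn_diff scaler_sumr -big_split /=; apply: eq_bigr => i _.
rewrite scaler_sumr -big_split /=; apply: eq_bigr => j _.
by rewrite !mxE scalerA -scalerDl; congr (_ *: _); ring.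
Qed.

Lemma conn_diffDr p a u v v' :
  conn_diff p u (a *: v + v') = a *: conn_diff p u v + conn_diff p u v'.
Proof.
rewrite /conn_diff scaler_sumr -big_split /=; apply: eq_bigr => i _.
rewrite scaler_sumr -big_split /=; apply: eq_bigr => j _.
by rewrite !mxE scalerA -scalerDl; congr (_ *: _); ring.
Qed.

Lemma conn_diff0l p v : conn_diff p 0 v = 0.
Proof.
by rewrite /conn_diff big1// => i _; rewrite big1// => j _; rewrite mxE mul0r scale0r.
Qed.

Lemma conn_diff0r p v : conn_diff p v 0 = 0.
Proof.
by rewrite /conn_diff big1// => i _; rewrite big1// => j _; rewrite mxE mulr0 scale0r.
Qed.

Lemma conn_diffNl p u v : conn_diff p (- u) v = - conn_diff p u v.
Proof. by have := conn_diffDl p (-1) u 0 v; rewrite conn_diff0l !addr0 !scaleN1r. Qed.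

Lemma conn_diffNr p u v : conn_diff p u (- v) = - conn_diff p u v.
Proof. by have := conn_diffDr p (-1) u v 0; rewrite conn_diff0r !addr0 !scaleN1r. Qed.

Lemma conn_diffE X Y p :
  is_linear_connection nabla1 -> is_linear_connection nabla2 ->
  vfield X -> vfield Y -> sphere p ->
  nabla1 X Y p - nabla2 X Y p = conn_diff p (X p) (Y p).
Proof.
move=> H1 H2 vX vY sp; rewrite (conn_christoffel H1)// (conn_christoffel H2)//.
rewrite -sumrB; apply: eq_bigr => i _; rewrite -scalerBr -sumrB scaler_sumr.
by apply: eq_bigr => j _; rewrite opprD addrACA subrr add0r -scalerBr scalerA.
Qed.

End Difference.
End Fields.

Ltac gen_dots :=
  repeat match goal with |- context [@dot ?R ?n ?a ?b] => generalize (@dot R n a b) => ? end.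
(** Pairs a vector identity with an arbitrary [w], which leaves a scalar identity for [ring]; the
    compound terms are first generalized to variables. *)
Ltac row_ring := gen_dots;
  repeat match goal with
  | |- context [@mulI ?R ?n ?a] => generalize (@mulI R n a) => ?
  | |- context [@cxJ ?R ?n ?p ?a] => generalize (@cxJ R n p a) => ?
  | |- context [@dS ?R ?n ?W ?F ?p ?v] => generalize (@dS R n W F p v) => ?
  end;
  let w := fresh "w" in apply/dotP => w;
  rewrite ?(dotDl, dotNl, dotZl, dot0l); gen_dots; ring.

(** * The Levi-Civita and Tanaka-Webster connections *)

Section Connections.
Context {R : realType} {n : nat}.
Local Opaque cxJ projH webster levi_form dS mulI theta.
Implicit Types (u v w x y p : ambient R n) (a b : R).
Implicit Types (X Y Z : ambient R n -> ambient R n).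

(** The tangential part of the ambient derivative: the normal component of dY(X) at p is -<X, Y>. *)
Definition round_connection : connection R n :=
  fun X Y p => dS Y p (X p) + dot (X p) (Y p) *: p.

Lemma round_linear : is_linear_connection round_connection.
Proof.
split.
- move=> X Y [sX tX] [sY tY]; split.
    apply: smooth_funD; first exact: smooth_fun_dS_row.
    by apply: smooth_funZ; [exact: smooth_fun_dot|exact: smooth_fun_id].
  move=> p sp; rewrite /tangent/round_connection dotDr dotZr sp mulr1.
  by rewrite dot_dS_tangent//; [rewrite addNr|exact: tX].
- move=> f X X' Y sf [sX tX] [sX' tX'] [sY tY] p sp.
  rewrite /round_connection dS_Dv// dS_Zv// dotDl dotZl.
  by row_ring.
- move=> f X Y Y' sf [sX tX] [sY tY] [sY' tY'] p sp.
  rewrite /round_connection dSD//; last exact: smooth_funZ.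
  rewrite dSZ// dotDr dotZr.
  generalize (Y p) (Y' p) (dS f p (X p)) => y y' e.
  by row_ring.
Qed.

Lemma round_is_levi_civita : is_levi_civita round_connection.
Proof.
split; first exact: round_linear.
- move=> X Y Z [sX tX] [sY tY] [sZ tZ] p sp.
  rewrite (@dS_eq _ _ _ _ (fun x => dot (Y x) (Z x))) => [|q sq|//]; last exact: websterE.
  rewrite dS_dot// !(websterE _ _ sp) /round_connection dotDl dotDr dotZl dotZr.
  by rewrite [dot (Y p) p]dotC [dot p (Z p)]tZ// [dot p (Y p)]tY// !mulr0 !addr0.
- move=> X Y [sX tX] [sY tY] p sp; rewrite /torsion /bracket /round_connection.
  rewrite [dot (Y p) _]dotC; row_ring.
Qed.

(** Levi-Civita plus three corrections. The term <JX, Y> T cancels the T-component of the derivative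
    of a horizontal Y; -theta(Y) JX makes T parallel, since the Levi-Civita derivative of T along X
    is JX; -theta(X) JY makes the last two terms together symmetric in X and Y, so that the torsion
    comes only from the first. *)
Definition sphere_tw : connection R n :=
  fun X Y p => round_connection X Y p + dot (mulI (X p)) (Y p) *: mulI p
    - (dot (mulI p) (Y p) *: cxJ p (X p) + dot (mulI p) (X p) *: cxJ p (Y p)).

Lemma cxJ_lin p a u v : cxJ p (a *: u + v) = a *: cxJ p u + cxJ p v.
Proof.
rewrite !cxJI mulIDl mulIZ dotDr dotZr; row_ring.
Qed.

Lemma tw_linear : is_linear_connection sphere_tw.
Proof.
have [Lv Lt Ll] := round_linear; split.
- move=> X Y vX vY.
  have sI : smooth_fun (fun x : ambient R n => mulI x).
    exact/smooth_fun_mulI/smooth_fun_id.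
  have tI p : sphere p -> tangent p (mulI p) by rewrite /tangent dot_mulIr.
  have [sX tX] := vX; have [sY tY] := vY.
  apply: vfieldB; first apply: vfieldD; first exact: Lv.
    apply: vfieldZ; last by split.
    by apply: smooth_fun_dot => //; exact: smooth_fun_mulI.
  by apply: vfieldD; apply: vfieldZ; by [exact: smooth_fun_dot|exact: cxJ_vfield].
- move=> f X X' Y sf vX vX' vY p sp.
  rewrite /sphere_tw Lt// mulIDl mulIZ !(dotDl, dotDr, dotZl, dotZr) cxJ_lin.
  generalize (round_connection X Y p) => d1; generalize (round_connection X' Y p) => d2.
  by row_ring.
- move=> f X Y Y' sf vX vY vY' p sp.
  rewrite /sphere_tw Ll// !(dotDl, dotDr, dotZl, dotZr) cxJ_lin.
  generalize (round_connection X Y p) => d1; generalize (round_connection X Y' p) => d2.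
  generalize (Y p) (Y' p) (dS f p (X p)) => y y' e.
  by row_ring.
Qed.

Lemma tw_torsionE X Y p : torsion sphere_tw X Y p =
  (2 * dot (mulI (X p)) (Y p)) *: mulI p.
Proof.
rewrite /torsion /sphere_tw /round_connection /bracket.
rewrite [dot (Y p) (X p)]dotC [dot (mulI (Y p)) _]dot_mulIl.
rewrite [dot (Y p) _]dotC.
by row_ring.
Qed.

Lemma dot_mulI_cxJ p v : sphere p -> tangent p v -> dot (mulI p) (cxJ p v) = 0.
Proof.
by move=> sp tv; rewrite cxJE dot_mulI projHE dotDr dotNr dotZr dot_mulIr tv; ring.
Qed.

(** For fixed X the correction to the Levi-Civita connection is a skew operator of Y, so metricity
    is inherited. *)
Lemma tw_metric_compat : is_metric sphere_tw.
Proof.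
move=> X Y Z vX vY vZ p sp; rewrite (lc_metric round_is_levi_civita vX vY vZ sp).
have [sX tX] := vX; have [sY tY] := vY; have [sZ tZ] := vZ.
rewrite !(websterE _ _ sp) /sphere_tw.
have pY : dot p (Y p) = 0 by exact: tY.
have pZ : dot p (Z p) = 0 by exact: tZ.
generalize (round_connection X Y p) (round_connection X Z p) => d e.
rewrite !cxJI.
move: (X p) (Y p) (Z p) pY pZ => x y z py pz.
have yp : dot y p = 0 by rewrite dotC.
rewrite !(dotDl, dotDr, dotNl, dotNr, dotZl, dotZr) yp pz.
have -> : dot y (mulI x) = - dot (mulI x) y * -1 by rewrite mulrN1 opprK dotC.
have -> : dot y (mulI z) = - dot (mulI y) z by rewrite dot_mulIl opprK.
rewrite [dot y (mulI p)]dotC; ring.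
Qed.

Lemma tw_J X Y : vfield X -> vfield Y -> forall p, sphere p ->
  sphere_tw X (fun x => cxJ x (Y x)) p = cxJ p (sphere_tw X Y p).
Proof.
move=> vX vY p sp; have [sX tX] := vX; have [sY tY] := vY.
have sI : smooth_fun (fun x : ambient R n => mulI x).
  exact/smooth_fun_mulI/smooth_fun_id.
have sIY : smooth_fun (fun x => dot (mulI x) (Y x)) by exact: smooth_fun_dot.
have D : dS (fun x => cxJ x (Y x)) p (X p) =
    mulI (dS Y p (X p)) + ((dot (mulI (X p)) (Y p) + dot (mulI p) (dS Y p (X p))) *: p
     + dot (mulI p) (Y p) *: X p).
  under eq_fun do rewrite cxJI.
  rewrite dSD//; [|exact: smooth_fun_mulI|apply: smooth_funZ => //; exact: smooth_fun_id].
  rewrite dS_mulI// dSZ//; last exact: smooth_fun_id.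
  rewrite dS_dot// dS_mulI//; last exact: smooth_fun_id.
  by rewrite dS_id//; exact: tX.
have pX : dot p (X p) = 0 by exact: tX.
have pY : dot p (Y p) = 0 by exact: tY.
have pp : dot p p = 1 by exact: sp.
rewrite /sphere_tw /round_connection D !cxJI.
move: (dS Y p (X p)) => d.
set x := X p in pX *; set y := Y p in pY *.
have xp : dot x p = 0 by rewrite dotC.
have yp : dot y p = 0 by rewrite dotC.
have pIp : dot p (mulI p) = 0 by exact: dot_mulIr.
have Ipp : dot (mulI p) p = 0 by rewrite dotC.
have Ixp : dot (mulI x) p = - dot (mulI p) x by rewrite dotC -dot_mulI mulIK dotNr.
have Ixy : dot (mulI x) (mulI y) = dot x y by exact: dot_mulI.
have xIy : dot x (mulI y) = - dot (mulI x) y by rewrite dot_mulIl opprK.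
have Ipx : dot (mulI p) (mulI x) = 0 by rewrite dot_mulI.
have Ipy : dot (mulI p) (mulI y) = 0 by rewrite dot_mulI.
have IpIp : dot (mulI p) (mulI p) = 1 by rewrite dot_mulI.
rewrite !(mulIDl, mulIZ, mulIN, mulIK).
rewrite !(dotDl, dotDr, dotNl, dotNr, dotZl, dotZr).
rewrite !(pX, pY, pp, xp, yp, pIp, Ipp, Ixp, Ixy, xIy, Ipx, Ipy, IpIp).
by row_ring.
Qed.

Lemma tw_Hfield X Y : vfield X -> Hfield Y -> Hfield (sphere_tw X Y).
Proof.
move=> vX [vY hY]; have vXY := conn_vfield tw_linear vX vY.
have [sX tX] := vX; have [sY tY] := vY.
split=> // p sp; apply/levi_distributionP; split; first by case: vXY => _; exact.
have hp q : sphere q -> dot (mulI q) (Y q) = 0.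
  by move=> sq; have /levi_distributionP[] := hY q sq.
have sI : smooth_fun (fun x : ambient R n => mulI x).
  exact/smooth_fun_mulI/smooth_fun_id.
have : dS (fun x => dot (mulI x) (Y x)) p (X p) = dS (fun _ => 0) p (X p).
  by apply: dS_eq => // q sq; exact: hp.
rewrite dS_cst dS_dot// dS_mulI//; last exact: smooth_fun_id.
rewrite dS_id//; last exact: tX.
move=> E; rewrite /sphere_tw /round_connection.
have JX := dot_mulI_cxJ sp (tX p sp); have JY := dot_mulI_cxJ sp (tY p sp).
have pp : dot p p = 1 by exact: sp.
move: JX JY E; rewrite (hp p sp).
generalize (cxJ p (X p)) (cxJ p (Y p)) (dS Y p (X p)) => jx jy d JX JY E.
rewrite !(dotDl, dotDr, dotNl, dotNr, dotZl, dotZr) JX JY dot_mulI pp.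
move: E => /eqP; rewrite dot_mulIl0 addrC addr_eq0 => /eqP ->; ring.
Qed.

Lemma re_vecZ (c : R[i]) v : re_vec (c *: cplx_of v 0) = complex.Re c *: v.
Proof. by apply/rowP => i; rewrite !mxE !partE /=; ring. Qed.

Lemma im_vecZ (c : R[i]) v : im_vec (c *: cplx_of v 0) = complex.Im c *: v.
Proof. by apply/rowP => i; rewrite !mxE !partE /=; ring. Qed.

Lemma re_vec0 : re_vec (0 : ambient R[i] n) = 0.
Proof. by apply/rowP => i; rewrite !mxE. Qed.
Lemma im_vec0 : im_vec (0 : ambient R[i] n) = 0.
Proof. by apply/rowP => i; rewrite !mxE. Qed.

Lemma tw_is_tanaka_webster : is_tanaka_webster sphere_tw.
Proof.
split.
- exact: tw_linear.
- exact: tw_Hfield.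
- exact: tw_metric_compat.
- exact: tw_J.
- move=> Z W [_ _ TZ] [_ _ TW] p sp; have IZ := re_T10 (TZ p sp); have IW := re_T10 (TW p sp).
  rewrite /torsionC !tw_torsionE IZ IW !(mulIN, dotNl, dotNr) !dot_mulI.
  rewrite mulIK dotNl.
  by apply: cplx_ext; rewrite ?cplx_of_re ?cplx_of_im ?re_vec0 ?im_vec0; row_ring.
- move=> Z W [_ _ TZ] [_ _ TW] p sp; have IZ := re_T10 (TZ p sp); have IW := re_T10 (TW p sp).
  rewrite /torsionC !tw_torsionE /levi_formC !levi_formE.
  rewrite re_vec_conj im_vec_conj IZ IW opprK reebE.
  have [_ [tz tiz]] := TZ p sp; have [_ [tw tiw]] := TW p sp.
  have hw : dot (mulI p) (re_vec (W p)) = 0.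
    by move: tiw; rewrite IW /tangent dotNr -dot_mulIl.
  have hIw : dot (mulI p) (mulI (re_vec (W p))) = 0 by rewrite dot_mulI.
  rewrite (projH_id hw) (projH_id hIw).
  rewrite !(mulIN, mulIK, dotNl, dotNr) !dot_mulI [dot (mulI _) _]dot_mulIl.
  by apply: cplx_ext; rewrite ?cplx_of_re ?cplx_of_im ?re_vecZ ?im_vecZ !partE /=; row_ring.
- move=> X vX p sp; have [sX tX] := vX; rewrite /tau !tw_torsionE reebE.
  have tJ : tangent p (cxJ p (X p)) by exact/cxJ_tangent/tX.
  rewrite !mulIK !dotNl tJ [dot p (X p)]tX// !oppr0 !mulr0 !scale0r cxJI.
  by rewrite dot0r scale0r addr0 add0r linear0.
Qed.

End Connections.

(** * Uniqueness of the Levi-Civita and Tanaka-Webster connections *)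

Section Uniqueness.
Context {R : realType} {n : nat}.
Implicit Types (u v w x y p : ambient R n) (a b : R).
Implicit Types (X Y Z : ambient R n -> ambient R n).

(* The argument for uniqueness of a metric connection with given torsion: the
   trilinear form <c(u,v),w> is symmetric in (u,v) and skew in (v,w). *)
Lemma skew_symmetric_eq0 (S : set (ambient R n)) (c : ambient R n -> ambient R n -> ambient R n) :
  (forall u v, S u -> S v -> S (c u v)) ->
  (forall u v, S u -> S v -> c u v = c v u) ->
  (forall u v w, S u -> S v -> S w -> dot (c u v) w = - dot v (c u w)) ->
  forall u v, S u -> S v -> c u v = 0.
Proof.
move=> Sc sym skew u v Su Sv; apply/eqP; rewrite -dot_eq0; apply/eqP.
have H x y z : S x -> S y -> S z -> dot (c x y) z = - dot (c x y) z.
  move=> Sx Sy Sz.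
  rewrite {1}skew// dotC (sym x z)// skew// opprK dotC (sym z y)// skew//.
  by rewrite [dot z _]dotC (sym y x).
have := H u v (c u v) Su Sv (Sc _ _ Su Sv).
by move=> /eqP; rewrite -addr_eq0 -mulr2n mulrn_eq0 => /eqP.
Qed.

Section TwoConnections.
Variables nabla1 nabla2 : connection R n.
Hypotheses (L1 : is_linear_connection nabla1) (L2 : is_linear_connection nabla2).
Hypotheses (M1 : is_metric nabla1) (M2 : is_metric nabla2).
Local Notation D := (conn_diff nabla1 nabla2).
Variables (p : ambient R n) (sp : sphere p).

Lemma conn_diff_extend u v : tangent p u -> tangent p v ->
  D p u v = nabla1 (extend u) (extend v) p - nabla2 (extend u) (extend v) p.
Proof.
move=> tu tv; rewrite (conn_diffE L1 L2 (extend_vfield u) (extend_vfield v) sp).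
by rewrite !extend_id.
Qed.

Lemma conn_diff_tangent u v : tangent p u -> tangent p v -> tangent p (D p u v).
Proof.
move=> tu tv; rewrite conn_diff_extend// /tangent dotDr dotNr.
have [_ t1] := conn_vfield L1 (extend_vfield u) (extend_vfield v).
have [_ t2] := conn_vfield L2 (extend_vfield u) (extend_vfield v).
by rewrite t1// t2// subrr.
Qed.

(** Both connections differentiate the same function <v, w> in the same way; subtracting the two
    product rules leaves the skewness of the difference. *)
Lemma conn_diff_skew u v w : tangent p u -> tangent p v -> tangent p w ->
  dot (D p u v) w = - dot v (D p u w).
Proof.
move=> tu tv tw; rewrite !conn_diff_extend//.
have := M1 (extend_vfield u) (extend_vfield v) (extend_vfield w) sp.
rewrite (M2 (extend_vfield u) (extend_vfield v) (extend_vfield w) sp).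
rewrite !(websterE _ _ sp) (extend_id tv) (extend_id tw).
rewrite dotDl dotNl dotDr dotNr.
generalize (nabla1 (extend u) (extend v) p) (nabla2 (extend u) (extend v) p).
generalize (nabla1 (extend u) (extend w) p) (nabla2 (extend u) (extend w) p).
move=> a b c d E.
have -> : dot c w = dot d w + dot v b - dot v a by rewrite E addrK.
by ring.
Qed.

End TwoConnections.

Lemma levi_civita_unique nabla1 nabla2 X Y p :
  is_levi_civita nabla1 -> is_levi_civita nabla2 ->
  vfield X -> vfield Y -> sphere p -> nabla1 X Y p = nabla2 X Y p.
Proof.
move=> [L1 M1 T1] [L2 M2 T2] vX vY sp; apply/eqP; rewrite -subr_eq0; apply/eqP.
rewrite (conn_diffE L1 L2 vX vY sp).
have [_ tX] := vX; have [_ tY] := vY.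
apply: (@skew_symmetric_eq0 (tangent p)) (tX p sp) (tY p sp).
- by move=> u v; exact: conn_diff_tangent.
- move=> u v tu tv; rewrite !conn_diff_extend//.
  have := T1 _ _ (extend_vfield u) (extend_vfield v) p sp.
  have := T2 _ _ (extend_vfield u) (extend_vfield v) p sp.
  rewrite /torsion.
  generalize (nabla1 (extend u) (extend v) p) (nabla2 (extend u) (extend v) p).
  generalize (nabla1 (extend v) (extend u) p) (nabla2 (extend v) (extend u) p).
  generalize (bracket (extend u) (extend v) p) => e a b c d.
  move=> /eqP; rewrite subr_eq0 => /eqP <-.
  move=> /eqP; rewrite subr_eq0 subr_eq => /eqP ->.
  by row_ring.
- by move=> u v w; exact: conn_diff_skew.
Qed.

Lemma levi_civitaE X Y p : vfield X -> vfield Y -> sphere p ->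
  @levi_civita R n X Y p = round_connection X Y p.
Proof.
have ex := @xgetPex _ (fun _ _ _ => 0) [set nabla : connection R n | is_levi_civita nabla].
have H : is_levi_civita (@levi_civita R n).
  by apply: ex; exists round_connection; exact: round_is_levi_civita.
by apply: levi_civita_unique => //; exact: round_is_levi_civita.
Qed.

Section TanakaWebsterUnique.
Variables nabla1 nabla2 : connection R n.
Hypotheses (H1 : is_tanaka_webster nabla1) (H2 : is_tanaka_webster nabla2).
Let L1 := tw_connection H1.
Let L2 := tw_connection H2.
Local Notation D := (conn_diff nabla1 nabla2).
Variables (p : ambient R n) (sp : sphere p).

Definition horizontal p : set (ambient R n) := [set v | tangent p v /\ dot (mulI p) v = 0].

Lemma extendH_vfield v : vfield (@extendH R n v).
Proof. by have [] := extendH_Hfield v. Qed.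

Lemma horizontal_mulI v : horizontal p v -> horizontal p (mulI v).
Proof.
move=> [tv hv]; split; last by rewrite dot_mulI; exact: tv.
by rewrite /tangent -[dot p _]opprK -dot_mulIl hv oppr0.
Qed.

Lemma conn_diff_horizontal u v : tangent p u -> horizontal p v -> horizontal p (D p u v).
Proof.
move=> tu [tv hv].
have [_ h1] := tw_H_parallel H1 (extend_vfield u) (extendH_Hfield v).
have [_ h2] := tw_H_parallel H2 (extend_vfield u) (extendH_Hfield v).
have /levi_distributionP[t1 {}h1] := h1 p sp.
have /levi_distributionP[t2 {}h2] := h2 p sp.
have := conn_diffE L1 L2 (extend_vfield u) (extendH_vfield v) sp.
rewrite extend_id// extendH_id// => <-.
by split; rewrite /tangent dotDr dotNr ?t1 ?t2 ?h1 ?h2 subrr.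
Qed.

Lemma conn_diff_torsion X Y : vfield X -> vfield Y ->
  torsion nabla1 X Y p - torsion nabla2 X Y p = D p (X p) (Y p) - D p (Y p) (X p).
Proof.
move=> vX vY; rewrite -(conn_diffE L1 L2 vX vY sp) -(conn_diffE L1 L2 vY vX sp) /torsion.
generalize (nabla1 X Y p) (nabla2 X Y p) (nabla1 Y X p) (nabla2 Y X p) => a b c d.
by generalize (bracket X Y p) => e; row_ring.
Qed.

Lemma re_torsionC (nabla : connection R n) (Z W : ambient R n -> ambient R[i] n)
    X Y X' Y' q :
  (forall x, re_vec (Z x) = X x) -> (forall x, im_vec (Z x) = X' x) ->
  (forall x, re_vec (W x) = Y x) -> (forall x, im_vec (W x) = Y' x) ->
  re_vec (torsionC nabla Z W q) = torsion nabla X Y q - torsion nabla X' Y' q.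
Proof.
move=> /funext EX /funext EX' /funext EY /funext EY'.
by rewrite /torsionC cplx_of_re EX EX' EY EY'.
Qed.

(** The torsion axioms only see complex fields, so u and v are extended to the (1,0)-fields X - iJX
    and Y - iJY. The real part of the (2,0) axiom gives the torsion on (X, Y) minus that on (JX,
    JY), the real part of the (1,1) axiom their sum. Hence both connections have the same torsion on
    (u, v), which is the symmetry of their difference. *)
Lemma conn_diff_sym u v : horizontal p u -> horizontal p v -> D p u v = D p v u.
Proof.
move=> hu hv; have hIu := horizontal_mulI hu; have hIv := horizontal_mulI hv.
pose X := @extendH R n u; pose Y := @extendH R n v.
pose IX x := - mulI (X x); pose IY x := - mulI (Y x).
pose Z x := cplx_of (X x) (IX x); pose W x := cplx_of (Y x) (IY x).
have vX : vfield X by exact: extendH_vfield.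
have vY : vfield Y by exact: extendH_vfield.
have TF (F : ambient R n -> ambient R n) : Hfield F ->
    vfield (fun x => - mulI (F x)) /\ T10field (fun x => cplx_of (F x) (- mulI (F x))).
  move=> [[sF tF] hF].
  have hF' q : sphere q -> tangent q (F q) /\ dot (mulI q) (F q) = 0.
    by move=> sq; apply/levi_distributionP/hF.
  have sIF : smooth_fun (fun x => - mulI (F x)) by exact/smooth_funN/smooth_fun_mulI.
  split; first split => // q sq.
    by rewrite /tangent dotNr -dot_mulIl; have [] := hF' q sq.
  split; last by move=> q sq; apply/T10P; have [] := hF' q sq.
    by under eq_fun do rewrite cplx_of_re.
  by under eq_fun do rewrite cplx_of_im.
have [vIX TZ] := TF _ (extendH_Hfield u); have [vIY TW] := TF _ (extendH_Hfield v).
have t20 nabla : is_tanaka_webster nabla ->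
    torsion nabla X Y p - torsion nabla IX IY p = 0.
  move=> H; have := tw_torsion20 H TZ TW sp.
  move/(congr1 (@re_vec R n)); rewrite re_vec0 => <-; symmetry.
  by apply: re_torsionC => x; rewrite ?cplx_of_re ?cplx_of_im.
have t11 : torsion nabla1 X Y p - torsion nabla1 IX (fun x => - IY x) p =
           torsion nabla2 X Y p - torsion nabla2 IX (fun x => - IY x) p.
  have := tw_torsion11 H1 TZ TW sp; rewrite -(tw_torsion11 H2 TZ TW sp).
  move/(congr1 (@re_vec R n)).
  have E nabla : re_vec (torsionC nabla (fun x => cplx_of (extendH u x) (- mulI (extendH u x)))
      (fun x => conj_vec (cplx_of (extendH v x) (- mulI (extendH v x)))) p) =
      torsion nabla X Y p - torsion nabla IX (fun x => - IY x) p.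
    by apply: re_torsionC => x; rewrite ?re_vec_conj ?im_vec_conj ?cplx_of_re ?cplx_of_im.
  by rewrite !E.
have Xp : X p = u by case: hu => tu hu; exact: extendH_id.
have Yp : Y p = v by case: hv => tv hv; exact: extendH_id.
have E0 := conn_diff_torsion vX vY.
have E1 := conn_diff_torsion vIX vIY.
have E2 := conn_diff_torsion vIX (vfieldN vIY).
have {}E1 : torsion nabla1 IX IY p - torsion nabla2 IX IY p =
    D p (mulI u) (mulI v) - D p (mulI v) (mulI u).
  by rewrite [LHS]E1 -/(X p) -/(Y p) Xp Yp !(conn_diffNl, conn_diffNr, opprK).
have {}E2 : torsion nabla1 IX (fun x => - IY x) p - torsion nabla2 IX (fun x => - IY x) p =
    - (D p (mulI u) (mulI v) - D p (mulI v) (mulI u)).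
  by rewrite [LHS]E2 -/(X p) -/(Y p) Xp Yp !(conn_diffNl, conn_diffNr, opprK) opprB addrC.
rewrite Xp Yp in E0.
have := t20 _ H1; have := t20 _ H2; move: t11 E0 E1 E2.
generalize (D p u v) (D p v u) (D p (mulI u) (mulI v) - D p (mulI v) (mulI u)) => a b c.
generalize (torsion nabla1 X Y p) (torsion nabla2 X Y p).
generalize (torsion nabla1 IX IY p) (torsion nabla2 IX IY p).
generalize (torsion nabla1 IX (fun x => - IY x) p) (torsion nabla2 IX (fun x => - IY x) p).
move=> d d' e e' f f' A0 A1 A2 A3 A4 A5.
apply/dotP => w.
move/(congr1 (fun z => dot z w)): A0; move/(congr1 (fun z => dot z w)): A1;
move/(congr1 (fun z => dot z w)): A2.
move/(congr1 (fun z => dot z w)): A3; move/(congr1 (fun z => dot z w)): A4;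
move/(congr1 (fun z => dot z w)): A5.
rewrite ?(dotDl, dotNl, dot0l); gen_dots => *; lra.
Qed.

(** Split both arguments along T and H(M). On horizontal pairs the difference D is symmetric and
    skew, hence 0. The vector z = D(x, T) is horizontal by skewness, and <z, z> = -<T, D(x, z)> = 0
    because D(x, .) preserves H(M). Finally, parallelism of J gives D(T, Jx) = J D(T, x), while the
    axiom on tau gives the opposite sign. *)
Lemma tanaka_webster_diff_eq0 u v : tangent p u -> tangent p v -> D p u v = 0.
Proof.
have M1 := tw_metric H1; have M2 := tw_metric H2.
have skew := conn_diff_skew L1 L2 M1 M2 sp.
have HH x y : horizontal p x -> horizontal p y -> D p x y = 0.
  apply: (@skew_symmetric_eq0 (horizontal p)).
  - by move=> s t [ts hs]; exact: conn_diff_horizontal.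
  - exact: conn_diff_sym.
  - by move=> s t r [ts _] [tt _] [tr _]; exact: skew.
have pp : dot p p = 1 by exact: sp.
have tT : tangent p (mulI p) by rewrite /tangent dot_mulIr.
have TT : dot (mulI p) (mulI p) = 1 by rewrite dot_mulI.
have hproj x : tangent p x -> horizontal p (projH p x).
  by move=> tx; split; [exact: projH_tangent|exact: dot_projH].
have XT x : tangent p x -> D p x (mulI p) = 0.
  move=> tx; set z := D p x (mulI p).
  have tz : tangent p z by exact: conn_diff_tangent.
  have zT : dot z (mulI p) = 0.
    have := skew x (mulI p) (mulI p) tx tT tT; rewrite -/z [dot (mulI p) z]dotC.
    by move=> /eqP; rewrite -addr_eq0 -mulr2n mulrn_eq0 => /eqP.
  have hz : horizontal p z by split=> //; rewrite dotC.
  apply/eqP; rewrite -dot_eq0 {1}/z skew//.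
  have [_ h] := conn_diff_horizontal tx hz.
  by rewrite h oppr0.
have TH x : horizontal p x -> D p (mulI p) x = 0.
  move=> hx; have [tx dx] := hx.
  pose Y := @extendH R n x.
  have vY : vfield Y by exact: extendH_vfield.
  have Yp : Y p = x by exact: extendH_id.
  have vR := @reeb_vfield R n.
  have Rp : reeb p = mulI p by exact: reebE.
  have hD : horizontal p (D p (mulI p) x) by exact: conn_diff_horizontal.
  have cxJh w : horizontal p w -> cxJ p w = mulI w.
    by move=> [_ hw]; rewrite cxJI hw scale0r addr0.
  have EJ : D p (mulI p) (mulI x) = mulI (D p (mulI p) x).
    have := conn_diffE L1 L2 vR (cxJ_vfield vY) sp.
    rewrite (tw_J_parallel H1 vR vY sp) (tw_J_parallel H2 vR vY sp).
    rewrite Yp Rp (cxJh _ hx) => <-.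
    have := conn_diffE L1 L2 vR vY sp; rewrite Yp Rp => E.
    rewrite -(cxJh _ hD) -E.
    by rewrite !cxJI; generalize (nabla1 (@reeb R n) Y p) (nabla2 (@reeb R n) Y p) => a b;
      rewrite mulIDl mulIN dotDr dotNr; row_ring.
  have Et : D p (mulI p) (mulI x) + mulI (D p (mulI p) x) = 0.
    have := tw_tau H1 vY sp; have := tw_tau H2 vY sp; rewrite /tau.
    have := conn_diff_torsion vR (cxJ_vfield vY).
    have := conn_diff_torsion vR vY.
    rewrite Yp Rp (cxJh _ hx) [D p x _]XT// [D p (mulI x) _]XT; last first.
      by have [] := horizontal_mulI hx.
    rewrite !subr0 -(cxJh _ hD) => <- <-.
    generalize (torsion nabla1 (@reeb R n) Y p) (torsion nabla2 (@reeb R n) Y p) => a b.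
    generalize (torsion nabla1 (@reeb R n) (fun x0 => cxJ x0 (Y x0)) p).
    generalize (torsion nabla2 (@reeb R n) (fun x0 => cxJ x0 (Y x0)) p).
    move=> c d /eqP; rewrite addr_eq0 => /eqP -> /eqP; rewrite addr_eq0 => /eqP ->.
    by rewrite !cxJI mulIDl mulIN dotDr dotNr; row_ring.
  move: Et; rewrite EJ -mulr2n -scaler_nat => /eqP; rewrite scaler_eq0 pnatr_eq0/=.
  move=> /eqP /(congr1 mulI); rewrite mulIK linear0 => /eqP.
  by rewrite oppr_eq0 => /eqP.
move=> tu tv.
have split_ x : x = dot (mulI p) x *: mulI p + projH p x.
  by rewrite projHE addrC subrK.
rewrite (split_ u) conn_diffDl (split_ v) !conn_diffDr.
rewrite !XT ?TH ?HH ?scaler0 ?addr0//; try exact: hproj.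
  by rewrite scaler0.
exact: projH_tangent.
Qed.

End TanakaWebsterUnique.

Lemma tanaka_webster_is : is_tanaka_webster (@tanaka_webster R n).
Proof.
have ex := @xgetPex _ (fun _ _ _ => 0) [set nabla : connection R n | is_tanaka_webster nabla].
by apply: ex; exists sphere_tw; exact: tw_is_tanaka_webster.
Qed.

Lemma tanaka_websterE X Y p : vfield X -> vfield Y -> sphere p ->
  @tanaka_webster R n X Y p = sphere_tw X Y p.
Proof.
move=> vX vY sp; apply/eqP; rewrite -subr_eq0; apply/eqP.
have H1 := tanaka_webster_is; have H2 := @tw_is_tanaka_webster R n.
rewrite (conn_diffE (tw_connection H1) (tw_connection H2) vX vY sp).
have [_ tX] := vX; have [_ tY] := vY.
by apply: tanaka_webster_diff_eq0; [exact: H1|exact: H2|exact: sp|exact: tX|exact: tY].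
Qed.

End Uniqueness.

(** * Pseudohermitian curvature *)

Section Curvature.
Context {R : realType} {n : nat}.
Implicit Types (u v w x y p : ambient R n) (a b : R).
Implicit Types (X Y Z V : ambient R n -> ambient R n).
Local Notation TW := (@tanaka_webster R n).

Definition hess_row m (F : ambient R n -> 'rV[R]_m) p v w : 'rV[R]_m :=
  \row_i hess (fun x => F x 0 i) p v w.

Lemma hess_rowC m (F : ambient R n -> 'rV[R]_m) p v w :
  smooth_fun F -> sphere p -> hess_row F p v w = hess_row F p w v.
Proof.
move=> sF sp; apply/rowP => i; rewrite [LHS]mxE [RHS]mxE.
by apply: hessC; [exact: smooth_fun_coord|exact: sphere_neq0].
Qed.

Lemma dS_dS_row m (F : ambient R n -> 'rV[R]_m) X p v :
  smooth_fun F -> smooth_fun X -> sphere p -> tangent p v ->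
  dS (fun x => dS F x (X x)) p v = dS F p (dS X p v) + hess_row F p v (X p).
Proof.
move=> sF sX sp tv; apply/rowP => i; rewrite [RHS]mxE [hess_row _ _ _ _ _ _]mxE.
have sFi := smooth_fun_coord i sF.
rewrite -(dS_coord sp)//; last exact: smooth_fun_dS_row.
rewrite -(dS_coord sp)// -dS_dS//; apply: dS_eq => // q sq.
by rewrite (dS_coord sq).
Qed.

Lemma curvature_twE X Y Z p : vfield X -> vfield Y -> vfield Z -> sphere p ->
  curvature TW X Y Z p = sphere_tw X (sphere_tw Y Z) p
    - sphere_tw Y (sphere_tw X Z) p - sphere_tw (bracket X Y) Z p.
Proof.
move=> vX vY vZ sp; have L := tw_connection (@tanaka_webster_is R n).
have L' := @tw_linear R n.
have cv A B : vfield A -> vfield B -> vfield (TW A B) by exact: (conn_vfield L).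
have cv' (A B : ambient R n -> ambient R n) : vfield A -> vfield B -> vfield (sphere_tw A B)
  by exact: (conn_vfield L').
have E A B C : vfield A -> vfield B -> vfield C ->
    TW A (TW B C) p = sphere_tw A (sphere_tw B C) p.
  move=> vA vB vC; rewrite (tanaka_websterE vA (cv _ _ vB vC) sp).
  apply: (conn_eq_right L' vA (cv _ _ vB vC) (cv' _ _ vB vC)) sp => q sq.
  exact: tanaka_websterE.
rewrite /curvature (E _ _ _ vX vY vZ) (E _ _ _ vY vX vZ).
by rewrite (tanaka_websterE (bracket_vfield vX vY) vZ sp).
Qed.

Lemma HfieldP X p : Hfield X -> sphere p -> horizontal p (X p).
Proof. by move=> [_ hX] sp; apply/levi_distributionP/hX. Qed.

Lemma dot_tw X Y p e : vfield X -> vfield Y -> sphere p -> horizontal p e ->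
  dot (mulI p) (Y p) = 0 ->
  dot (sphere_tw X Y p) e =
    dot (dS Y p (X p)) e - dot (mulI p) (X p) * dot (mulI (Y p)) e.
Proof.
move=> [_ tX] [_ tY] sp [te he] hY.
have pe : dot p e = 0 by exact: te.
rewrite /sphere_tw /round_connection hY scale0r add0r cxJI hY scale0r addr0.
generalize (dS Y p (X p)) => d; rewrite !(dotDl, dotNl, dotZl) pe he.
by ring.
Qed.

Lemma horizontal_ext p u v : horizontal p u -> horizontal p v ->
  (forall e, horizontal p e -> dot u e = dot v e) -> u = v.
Proof.
move=> [tu hu] [tv hv] H; apply/eqP; rewrite -subr_eq0 -dot_eq0 dotDl dotNl.
rewrite H ?subrr//; split; rewrite /tangent dotDr dotNr ?hu ?hv ?subrr//.
by rewrite [dot p u]tu [dot p v]tv subrr.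
Qed.

(** Pairing with a horizontal e removes every term along p and ip. This loses nothing, since the
    curvature applied to X is itself horizontal ([curvature_horizontal]). *)
Lemma dot_curvature V X p e : vfield V -> Hfield X -> sphere p -> horizontal p e ->
  dot (curvature TW V X X p) e = dot (X p) (X p) * dot (V p) e
    - dot (V p) (X p) * dot (X p) e + 3 * dot (mulI (X p)) (V p) * dot (mulI (X p)) e.
Proof.
move=> vV HX sp he; have [vX _] := HX; have [sV tV] := vV; have [sX tX] := vX.
have sI : smooth_fun (fun x : ambient R n => mulI x) by exact/smooth_fun_mulI/smooth_fun_id.
have sid := @smooth_fun_id R n.
have L := @tw_linear R n.
have HW := tw_Hfield vX HX; have HW' := tw_Hfield vV HX.
have [vW _] := HW; have [vW' _] := HW'.
have hX q : sphere q -> dot (mulI q) (X q) = 0.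
  by move=> sq; have [] := HfieldP HX sq.
have dotXI q : dot (mulI (X q)) (X q) = 0 by exact: dot_mulIl0.
have dot3 (a b c w : ambient R n) : dot (a - b - c) w = dot a w - dot b w - dot c w.
  by rewrite !dotDl !dotNl.
rewrite (curvature_twE vV vX vX sp) dot3.
have [_ hWp] := HfieldP HW sp; have [_ hWp'] := HfieldP HW' sp.
have E1 := dot_tw vV vW sp he hWp; have E2 := dot_tw vX vW' sp he hWp'.
have E3 := dot_tw (bracket_vfield vV vX) vX sp he (hX p sp).
have EW q : sphere q -> sphere_tw X X q = dS X q (X q) + dot (X q) (X q) *: q.
  move=> sq; rewrite /sphere_tw /round_connection dotXI hX//.
  by rewrite !scale0r !addr0 subr0.
have EW' q : sphere q -> sphere_tw V X q = dS X q (V q) + (dot (V q) (X q) *: q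
    + (dot (mulI (V q)) (X q) *: mulI q - dot (mulI q) (V q) *: mulI (X q))).
  move=> sq; rewrite /sphere_tw /round_connection hX// scale0r add0r.
  by rewrite [cxJ q (X q)]cxJI hX// scale0r addr0 -!addrA.
have tVp := tV p sp; have tXp := tX p sp.
have sXX : smooth_fun (fun x => dot (X x) (X x)) by exact: smooth_fun_dot.
have sVX : smooth_fun (fun x => dot (V x) (X x)) by exact: smooth_fun_dot.
have sIVX : smooth_fun (fun x => dot (mulI (V x)) (X x)).
  by apply: smooth_fun_dot => //; exact: smooth_fun_mulI.
have sIV : smooth_fun (fun x => dot (mulI x) (V x)) by exact: smooth_fun_dot.
have sIX : smooth_fun (fun x => mulI (X x)) by exact: smooth_fun_mulI.
have DW : dS (sphere_tw X X) p (V p) = dS X p (dS X p (V p)) + hess_row X p (V p) (X p)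
    + (dS (fun x => dot (X x) (X x)) p (V p) *: p + dot (X p) (X p) *: V p).
  rewrite (dS_eq _ EW sp) dSD//; [|exact: smooth_fun_dS_row|exact: smooth_funZ].
  by rewrite dS_dS_row// dSZ// dS_id.
have DW' : dS (sphere_tw V X) p (X p) =
    dS X p (dS V p (X p)) + hess_row X p (X p) (V p)
    + (dS (fun x => dot (V x) (X x)) p (X p) *: p + dot (V p) (X p) *: X p
    + (dS (fun x => dot (mulI (V x)) (X x)) p (X p) *: mulI p
       + dot (mulI (V p)) (X p) *: mulI (X p)
    - ((dot (mulI (X p)) (V p) + dot (mulI p) (dS V p (X p))) *: mulI (X p)
       + dot (mulI p) (V p) *: mulI (dS X p (X p))))).
  have s1 := smooth_fun_dS_row sX sV; have s2 := smooth_funZ sVX sid.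
  have s3 := smooth_funZ sIVX sI; have s4 := smooth_funZ sIV sIX.
  have s5 := smooth_funB s3 s4.
  rewrite (dS_eq _ EW' sp) (dSD sp _ s1 (smooth_funD s2 s5)) (dSD sp _ s2 s5).
  rewrite (dSB sp _ s3 s4) (dSZ sp _ sVX sid) (dSZ sp _ sIVX sI) (dSZ sp _ sIV sIX).
  rewrite (dS_dS_row sX sV sp tXp) (dS_mulI sp _ sid) (dS_mulI sp _ sX) (dS_id sp tXp).
  by rewrite (dS_dot sp _ sI sV) (dS_mulI sp _ sid) (dS_id sp tXp).
(* The derivative of theta(X) = 0 along V. *)
have hXd : dot (mulI (V p)) (X p) + dot (mulI p) (dS X p (V p)) = 0.
  have : dS (fun x => dot (mulI x) (X x)) p (V p) = dS (fun _ => 0) p (V p).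
    by apply: dS_eq => // q sq; exact: hX.
  by rewrite dS_cst dS_dot// dS_mulI// dS_id.
have DB : dS X p (bracket V X p) = dS X p (dS X p (V p)) - dS X p (dS V p (X p)).
  have := dS_lin sp (-1) (dS V p (X p)) (dS X p (V p)) sX.
  by rewrite !scaleN1r addrC => E; rewrite /bracket E addrC.
have EB : bracket V X p = dS X p (V p) - dS V p (X p) := erefl.
have EWp := EW p sp; have hXp := hX p sp.
(* Symmetry of the second derivatives of X, which then cancel between [DW] and [DW']. *)
rewrite (hess_rowC (V p) (X p) sX sp) in DW.
have [te hhe] := he; have pe : dot p e = 0 by exact: te.
move: E1 E2 E3 DW DW' DB EB EWp hXp hXd pe hhe.
generalize (dot (sphere_tw V (sphere_tw X X) p) e).
generalize (dot (sphere_tw X (sphere_tw V X) p) e).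
generalize (dot (sphere_tw (bracket V X) X p) e).
generalize (dS (sphere_tw X X) p (V p)) (dS (sphere_tw V X) p (X p)).
generalize (dS X p (bracket V X p)) (bracket V X p) (sphere_tw X X p) (sphere_tw V X p).
generalize (dS X p (dS X p (V p))) (hess_row X p (X p) (V p)) (dS X p (dS V p (X p))).
generalize (dS (fun x => dot (X x) (X x)) p (V p)) (dS (fun x => dot (V x) (X x)) p (X p)).
generalize (dS (fun x => dot (mulI (V x)) (X x)) p (X p)).
generalize (dS X p (X p)) (dS V p (X p)) (dS X p (V p)).
generalize (V p) (X p).
move=> v x d1 d2 d3 a1 a2 a3 d4 d5 d6 d7 d8 w w' f1 f2 c1 c2 c3.
move=> -> -> -> -> -> -> -> -> hx /eqP; rewrite addr_eq0 => /eqP E pe Ipe.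
rewrite !(mulIDl, mulIZ, mulIN, mulIK).
rewrite !(dotDl, dotDr, dotNl, dotNr, dotZl, dotZr) pe Ipe hx.
have -> : dot (mulI p) d3 = - dot (mulI v) x by rewrite E opprK.
have -> : dot (mulI v) x = - dot (mulI x) v by rewrite dot_mulIl dotC.
by ring.
Qed.

Lemma curvature_horizontal V X p : vfield V -> Hfield X -> sphere p ->
  horizontal p (curvature TW V X X p).
Proof.
move=> vV HX sp; have [vX _] := HX; rewrite (curvature_twE vV vX vX sp).
have [t1 h1] := HfieldP (tw_Hfield vV (tw_Hfield vX HX)) sp.
have [t2 h2] := HfieldP (tw_Hfield vX (tw_Hfield vV HX)) sp.
have [t3 h3] := HfieldP (tw_Hfield (bracket_vfield vV vX) HX) sp.
move: t1 h1 t2 h2 t3 h3.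
generalize (sphere_tw V (sphere_tw X X) p) (sphere_tw X (sphere_tw V X) p).
generalize (sphere_tw (bracket V X) X p) => a b c ta ha tb hb tc hc.
by split; rewrite /tangent !dotDr !dotNr ?ha ?hb ?hc ?ta ?tb ?tc !subr0.
Qed.

Lemma curvatureE V X p : vfield V -> Hfield X -> sphere p ->
  curvature TW V X X p = dot (X p) (X p) *: projH p (V p)
    - dot (V p) (X p) *: X p + (3 * dot (mulI (X p)) (V p)) *: mulI (X p).
Proof.
move=> vV HX sp; have hX := HfieldP HX sp; have [tX dX] := hX; have [_ tV] := vV.
have [tIX hIX] := horizontal_mulI hX.
apply: (@horizontal_ext p); first exact: curvature_horizontal.
  have tPV := projH_tangent (tV p sp); have hPV := dot_projH (V p) sp.
  move: tPV hPV; generalize (projH p (V p)) => q tq hq.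
  split; rewrite /tangent !(dotDr, dotNr, dotZr).
    by rewrite [dot p (X p)]tX [dot p (mulI _)]tIX [dot p q]tq; ring.
  by rewrite hq dX hIX; ring.
move=> e he; rewrite (dot_curvature vV HX sp he) projHE.
have [_ hee] := he.
by rewrite !(dotDl, dotNl, dotZl) hee; ring.
Qed.

Lemma tangent_traceE p (L : ambient R n -> ambient R n) :
  tangent_trace p L = \sum_i L (tproj p (delta_mx 0 i)) 0 i.
Proof. by apply: eq_bigr => i _; rewrite mxE. Qed.

Lemma dot_tproj p v w : tangent p w -> dot (tproj p v) w = dot v w.
Proof. by rewrite /tangent => tw; rewrite /tproj dotDl dotNl dotZl tw mulr0 subr0. Qed.

Lemma sum_dot (u v : ambient R n) : \sum_i u 0 i * v 0 i = dot u v.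
Proof. by []. Qed.

(** Trace of [curvatureE]: the first term contributes 2n |X|^2, as p and ip are projected out of the
    2n + 2 ambient directions, the second -|X|^2 and the third 3 |X|^2. *)
Lemma pseudo_ricciE X p : Hfield X -> sphere p ->
  pseudo_ricci X X p = (2 * n.+1)%:R * dot (X p) (X p).
Proof.
move=> HX sp; have hX := HfieldP HX sp; have [tX dX] := hX.
have [tIX hIX] := horizontal_mulI hX.
have tIp : tangent p (mulI p) by rewrite /tangent dot_mulIr.
rewrite /pseudo_ricci tangent_traceE.
have E i : curvature TW (extend (tproj p (delta_mx 0 i))) X X p 0 i =
    dot (X p) (X p) * (1 - p 0 i * p 0 i - mulI p 0 i * mulI p 0 i)
    - X p 0 i * X p 0 i + 3 * (mulI (X p) 0 i * mulI (X p) 0 i).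
  set v := tproj p _; have tv : tangent p v by exact: tproj_tangent.
  have dv w : tangent p w -> dot w v = w 0 i.
    by move=> tw; rewrite dotC dot_tproj// dot_delta.
  have vi : v 0 i = 1 - p 0 i * p 0 i.
    rewrite -dot_delta /v /tproj dotDr dotNr dotZr dot_delta2 eqxx.
    by rewrite mulr1n [dot p _]dotC !dot_delta.
  clearbody v.
  rewrite (curvatureE (extend_vfield v) HX sp) (extend_id tv) projHE.
  rewrite -[LHS]dot_delta [dot v (X p)]dotC (dv _ tIp) (dv _ tIX) (dv _ tX).
  by rewrite !(dotDr, dotNr, dotZr) !dot_delta vi; ring.
rewrite (eq_bigr _ (fun i _ => E i)) big_split sumrB /= -!mulr_sumr !sumrB !sum_dot.
rewrite !dot_mulI sp sumr_const card_ord addnn -muln2 mulnC.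
by ring.
Qed.

Lemma pseudo_torsionE X Y p : vfield X -> sphere p -> pseudo_torsion X Y p = 0.
Proof.
move=> vX sp; rewrite /pseudo_torsion websterE// /tau.
have vT := @reeb_vfield R n.
have -> : torsion TW (@reeb R n) X p = torsion sphere_tw (@reeb R n) X p.
  by rewrite /torsion !tanaka_websterE.
rewrite tw_torsionE reebE mulIK dotNl; have [_ tX] := vX.
by rewrite [dot p (X p)]tX// oppr0 mulr0 scale0r dot0l.
Qed.

Lemma condition_iP (k : R) : (0 < n)%N -> condition_i n k <-> 0 < k <= (2 * n.+1)%:R.
Proof.
move=> n0; split=> [[k0 H]|/andP[k0 kn]].
  rewrite k0 /=.
  (* The vectors p and v lie in different complex coordinates, so v is a unit vector orthogonal to p
     and ip; n >= 1 provides the second coordinate. *)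
  pose o0 : 'I_n.+1 := ord0; pose o1 : 'I_n.+1 := @Ordinal n.+1 1 n0.
  have o10 : o1 != o0 by [].
  pose p : ambient R n := dx_vec R o0; pose v : ambient R n := dx_vec R o1.
  have sp : sphere p by rewrite /sphere/= /p dot_delta2 eqxx.
  have tv : tangent p v.
    by rewrite /tangent /p /v dot_delta2 eq_lshift eq_sym (negPf o10).
  have hv : dot (mulI p) v = 0.
    by rewrite dotC dot_delta mulI_lshift mxE eq_rlshift andbF oppr0.
  have HX := @extendH_Hfield R n v.
  have := H _ HX p sp; rewrite pseudo_ricciE// pseudo_torsionE//; last by have [] := HX.
  rewrite mulr0 addr0 levi_formE projH_id extendH_id//.
  have -> : dot v v = 1 by rewrite dot_delta2 eqxx.
  by rewrite !mulr1.
split=> // X HX p sp; rewrite pseudo_ricciE// pseudo_torsionE//; last by have [] := HX.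
have [tX hX] := HfieldP HX sp.
by rewrite mulr0 addr0 levi_formE projH_id// ler_wpM2r// dot_ge0.
Qed.

End Curvature.

(** * The sublaplacian *)

Section Laplacian.
Context {R : realType} {n : nat}.
Implicit Types (u v w x y p : ambient R n) (a b : R) (f : ambient R n -> R).
Local Notation U0 := (@punctured R n).
Local Notation oU0 := (@open_punctured R n).
Local Notation ext f := (f \o @retract R n).
Local Notation e_ i := (delta_mx 0 i : ambient R n).

(** The difference quotient is 0 as soon as 1 + h > 0. *)
Lemma derive_radial {W : normedModType R} (F : ambient R n -> W) x : 'D_x (ext F) x = 0.
Proof.
apply/lim_near_cst => //=; near=> h.
have h1 : 0 < h + 1.
  have : `|h| < 1 by near: h; exact: dnbhs0_lt.
  by rewrite ltr_norml => /andP[h1 _]; rewrite -ltrBlDr sub0r.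
have -> : h *: x + x = (h + 1) *: x by rewrite scalerDl scale1r.
by rewrite retractZ// subrr scaler0.
Unshelve. all: by end_near. Qed.

(** Differentiate dF(A y) = 0 along v. The hypothesis on derivatives says that A is its own
    differential; the two uses are the identity (rays) and [mulI] (Reeb flow). *)
Lemma hess_of_stationary f (A : ambient R n -> ambient R n) x v :
  smooth_fun f -> x != 0 -> (forall y w, is_derive y w A (A w)) ->
  (forall y, y != 0 -> 'D_(A y) (ext f) y = 0) ->
  hess f x v (A x) = - 'D_(A v) (ext f) x.
Proof.
move=> sf x0 dA stat.
have df y : y != 0 -> differentiable (ext f) y by exact: smooth_fun_differentiable.
pose S y := \sum_i A y 0 i * 'D_(e_ i) (ext f) y.
have HS : is_derive x v S (\sum_i (A v 0 i * 'D_(e_ i) (ext f) x + A x 0 i * hess f x v (e_ i))).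
  apply: is_derive_sumr => i.
  have HA := (is_derive_rowP _ _ _ _).1 (dA x v) i.
  have HD := smooth_on_is_derive v (smooth_on_derive (e_ i) sf) x0.
  have H := is_deriveM HA HD.
  by apply: (is_derive_eq H); rewrite addrC [A v 0 i * _]mulrC.
have H0 : is_derive x v S 0.
  apply: (@near_eq_is_derive _ _ _ (fun _ => 0) S).
  have := open_nbhs_nbhs (conj oU0 x0).
  rewrite -nbhs_nearE; apply: filterS => y y0; rewrite -(stat y y0).
  by rewrite derive_rowE//; exact: df.
have E := is_derive_eqE HS H0; rewrite big_split /= -(hess_rowr v (A x) sf x0) in E.
apply/eqP; rewrite -addr_eq0 addrC -E; apply/eqP; congr (_ + _).
by rewrite derive_rowE//; exact: df.
Qed.

Lemma hess_radial f x v : smooth_fun f -> x != 0 -> hess f x v x = - 'D_v (ext f) x.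
Proof.
move=> sf x0; apply: (@hess_of_stationary f id) => // y w.
exact: derive_radial.
Qed.

Definition grad f x : ambient R n := \row_i 'D_(e_ i) (ext f) x.

Lemma dot_grad f x v : smooth_fun f -> x != 0 -> dot (grad f x) v = 'D_v (ext f) x.
Proof.
move=> sf x0; rewrite derive_rowE; last exact: smooth_fun_differentiable.
by apply: eq_bigr => i _; rewrite mxE mulrC.
Qed.

Lemma dot_grad_radial f x : smooth_fun f -> x != 0 -> dot (grad f x) x = 0.
Proof. by move=> sf x0; rewrite dot_grad// derive_radial. Qed.

Lemma derive_ext_retract f x v : smooth_fun f -> x != 0 ->
  dS f (retract x) v = (ninv x)^-1 * 'D_v (ext f) x.
Proof. by move=> sf x0; rewrite /dS derive_retract. Qed.

Lemma derive_reeb f x : kerT f -> x != 0 -> 'D_(mulI x) (ext f) x = 0.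
Proof.
move=> [sf Tf] x0; have N0 := lt0r_neq0 (ninv_gt0 x0).
have := Tf (retract x) (sphere_retract x0).
rewrite reebE derive_ext_retract// {1}retractE mulIZ.
have := deriveDv (ninv x) (mulI x) 0 (smooth_fun_differentiable sf x0).
rewrite addr0 derive0 addr0 => -> /eqP.
by rewrite mulf_eq0 invr_eq0 (negPf N0) /= mulf_eq0 (negPf N0) /= => /eqP.
Qed.

Lemma hess_reeb f x v : kerT f -> x != 0 ->
  hess f x v (mulI x) = dot (mulI (grad f x)) v.
Proof.
move=> kf x0; have [sf _] := kf.
have HI y w : is_derive y w (@mulI R n) (mulI w) := is_derive_mulI (is_derive_id y w).
rewrite (hess_of_stationary v sf x0 HI) => [|y]; last exact: derive_reeb.
by rewrite -dot_grad// dot_mulIl.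
Qed.

Definition lap f x := \sum_i hess f x (e_ i) (e_ i).

Lemma gradE f p : smooth_fun f -> sphere p -> gradient f p = grad f p.
Proof.
move=> sf sp; have p0 := sphere_neq0 sp.
have tg : tangent p (grad f p) by rewrite /tangent dotC dot_grad_radial.
have ex := @xgetPex _ (0 : ambient R n) [set u | tangent p u /\
  forall v, tangent p v -> webster p u v = dS f p v].
have [tG HG] : [set u | tangent p u /\
    forall v, tangent p v -> webster p u v = dS f p v] (gradient f p).
  apply: ex; exists (grad f p); split=> // v tv.
  by rewrite websterE// dot_grad.
apply/eqP; rewrite -subr_eq0 -dot_eq0.
have td : tangent p (gradient f p - grad f p).
  by move: tG tg; rewrite /tangent; generalize (gradient f p) (grad f p) => x y tx ty;
    rewrite dotDr dotNr tx ty subrr.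
have := HG _ td; rewrite websterE// /dS -dot_grad//.
move: (gradient f p) (grad f p) => x y; set d := x - y => E.
by rewrite {1}/d dotDl dotNl E subrr.
Qed.

Lemma smooth_fun_grad f : smooth_fun f -> smooth_fun (grad f).
Proof.
move=> sf; apply: smooth_fun_rowP => i; under eq_fun do rewrite mxE.
have := smooth_fun_dS sf (smooth_fun_cst (e_ i)).
exact.
Qed.

Lemma grad_vfield f : smooth_fun f -> vfield (grad f).
Proof.
move=> sf; split; first exact: smooth_fun_grad.
by move=> p sp; rewrite /tangent dotC dot_grad_radial//; exact: sphere_neq0.
Qed.

(** As T f = 0, the gradient is already horizontal. The divergence is the trace of the Hessian over
    tangent directions, and the missing radial entry Hess(p, p) = -D_p F vanishes. *)
Lemma sublaplacianE f p : kerT f -> sphere p -> sublaplacian f p = lap f p.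
Proof.
move=> kf sp; have [sf Tf] := kf; have p0 := sphere_neq0 sp.
pose X x := projH x (gradient f x).
have XE q : sphere q -> X q = grad f q.
  move=> sq; rewrite /X gradE// projH_id//.
  by rewrite dotC dot_grad ?derive_reeb//; exact: sphere_neq0.
have vX : vfield X.
  by apply: (@vfield_eq _ _ (grad f)); [move=> q sq; rewrite XE|exact: grad_vfield].
have tg : dot p (grad f p) = 0 by have [_ t] := grad_vfield sf; exact: t.
rewrite /sublaplacian /divergence tangent_traceE.
have E i : levi_civita (extend (tproj p (e_ i))) X p 0 i =
    hess f p (e_ i) (e_ i) - p 0 i * hess f p p (e_ i) + grad f p 0 i * p 0 i.
  set v := tproj p _; have tv : tangent p v by exact: tproj_tangent.
  have dv : dot v (grad f p) = grad f p 0 i by rewrite dot_tproj// dot_delta.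
  rewrite (levi_civitaE (extend_vfield v) vX sp) /round_connection (extend_id tv) (XE p sp).
  rewrite dv (dS_eq _ XE sp) mxE [(_ *: p) 0 i]mxE; congr (_ + _).
  rewrite -(dS_coord sp); last exact: smooth_fun_grad.
  under [fun x => grad f x 0 i]eq_fun do rewrite mxE.
  rewrite -[LHS]/(dS (fun x => dS f x (e_ i)) p v).
  rewrite (dS_dS sf (smooth_fun_cst (e_ i)) sp tv) dS_cst dS_0v add0r.
  have := hess_linl (- p 0 i) p (e_ i) (e_ i) sf p0.
  rewrite mulNr => E; rewrite [RHS]addrC -E.
  suff -> : v = - p 0 i *: p + e_ i by [].
  by rewrite /v /tproj [dot p _]dotC dot_delta addrC scaleNr.
have Hr := hess_rowr p p sf p0; rewrite hess_radial// derive_radial oppr0 in Hr.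
rewrite (eq_bigr _ (fun i _ => E i)) big_split sumrB -Hr subr0 /=.
have -> : \sum_i grad f p 0 i * p 0 i = dot (grad f p) p by [].
by rewrite dotC tg addr0.
Qed.

End Laplacian.

(** * The strong maximum principle *)

Section SecondDerivativeTest.
Context {R : realType} {V : normedModType R}.
Variables (U : set V) (oU : open U).
Implicit Types (f : V -> R) (x v : V).

Lemma line_nbhs x v (A : set V) : nbhs x A ->
  exists2 t : R, 0 < t & forall s, `|s| < t -> A (x + s *: v).
Proof.
move=> /nbhs_ballP[d /= d0 dA].
have n0 : 0 < `|v| + 1 by rewrite ltr_wpDl.
exists (d / (`|v| + 1)); first by rewrite divr_gt0.
move=> s st; apply: dA; rewrite -ball_normE /= opprD addNKr normrN normrZ.
rewrite (@le_lt_trans _ _ (`|s| * (`|v| + 1)))//; first by rewrite ler_wpM2l// lerDl.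
by rewrite -ltr_pdivlMr.
Qed.

Lemma derive_at_max f x v : smooth_on U f -> U x -> (forall y, U y -> f y <= f x) ->
  'D_v f x = 0.
Proof.
move=> sf Ux fx.
have [t t0 tU] := line_nbhs v (open_nbhs_nbhs (conj oU Ux)).
pose g s := f (x + s *: v).
have gd s : s \in `](- t), t[ -> is_derive s 1 g ('D_v f (x + s *: v)).
  rewrite in_itv/= -ltr_norml => st.
  exact: (is_derive_line (smooth_on_is_derive v sf (tU s st))).
have z0 : 0 \in `](- t), t[ by rewrite in_itv/= oppr_lt0 t0.
have H := gd 0 z0; rewrite scale0r addr0 in H.
have H0 : is_derive (0 : R) 1 g (0 : R).
  apply: (@derive1_at_max _ g (- t) t 0) => //.
  - by rewrite ge0_cp// ltW.
  - by move=> s /gd [].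
  - move=> s; rewrite in_itv/= -ltr_norml => st; rewrite /g scale0r addr0.
    exact/fx/tU.
exact: is_derive_eqE H H0.
Qed.

(** A positive second derivative would stay positive on a short segment from x; two applications of
    the mean value theorem then make f exceed f x at its end. *)
Lemma derive2_at_max f x v : smooth_on U f -> U x -> (forall y, U y -> f y <= f x) ->
  'D_v ('D_v f) x <= 0.
Proof.
move=> sf Ux fx; rewrite leNgt; apply/negP => D2.
have sD := smooth_on_derive v sf; have sD2 := smooth_on_derive v sD.
have cD2 : {for x, continuous ('D_v ('D_v f))} by have := sD2 0%N; apply.
have n1 : \forall y \near x, 0 < 'D_v ('D_v f) y.
  by move/cvgr_gt : cD2; apply.
have [t t0 tU] := line_nbhs v (filterI (open_nbhs_nbhs (conj oU Ux)) n1).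
have t20 : 0 < t / 2 by rewrite divr_gt0.
have small s : 0 <= s <= t / 2 -> U (x + s *: v) /\ 0 < 'D_v ('D_v f) (x + s *: v).
  move=> /andP[s0 st]; apply: tU; rewrite ger0_norm//.
  by rewrite (le_lt_trans st)// ltr_pdivrMr// ltr_pMr// ltr1n.
have mvt (h : V -> R) (T : R) : smooth_on U h -> 0 < T -> T <= t / 2 ->
    exists2 s, 0 < s < T & h (x + T *: v) - h x = 'D_v h (x + s *: v) * T.
  move=> sh T0 Tt.
  have dh s : 0 <= s <= T -> is_derive s 1 (fun r => h (x + r *: v)) ('D_v h (x + s *: v)).
    move=> /andP[s0 sT]; have [Us _] := small s (introT andP (conj s0 (le_trans sT Tt))).
    exact: (is_derive_line (smooth_on_is_derive v sh Us)).
  have [||s] := @MVT R (fun r => h (x + r *: v)) (fun s => 'D_v h (x + s *: v)) 0 T T0.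
  - by move=> s; rewrite in_itv/= => /andP[/ltW s0 /ltW sT]; apply: dh; rewrite s0.
  - apply: derivable_within_continuous => s; rewrite in_itv/= => sT.
    by have [] := dh s sT.
  by rewrite in_itv/= subr0 scale0r addr0 => sT E; exists s.
have [s /andP[s0 st] E1] := mvt f (t / 2) sf t20 (lexx _).
have [s' /andP[s'0 s's] E2] := mvt ('D_v f) s sD s0 (ltW st).
have s'U : 0 <= s' <= t / 2 by rewrite ltW//= ltW// (lt_trans s's).
have tU' : 0 <= t / 2 <= t / 2 by rewrite lexx ltW.
have [_ p2] := small s' s'U; have [Ut _] := small _ tU'; move: E2.
rewrite (derive_at_max v sf Ux fx) subr0 => E2.
have := fx _ Ut; rewrite -subr_le0 E1 E2 leNgt => /negP; apply.
by rewrite !mulr_gt0// p2.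
Qed.

End SecondDerivativeTest.

Lemma derive_gt0_increase {R : realType} (g : R -> R) (x l T : R) :
  is_derive x 1 g l -> 0 < l -> 0 < T -> exists2 t, 0 < t < T & g x < g (x + t).
Proof.
move=> [dg dgl] l0 T0.
have : (fun h : R => h^-1 *: ((g \o shift x) (h *: 1) - g x)) @ 0^' --> l.
  by rewrite -dgl; exact: dg.
move/cvgr_gt => /(_ _ l0) /=; rewrite near_withinE => /nbhs_ballP[d /= d0 H].
pose t := Num.min d T / 2.
have m0 : 0 < Num.min d T by rewrite lt_min d0.
have t0 : 0 < t by rewrite divr_gt0.
have tm : t < Num.min d T by rewrite ltr_pdivrMr// ltr_pMr// ltr1n.
move: tm; rewrite lt_min => /andP[td tT].
exists t; first by rewrite t0.
have := H t; rewrite -ball_normE /= sub0r normrN gtr0_norm// => /(_ td).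
move=> /(_ (lt0r_neq0 t0)); rewrite [t *: 1]mulr1 => p0.
have : 0 < t * (t^-1 * (g (t + x) - g x)) by rewrite mulr_gt0.
by rewrite mulrA mulfV ?lt0r_neq0// mul1r subr_gt0 addrC.
Qed.

Section StrongMaximum.
Context {R : realType} {n : nat}.
Implicit Types (u v w x y z c q : ambient R n).
Local Notation e_ i := (delta_mx 0 i : ambient R n).
Local Notation sq v := (dot v v).

Lemma dotB_sym x y : sq (x - y) = sq (y - x).
Proof. by rewrite -opprB dotNl dotNr opprK. Qed.

Lemma dot_sqD_le u v : sq (u + v) <= 2 * sq u + 2 * sq v.
Proof.
have := dot_ge0 (u - v); rewrite !(dotDl, dotDr, dotNl, dotNr) [dot v u]dotC.
by move: (dot u u) (dot v v) (dot u v) => *; lra.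
Qed.

(** The norm of row vectors is the maximum norm, which the Euclidean one dominates; this is what
    turns bounds on [dot] into boundedness. *)
Lemma norm_le_dot v (r : R) : 0 <= r -> sq v <= r ^+ 2 -> `|v| <= r.
Proof.
move=> r0 vr; rewrite [leLHS]/Num.Def.normr/= mx_normrE bigmax_le// => -[i j] _ /=.
rewrite ord1 -(@ler_pXn2r _ 2)// ?nnegrE// -normrX ger0_norm ?sqr_ge0//.
apply: le_trans vr; rewrite /dot (bigD1 j)//= expr2 lerDl.
by apply: sumr_ge0 => k _; rewrite -expr2 sqr_ge0.
Qed.

Lemma smooth_on_sqdist (U : set (ambient R n)) c : open U -> smooth_on U (fun z => sq (z - c)).
Proof.
move=> oU; have s : smooth_on U (fun z : ambient R n => z - c).
  by apply: smooth_onB => //; [exact: smooth_on_id|exact: smooth_on_cst].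
exact: smooth_on_dot.
Qed.

Lemma continuous_sqdist c : continuous (fun z => sq (z - c)).
Proof.
move=> z; have := smooth_on_sqdist c (@openT (ambient R n)).
by move=> /(_ 0%N) /= /(_ z I).
Qed.

Lemma compact_shell c (lo hi : R) : compact [set z | lo <= sq (z - c) <= hi].
Proof.
apply: bounded_closed_compact.
  exists (`|c| + (Num.max 1 hi)); split; first by rewrite num_real.
  move=> m cm z /= /andP[_ zhi]; rewrite (le_trans _ (ltW cm))//.
  rewrite -[z](subrK c) (le_trans (ler_normD _ _))// addrC lerD2l.
  have m1 : 1 <= Num.max 1 hi by rewrite le_max lexx.
  apply: norm_le_dot; first exact: le_trans m1.
  rewrite (le_trans zhi)// (@le_trans _ _ (Num.max 1 hi))//; first by rewrite le_max lexx orbT.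
  by rewrite expr2 ler_peMl// (le_trans _ m1).
have -> : [set z | lo <= sq (z - c) <= hi] =
    (fun z => sq (z - c)) @^-1` [set t | lo <= t <= hi].
  by [].
apply: closed_comp; first by move=> z _; exact: continuous_sqdist.
rewrite (_ : [set t | lo <= t <= hi] = [set` `[lo, hi]]); first exact: itv_closed.
by apply/seteqP; split => t /=; rewrite in_itv.
Qed.

Lemma EVT_shell (f : ambient R n -> R) (U : set (ambient R n)) c lo hi z0 :
  smooth_on U f -> [set z | lo <= sq (z - c) <= hi] `<=` U -> lo <= sq (z0 - c) <= hi ->
  exists2 z, lo <= sq (z - c) <= hi & forall y, lo <= sq (y - c) <= hi -> f y <= f z.
Proof.
move=> sf sub z0P.
have [||z zP zmax] := @compact_EVT_max _ R f _ _ (@compact_shell c lo hi).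
- by exists z0.
- apply: continuous_in_subspaceT => y; rewrite inE => yP.
  by have := sf 0%N; apply; exact: sub.
by exists z; [rewrite inE in zP|move=> y yP; apply: zmax; rewrite inE].
Qed.

Lemma derive2D (U : set (ambient R n)) (f g : ambient R n -> R) x v : open U ->
  smooth_on U f -> smooth_on U g -> U x ->
  'D_v ('D_v (fun z => f z + g z)) x = 'D_v ('D_v f) x + 'D_v ('D_v g) x.
Proof.
move=> oU sf sg Ux.
have D1 z : U z -> 'D_v (fun z => f z + g z) z = 'D_v f z + 'D_v g z.
  move=> Uz.
  by have [_] := is_deriveD (smooth_on_is_derive v sf Uz) (smooth_on_is_derive v sg Uz).
rewrite (@near_eq_derive _ _ _ _ (fun z => 'D_v f z + 'D_v g z)).
  have sDf := smooth_on_derive v sf; have sDg := smooth_on_derive v sg.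
  by have [_] := is_deriveD (smooth_on_is_derive v sDf Ux) (smooth_on_is_derive v sDg Ux).
have := open_nbhs_nbhs (conj oU Ux).
by rewrite -nbhs_nearE; apply: filterS => y Uy; exact: D1.
Qed.

Section Barrier.
Variables (c : ambient R n) (A E e : R).
(* Hopf's barrier on a shell around c: the difference of squares vanishes on one
   boundary sphere and is subharmonic near it. *)
Let h z := e * ((A - sq (z - c)) ^+ 2 - E).

Lemma smooth_on_barrier (U : set (ambient R n)) : open U -> smooth_on U h.
Proof.
move=> oU; apply: smooth_onM => //; first exact: smooth_on_cst.
apply: smooth_onB => //; last exact: smooth_on_cst.
apply: smooth_onX => //; apply: smooth_onB => //; first exact: smooth_on_cst.
exact: smooth_on_sqdist.
Qed.

Lemma is_derive_sqdist z v : is_derive z v (fun x => sq (x - c)) (2 * dot (z - c) v).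
Proof.
have H : is_derive z v (fun x : ambient R n => x - c) v.
  by apply: is_derive_eq; rewrite oppr0 addr0.
have H2 := is_derive_dot H H; apply: (is_derive_eq H2).
by rewrite [dot v _]dotC; ring.
Qed.

Lemma derive_barrier z v :
  is_derive z v h (e * (- (4 * (A - sq (z - c)) * dot (z - c) v))).
Proof.
have H1 := is_deriveB (is_derive_cst A z v) (is_derive_sqdist z v).
have H2 := is_deriveM H1 H1.
have H3 := is_deriveB H2 (is_derive_cst E z v).
have H4 := is_deriveM (is_derive_cst e z v) H3.
have hE : h = cst e * (((cst A - (fun x => sq (x - c))) * (cst A - (fun x => sq (x - c)))) - cst E).
  by apply/funext => x; rewrite /h expr2.
rewrite hE; apply: (is_derive_eq H4).
rewrite !fctE /= /GRing.scale/=; ring.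
Qed.

Lemma derive2_barrier z v :
  'D_v ('D_v h) z = e * (8 * dot (z - c) v ^+ 2 - 4 * (A - sq (z - c)) * sq v).
Proof.
have -> : 'D_v h = fun z => e * (- (4 * (A - sq (z - c)) * dot (z - c) v)).
  by apply/funext => x; have [_] := derive_barrier x v.
have H1 := is_deriveB (is_derive_cst A z v) (is_derive_sqdist z v).
have H : is_derive z v (fun x : ambient R n => x - c) v.
  by apply: is_derive_eq; rewrite oppr0 addr0.
have H2 := is_derive_dot H (is_derive_cst v z v).
have H3 := is_deriveM (is_derive_cst (- (4 * e)) z v) (is_deriveM H1 H2).
have -> : (fun z => e * (- (4 * (A - sq (z - c)) * dot (z - c) v))) =
  cst (- (4 * e)) * ((cst A - (fun x => sq (x - c))) * (fun x => dot (x - c) v)).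
  by apply/funext => x /=; rewrite !fctE; ring.
have [_ ->] := H3; rewrite !fctE dot0r addr0 /GRing.scale/=; ring.
Qed.

Lemma lap_barrier z : \sum_i 'D_(e_ i) ('D_(e_ i) h) z =
  e * (8 * sq (z - c) - 4 * (n.+1 + n.+1)%:R * (A - sq (z - c))).
Proof.
under eq_bigr do rewrite derive2_barrier dotC dot_delta dot_delta2 eqxx.
rewrite -mulr_sumr sumrB -!mulr_sumr sumr_const card_ord.
rewrite (_ : \sum_i (z - c) 0 i ^+ 2 = sq (z - c)); last first.
  by apply: eq_bigr => i _; rewrite expr2.
by rewrite mulr1n; ring.
Qed.

End Barrier.

(** Radii enter squared. The ball of squared radius 4r around q leaves room for the ball around x
    that reaches the nearest point of {u = M}, whose squared radius is below r. *)
Lemma strong_maximum (U : set (ambient R n)) (u : ambient R n -> R) (M r : R) q :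
  open U -> smooth_on U u -> 0 < r -> (forall z, sq (z - q) <= 4 * r -> U z) ->
  (forall z, U z -> u z <= M) ->
  (forall z, U z -> 0 <= \sum_i 'D_(e_ i) ('D_(e_ i) u) z) -> u q = M ->
  forall x, sq (x - q) < r -> u x = M.
Proof.
move=> oU su r0 UB uM subh uq x xq; apply/eqP; rewrite eq_le; apply/andP; split.
  by apply/uM/UB; rewrite (le_trans (ltW xq))// ler_peMl// ?ler1n// ltW.
rewrite leNgt; apply/negP => ux.
(* Hopf's boundary point lemma at the point y of {u = M} nearest to x. *)
have [y [yb uy ymin]] : exists y, [/\ sq (y - q) <= 4 * r, u y = M &
    forall z, sq (z - q) <= 4 * r -> u z = M -> sq (y - x) <= sq (z - x)].
  pose B := [set z | 0 <= sq (z - q) <= 4 * r].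
  pose K := B `&` [set z | u z = M].
  have cB : compact B by exact: compact_shell.
  have BE z : B z <-> sq (z - q) <= 4 * r by rewrite /B/= dot_ge0.
  have clK : closed K.
    move=> z clz; have Bz : B z.
      apply: (compact_closed (@norm_hausdorff _ _) cB) => W /clz [w [[Bw _] Ww]].
      by exists w.
    split=> //; apply: contrapT => /= /eqP uz.
    have Uz : U z by apply/UB/BE.
    have cu : {for z, continuous u} by have := su 0%N; apply.
    have nuz : nbhs z (u @^-1` [set t | t != M]).
      by apply: cu; exact: (open_nbhs_nbhs (conj (open_neq (y := M)) uz)).
    have [w [[_ uw] /= uwn]] := clz _ nuz.
    by rewrite uw eqxx in uwn.
  have cK : compact K by apply: (subclosed_compact clK cB) => z [].
  have K0 : K !=set0.
    by exists q; split=> //; apply/BE; rewrite subrr dot0l mulr_ge0// ltW.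
  have [|y yK ymax] := @compact_EVT_max _ R (fun z => - sq (z - x)) _ K0 cK.
    apply: continuous_subspaceT => z.
    exact: (continuousN (@continuous_sqdist x z)).
  rewrite inE in yK; have [yB uy] := yK.
  exists y; split; [exact/BE|exact: uy|].
  move=> z zb uz; rewrite -lerN2; apply: ymax; rewrite inE; split=> //; exact/BE.
set d := sq (y - x).
have d0 : 0 < d.
  rewrite /d dot_gt0 subr_eq0; apply: contraTneq ux => <-.
  by rewrite uy ltxx.
have dr : d < r.
  apply: le_lt_trans xq; rewrite [leRHS]dotB_sym; apply: ymin => //.
  by rewrite subrr dot0l mulr_ge0// ltW.
have near_q z : sq (z - x) <= d -> sq (z - q) <= 4 * r.
  move=> zd; rewrite -[z - q](subrKA x) (le_trans (dot_sqD_le _ _))//.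
  by move: zd (ltW dr) (ltW xq) => *; lra.
pose N : R := (n.+1 + n.+1)%:R.
have N2 : 2 <= N by rewrite /N ler_nat addSn addnS !ltnS.
(* The relative thickness of the shell. For s > (1 - k) d the Laplacian of the barrier is
   proportional to 8s - 4N((1 + k)d - s), where 8s > 7d because k <= 1/8, and the subtracted part is
   below 8Nkd = 2d. *)
pose k := (4 * N)^-1.
have N0 : 0 < N by rewrite (lt_le_trans _ N2).
have k0 : 0 < k by rewrite invr_gt0 mulr_gt0.
have kN : k * N = 4^-1 by rewrite /k invfM -mulrA mulVf ?mulr1// gt_eqF.
have k8 : k <= 8^-1 by rewrite lef_pV2 ?posrE ?mulr_gt0//; lra.
(* At squared distance d the barrier bracket is (kd)^2 - E = 0, and at [lo] it is (2kd)^2 - E =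
   3E. *)
pose lo := (1 - k) * d; pose A := (1 + k) * d; pose E := (k * d) ^+ 2.
have lod : lo <= d by rewrite /lo ler_piMl ?ltW//; lra.
have inner z : sq (z - x) < d -> u z < M.
  move=> zd; have zb := near_q z (ltW zd).
  rewrite lt_def eq_sym uM ?andbT; last exact: UB.
  by apply: contraTneq zd => uz; rewrite -leNgt; exact: ymin.
have shellU l : [set z | l <= sq (z - x) <= d] `<=` U.
  by move=> z /= /andP[_ zd]; exact/UB/near_q.
(* The inner sphere lies strictly inside the ball, so by compactness u stays below M there by the
   fixed amount M - u z1. *)
have [z1 /andP[z1a z1b] z1max] : exists2 z, lo <= sq (z - x) <= lo &
    forall y, lo <= sq (y - x) <= lo -> u y <= u z.
  apply: (@EVT_shell u U x lo lo (x + Num.sqrt (1 - k) *: (y - x)) su).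
    by move=> z /= /andP[_ zl]; exact/UB/near_q/(le_trans zl).
  rewrite addrAC subrr add0r dotZl dotZr mulrA -expr2 sqr_sqrtr; last by lra.
  by rewrite /lo -/d lexx.
have lod' : lo < d by rewrite /lo gtr_pMl//; lra.
have m_lt : u z1 < M by exact/inner/(le_lt_trans z1b).
(* On the inner sphere the barrier then equals M - u z1 exactly. *)
pose e := (M - u z1) / (3 * E).
have E0 : 0 < E by rewrite exprn_gt0// mulr_gt0.
have e0 : 0 < e by rewrite divr_gt0 ?subr_gt0// mulr_gt0.
pose h z := e * ((A - sq (z - x)) ^+ 2 - E).
pose w z := u z + h z.
have sh : smooth_on U h by exact: smooth_on_barrier.
have sw : smooth_on U w by exact: smooth_onD.
have hd z : sq (z - x) = d -> h z = 0.
  by move=> zd; rewrite /h zd /A /E; ring.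
have wM z : lo <= sq (z - x) <= d -> w z <= M.
  have [z2 z2P z2max] : exists2 z, lo <= sq (z - x) <= d &
      forall y, lo <= sq (y - x) <= d -> w y <= w z.
    by apply: (@EVT_shell w U x lo d y sw (shellU lo)); rewrite lod lexx.
  move=> zP; apply: le_trans (z2max z zP) _.
  have Uz2 : U z2 by exact: shellU z2P.
  move: z2P; rewrite le_eqVlt => /andP[/orP[/eqP z2lo|z2lo] z2d].
    have -> : M = u z1 + (M - u z1) by rewrite addrC subrK.
    rewrite lerD//; first by apply: z1max; rewrite -z2lo lexx.
    rewrite le_eqVlt; apply/orP; left; apply/eqP.
    rewrite /h -z2lo /A /lo.
    have -> : ((1 + k) * d - (1 - k) * d) ^+ 2 - E = 3 * E by rewrite /E; ring.
    by rewrite /e divfK// gt_eqF// mulr_gt0.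
  move: z2d; rewrite le_eqVlt => /orP[/eqP z2d|z2d].
    by rewrite /w hd// addr0; exact: uM.
  (* A maximum of w inside the open shell is impossible: the Laplacian of w is positive there. *)
  pose O := [set z | lo < sq (z - x) < d].
  have oO : open O.
    rewrite (_ : O = (fun z => sq (z - x)) @^-1` [set` `]lo, d[]); last first.
      by apply/seteqP; split => t /=; rewrite in_itv.
    by apply: open_comp; [move=> t _; exact: continuous_sqdist|exact: itv_open].
  have OU : O `<=` U by move=> t /andP[t1 t2]; apply: (shellU lo); rewrite /= !ltW.
  have Oz2 : O z2 by rewrite /O/= z2lo.
  exfalso.
  have : \sum_i 'D_(e_ i) ('D_(e_ i) w) z2 <= 0.
    rewrite -oppr_ge0 -sumrN; apply: sumr_ge0 => i _; rewrite oppr_ge0.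
    apply: (derive2_at_max oO (e_ i) (smooth_onS OU sw) Oz2).
    by move=> t /andP[t1 t2]; apply: z2max; rewrite !ltW.
  have -> : \sum_i 'D_(e_ i) ('D_(e_ i) w) z2 = \sum_i 'D_(e_ i) ('D_(e_ i) u) z2
      + e * (8 * sq (z2 - x) - 4 * N * (A - sq (z2 - x))).
    rewrite -(lap_barrier x A E e z2) -big_split; apply: eq_bigr => i _.
    exact: (derive2D (e_ i) oU su sh Uz2).
  have := subh z2 Uz2; move: (\sum_i _) => Lu Lu0.
  rewrite leNgt => /negP; apply; rewrite ltr_wpDl//.
  rewrite mulr_gt0//; move: z2lo; rewrite /lo /A; move: (sq (z2 - x)) => s slo.
  have B1 : N * ((1 - k) * d) < N * s by rewrite ltr_pM2l.
  have B2 : N * (k * d) = 4^-1 * d by rewrite mulrA [N * k]mulrC kN.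
  have B3 : k * d <= 8^-1 * d by rewrite ler_wpM2r// ltW.
  have -> : 8 * s - 4 * N * ((1 + k) * d - s) =
    8 * s + 4 * (N * s) - 4 * (N * d) - 4 * (N * (k * d)) by ring.
  have E1 : N * ((1 - k) * d) = N * d - N * (k * d) by ring.
  have E2 : (1 - k) * d = d - k * d by ring.
  rewrite E1 B2 in B1; rewrite E2 in slo; rewrite B2.
  move: B1 B3 slo d0; generalize (N * s) (N * d) (k * d) => X Y Z *; lra.
have Uy : U y by exact: UB.
(* As an interior maximum of u, y is a critical point of u, whereas the barrier strictly grows from
   y towards x. So w exceeds w y = M inside the shell, against [wM]. *)
have Dy : is_derive (y + (0 : R) *: (x - y)) (x - y) w
    (0 + e * (- (4 * (A - d) * dot (y - x) (x - y)))).
  rewrite scale0r addr0; apply: is_deriveD; last exact: derive_barrier.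
  have H := smooth_on_is_derive (x - y) su Uy.
  apply: (is_derive_eq H); apply: (derive_at_max oU (x - y) su Uy) => z Uz.
  by rewrite uy; exact: uM.
have lpos : 0 < 0 + e * (- (4 * (A - d) * dot (y - x) (x - y))).
  rewrite add0r mulr_gt0// -[x - y]opprB dotNr -/d mulrN opprK !mulr_gt0//.
  by rewrite /A mulrDl mul1r addrAC subrr add0r mulr_gt0.
(* For t < k/2 one has (1 - t)^2 > 1 - k, so the point y + t(x - y) is still in the shell. *)
have k20 : 0 < k / 2 by rewrite divr_gt0.
have [t /andP[t0 tk]] := derive_gt0_increase (is_derive_line Dy) lpos k20.
rewrite scale0r addr0 add0r; apply/negP; rewrite -leNgt.
have -> : w y = M by rewrite /w uy hd// addr0.
apply: wM.
have -> : y + t *: (x - y) - x = (1 - t) *: (y - x).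
  by rewrite -[x - y]opprB scalerN addrAC scalerBl scale1r.
rewrite dotZl dotZr -/d mulrA /lo; move: d0 t0 tk k8; clear => d0 t0 tk k8.
by apply/andP; split; [rewrite ler_wpM2r ?ltW//|rewrite ler_piMl ?ltW//]; nra.
Qed.

End StrongMaximum.

(** * The Bochner formula *)

Section Bochner.
Context {R : realType} {n : nat}.
Implicit Types (u v w x y p : ambient R n) (a b c : R).
Local Notation U0 := (@punctured R n).
Local Notation oU0 := (@open_punctured R n).
Local Notation ext f := (f \o @retract R n).
Local Notation e_ i := (delta_mx 0 i : ambient R n).

Lemma derive_near_eq {W : normedModType R} (g h : ambient R n -> W) x v :
  x != 0 -> (forall y, y != 0 -> g y = h y) -> 'D_v g x = 'D_v h x.
Proof.
move=> x0 gh; apply: near_eq_derive; have := open_nbhs_nbhs (conj oU0 x0).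
by rewrite -nbhs_nearE; apply: filterS => y y0; exact: gh.
Qed.

(** Variant of [derive_homog] with a scaling factor [s] and a hypothesis off the origin only, as
    suits the derivatives of F, which have negative degree. *)
Lemma derive_homog_near (g : ambient R n -> R) (a s : R) x v :
  a != 0 -> x != 0 -> smooth_on U0 g -> (forall y, y != 0 -> g (a *: y) = s * g y) ->
  'D_v g (a *: x) = a^-1 * (s * 'D_v g x).
Proof.
move=> a0 x0 sg gE.
have ax0 : a *: x != 0 by rewrite scaler_eq0 negb_or a0.
have dg := smooth_on_differentiable sg ax0.
have da : differentiable ( *:%R a : ambient R n -> ambient R n) x by [].
have E1 : 'D_v (g \o *:%R a) x = a * 'D_v g (a *: x).
  rewrite deriveE; last exact: differentiable_comp.
  rewrite diff_comp// /= diff_val -deriveE//.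
  by have := deriveDv a v 0 dg; rewrite addr0 derive0 addr0.
have E2 : 'D_v (g \o *:%R a) x = s * 'D_v g x.
  rewrite (derive_near_eq v x0 (h := s *: g)) => [|y y0]; last exact: gE.
  have H := is_deriveZ s (smooth_on_is_derive v sg x0).
  by have [_] := H.
by rewrite -E2 E1 mulKf.
Qed.

Variables (f : ambient R n -> R) (sf : smooth_fun f).
Local Notation F := (ext f).
Local Notation D i := ('D_(e_ i) F).

Lemma derive_extZ (a : R) x v : 0 < a -> x != 0 -> 'D_v F (a *: x) = a^-1 * 'D_v F x.
Proof.
move=> a0 x0; rewrite (@derive_homog_near F a 1) ?mul1r//; first exact: lt0r_neq0.
by move=> y y0; rewrite mul1r /= retractZ.
Qed.

Lemma hessZ (a : R) x v w : 0 < a -> x != 0 ->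
  hess f (a *: x) v w = a^-1 * (a^-1 * hess f x v w).
Proof.
move=> a0 x0; rewrite /hess (@derive_homog_near ('D_w F) a a^-1)//.
- exact: lt0r_neq0.
- exact: smooth_on_derive.
- by move=> y y0; exact: derive_extZ.
Qed.

Lemma lapZ (a : R) x : 0 < a -> x != 0 -> lap f (a *: x) = a^-1 * (a^-1 * lap f x).
Proof.
move=> a0 x0; rewrite /lap !mulr_sumr.
by apply: eq_bigr => i _; rewrite hessZ.
Qed.

Definition gradsq x := dot (grad f x) (grad f x).

Lemma gradsqE x : gradsq x = \sum_i D i x * D i x.
Proof. by apply: eq_bigr => i _; rewrite !mxE. Qed.

Lemma gradsqZ (a : R) x : 0 < a -> x != 0 -> gradsq (a *: x) = a^-1 * a^-1 * gradsq x.
Proof.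
move=> a0 x0; rewrite !gradsqE mulr_sumr; apply: eq_bigr => i _.
by rewrite derive_extZ// mulrACA.
Qed.

Lemma smooth_on_gradsq : smooth_on U0 gradsq.
Proof.
apply: (@smooth_on_eq _ _ _ oU0 _ (fun x => \sum_i D i x * D i x)).
  by move=> x _; rewrite gradsqE.
apply: (smooth_on_sum oU0) => i; apply: (smooth_onM oU0); exact: smooth_on_derive.
Qed.

Lemma is_derive_ext x v : x != 0 -> is_derive x v F ('D_v F x).
Proof. by move=> x0; exact: smooth_on_is_derive. Qed.

Lemma is_derive_D x v w : x != 0 -> is_derive x v ('D_w F) (hess f x v w).
Proof. by move=> x0; apply: (smooth_on_is_derive v (smooth_on_derive w sf)). Qed.

Lemma is_derive_hess x v w z : x != 0 ->
  is_derive x v (fun y => hess f y w z) ('D_v (fun y => hess f y w z) x).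
Proof.
by move=> x0; apply: (smooth_on_is_derive v (smooth_on_derive w (smooth_on_derive z sf))).
Qed.

Lemma is_derive_gradsq x v : x != 0 ->
  is_derive x v gradsq (2 * \sum_i D i x * hess f x v (e_ i)).
Proof.
move=> x0; have -> : gradsq = fun y => \sum_i D i y * D i y.
  by apply/funext => y; exact: gradsqE.
rewrite mulr_sumr; apply: is_derive_sumr => i.
have H := is_deriveM (is_derive_D v (e_ i) x0) (is_derive_D v (e_ i) x0).
by apply: (is_derive_eq H); rewrite /GRing.scale/=; ring.
Qed.

(* The factor |x|^2 makes [pfun] homogeneous of degree 0, so that it attains its
   maximum over the punctured space on the sphere. *)
Definition pfun c x := dot x x * gradsq x + c * (F x * F x).

Lemma smooth_on_pfun c : smooth_on U0 (pfun c).
Proof.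
apply: (smooth_onD oU0); apply: (smooth_onM oU0).
- exact/smooth_on_sqdot/oU0.
- exact: smooth_on_gradsq.
- exact: (smooth_on_cst oU0).
- by apply: (smooth_onM oU0).
Qed.

Lemma pfunZ c (a : R) x : 0 < a -> x != 0 -> pfun c (a *: x) = pfun c x.
Proof.
move=> a0 x0; rewrite /pfun gradsqZ// dotZl dotZr /= retractZ//; congr (_ + _).
by field; exact: lt0r_neq0.
Qed.

Lemma is_derive_pfun c x v : x != 0 -> is_derive x v (pfun c)
  (2 * dot x v * gradsq x + dot x x * (2 * \sum_i D i x * hess f x v (e_ i))
   + 2 * c * (F x * 'D_v F x)).
Proof.
move=> x0; have H1 := is_deriveM (is_derive_sqdot x v) (is_derive_gradsq v x0).
have HF := is_derive_ext v x0.
have H2 := is_deriveM (is_derive_cst c x v) (is_deriveM HF HF).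
have H := is_deriveD H1 H2; apply: (is_derive_eq H).
rewrite !fctE /= /GRing.scale/=; move: ('D_v F x) => d.
move: (\sum_i _) => s; ring.
Qed.

Lemma derive2_pfun c x v : x != 0 -> 'D_v ('D_v (pfun c)) x =
  2 * dot v v * gradsq x + 4 * dot x v * (2 * \sum_i D i x * hess f x v (e_ i))
  + dot x x * (2 * \sum_i (hess f x v (e_ i) * hess f x v (e_ i)
                       + D i x * 'D_v (fun y => hess f y v (e_ i)) x))
  + 2 * c * ('D_v F x * 'D_v F x + F x * hess f x v v).
Proof.
move=> x0.
rewrite (derive_near_eq v x0 (h := fun y =>
   2 * dot y v * gradsq y + dot y y * (2 * \sum_i D i y * hess f y v (e_ i))
   + 2 * c * (F y * 'D_v F y))) => [|y y0]; last by have [] := is_derive_pfun c v y0.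
have Hxv : is_derive x v (fun y => dot y v) (dot v v).
  have H := is_derive_dot (is_derive_id x v) (is_derive_cst v x v).
  by apply: (is_derive_eq H); rewrite dot0r addr0.
have H1 := is_deriveM (is_deriveM (is_derive_cst (2 : R) x v) Hxv) (is_derive_gradsq v x0).
have HS : is_derive x v (fun y => \sum_i D i y * hess f y v (e_ i))
    (\sum_i (hess f x v (e_ i) * hess f x v (e_ i)
             + D i x * 'D_v (fun y => hess f y v (e_ i)) x)).
  apply: is_derive_sumr => i.
  have H := is_deriveM (is_derive_D v (e_ i) x0) (is_derive_hess v v (e_ i) x0).
  apply: (is_derive_eq H); rewrite /GRing.scale/=.
  by move: (hess f x v _) ('D_v _ x) (D i x) => ? ? ?; ring.
have H2 := is_deriveM (is_derive_sqdot x v) (is_deriveM (is_derive_cst (2 : R) x v) HS).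
have H3 := is_deriveM (is_derive_cst (2 * c) x v)
  (is_deriveM (is_derive_ext v x0) (is_derive_D v v x0)).
have [_] := is_deriveD (is_deriveD H1 H2) H3.
rewrite !fctE /= /GRing.scale/= => ->.
move: (hess f x v v) ('D_v F x) => ? ?.
move: (\sum_i D i x * _) (\sum_i (_ + _)) => ? ?; ring.
Qed.

End Bochner.

(** * The Frobenius inner product of matrices *)

Section Frobenius.
Context {R : realType} {n : nat}.
Implicit Types (u v w z : ambient R n) (A B : 'M[R]_(n.+1 + n.+1)).

Definition frob A B : R := \sum_i \sum_j A i j * B i j.
Definition outer u v : 'M[R]_(n.+1 + n.+1) := \matrix_(i, j) (u 0 i * v 0 j).

Lemma frobC A B : frob A B = frob B A.
Proof. by apply: eq_bigr => i _; apply: eq_bigr => j _; rewrite mulrC. Qed.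

Lemma frobDl A B C : frob (A + B) C = frob A C + frob B C.
Proof.
rewrite /frob -big_split; apply: eq_bigr => i _; rewrite -big_split.
by apply: eq_bigr => j _; rewrite mxE mulrDl.
Qed.

Lemma frobZl (a : R) A C : frob (a *: A) C = a * frob A C.
Proof.
rewrite /frob mulr_sumr; apply: eq_bigr => i _; rewrite mulr_sumr.
by apply: eq_bigr => j _; rewrite mxE mulrA.
Qed.

Lemma frobNl A C : frob (- A) C = - frob A C.
Proof. by rewrite -scaleN1r frobZl mulN1r. Qed.

Lemma frobDr A B C : frob C (A + B) = frob C A + frob C B.
Proof. by rewrite ![frob C _]frobC frobDl. Qed.
Lemma frobZr (a : R) A C : frob C (a *: A) = a * frob C A.
Proof. by rewrite ![frob C _]frobC frobZl. Qed.
Lemma frobNr A C : frob C (- A) = - frob C A.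
Proof. by rewrite ![frob C _]frobC frobNl. Qed.

Lemma frob_outer u v w z : frob (outer u v) (outer w z) = dot u w * dot v z.
Proof.
rewrite /frob /dot mulr_suml; apply: eq_bigr => i _; rewrite mulr_sumr.
by apply: eq_bigr => j _; rewrite !mxE mulrACA.
Qed.

Lemma frob1_outer u v : frob 1 (outer u v) = dot u v.
Proof.
apply: eq_bigr => i _; rewrite (bigD1 i)//= big1 => [|j ji].
  by rewrite !mxE eqxx mul1r addr0.
by rewrite mxE eq_sym (negPf ji) mul0r.
Qed.

Lemma frob_outer1 u v : frob (outer u v) 1 = dot u v.
Proof. by rewrite frobC frob1_outer. Qed.

Lemma frob1l A : frob 1 A = \sum_i A i i.
Proof.
apply: eq_bigr => i _; rewrite (bigD1 i)//= big1 => [|j ji].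
  by rewrite !mxE eqxx mul1r addr0.
by rewrite mxE eq_sym (negPf ji) mul0r.
Qed.

Lemma frob11 : frob 1 1 = (2 * n.+1)%:R.
Proof.
rewrite frob1l; under eq_bigr do rewrite mxE eqxx mulr1n.
by rewrite sumr_const card_ord addnn -muln2 mulnC.
Qed.

Lemma frob_ge0 A : 0 <= frob A A.
Proof. by apply: sumr_ge0 => i _; apply: sumr_ge0 => j _; rewrite -expr2 sqr_ge0. Qed.

Lemma frob_eq0 A : frob A A = 0 -> A = 0.
Proof.
move=> /psumr_eq0P A0; apply/matrixP => i j; rewrite mxE.
have Ai : \sum_j A i j * A i j = 0.
  by apply: A0 => // k _; apply: sumr_ge0 => l _; rewrite -expr2 sqr_ge0.
move/psumr_eq0P : Ai => Ai; apply/eqP; rewrite -[_ == 0]orbb -mulf_eq0; apply/eqP.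
by apply: Ai => // k _; rewrite -expr2 sqr_ge0.
Qed.

End Frobenius.

(** * The Bochner identity for a Reeb-invariant eigenfunction *)

Section Eigenfunction.
Context {R : realType} {n : nat}.
Implicit Types (u v w x y p : ambient R n) (a b c : R).
Local Notation U0 := (@punctured R n).
Local Notation oU0 := (@open_punctured R n).
Local Notation ext f := (f \o @retract R n).
Local Notation e_ i := (delta_mx 0 i : ambient R n).

Variables (f : ambient R n -> R) (kf : kerT f) (lam : R).
Hypothesis ef : forall p, sphere p -> lap f p = - lam * f p.
Let sf : smooth_fun f := kf.1.
Local Notation F := (ext f).
Local Notation D i := ('D_(e_ i) F).

(** The Laplacian of F has degree -2. This form of the eigenvalue equation holds off the sphere and
    can therefore be differentiated in every direction. *)
Lemma lap_ext x : x != 0 -> lap f x = - lam * (F x * (ninv x * ninv x)).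
Proof.
move=> x0; have N := ninv_gt0 x0; have N0 := lt0r_neq0 N.
have := lapZ sf N x0; rewrite -retractE ef; last exact: sphere_retract.
move/(congr1 (fun t => ninv x * (ninv x * t))); rewrite !mulVKf// => <-.
by rewrite /=; ring.
Qed.

Lemma derive_lap p v : sphere p ->
  'D_v (lap f) p = - lam * ('D_v F p - 2 * F p * dot p v).
Proof.
move=> sp; have p0 := sphere_neq0 sp.
rewrite (derive_near_eq v p0 lap_ext).
have HN : is_derive p v (@ninv R n) (- dot p v).
  have H := smooth_on_is_derive v (@smooth_on_ninv R n) p0.
  by apply: (is_derive_eq H); rewrite derive_ninv// ninv1// expr1n mulr1.
have HF := is_derive_ext sf v p0.
have [_] := is_deriveM (is_derive_cst (- lam) p v) (is_deriveM HF (is_deriveM HN HN)).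
rewrite !fctE /= (ninv1 sp) /GRing.scale/= => ->.
move: ('D_v F p) => ?; ring.
Qed.

Lemma sum_third i p : sphere p ->
  \sum_j 'D_(e_ j) (fun y => hess f y (e_ j) (e_ i)) p = 'D_(e_ i) (lap f) p.
Proof.
move=> sp; have p0 := sphere_neq0 sp.
have H : is_derive p (e_ i) (lap f) (\sum_j 'D_(e_ i) (fun y => hess f y (e_ j) (e_ j)) p).
  by apply: is_derive_sumr => j; exact: is_derive_hess.
have [_ ->] := H; apply: eq_bigr => j _.
transitivity ('D_(e_ j) (fun y => hess f y (e_ i) (e_ j)) p).
  by apply: (derive_near_eq (e_ j) p0) => y y0; exact: hessC.
exact: (derive_comm (e_ j) (e_ i) oU0 (smooth_on_derive (e_ j) sf) p0).
Qed.

Definition hess_mx p : 'M[R]_(n.+1 + n.+1) := \matrix_(i, j) hess f p (e_ i) (e_ j).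

Lemma frob_hess_outer p u v : sphere p -> frob (hess_mx p) (outer u v) = hess f p u v.
Proof.
move=> sp; have p0 := sphere_neq0 sp.
rewrite hess_rowr// [RHS](eq_bigr (fun j => \sum_i v 0 j * (u 0 i * hess f p (e_ i) (e_ j)))).
  rewrite exchange_big /=; apply: eq_bigr => i _; apply: eq_bigr => j _.
  by rewrite !mxE; ring.
move=> j _; rewrite -mulr_sumr (@hessC R n f p u (e_ j) sf p0).
rewrite (@hess_rowr R n f p (e_ j) u sf p0).
apply: f_equal; apply: eq_bigr => i _.
by rewrite (@hessC R n f p (e_ j) (e_ i) sf p0).
Qed.

(** The coefficient 2n - 2 is (2n + 2) - 4: the Laplacian of |x|^2 gives 2n + 2, and the cross term
    gives -4 through Hess(v, p) = -D_v F. The radial entries inside |Hess|^2 add 2 |grad F|^2, which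
    restores the Ricci constant 2n of the round sphere. *)
Lemma lap_pfun c p : sphere p -> \sum_j 'D_(e_ j) ('D_(e_ j) (pfun f c)) p =
  2 * (frob (hess_mx p) (hess_mx p) + (2 * n%:R - 2 - lam + c) * gradsq f p
       - c * lam * (F p * F p)).
Proof.
move=> sp; have p0 := sphere_neq0 sp; have pp : dot p p = 1 by [].
rewrite (eq_bigr _ (fun j _ => derive2_pfun sf c (e_ j) p0)).
rewrite !big_split /= pp.
have -> : \sum_j 2 * dot (e_ j) (e_ j) * gradsq f p = (2 * (2 * n.+1)%:R) * gradsq f p.
  under eq_bigr do rewrite dot_delta2 eqxx mulr1n mulr1.
  rewrite sumr_const card_ord addnn -muln2 -mulr_natr [(2 * n.+1)%N]mulnC; ring.
have -> : \sum_j 4 * dot p (e_ j) * (2 * \sum_i D i p * hess f p (e_ j) (e_ i)) =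
    - 8 * gradsq f p.
  rewrite (eq_bigr (fun j => \sum_i 8 * (D i p * (p 0 j * hess f p (e_ i) (e_ j))))).
    rewrite exchange_big /= gradsqE mulr_sumr; apply: eq_bigr => i _.
    rewrite -!mulr_sumr -hess_rowr// hess_radial//.
    by move: (D i p) => ?; ring.
  move=> j _; rewrite dotC dot_delta !mulr_sumr; apply: eq_bigr => i _.
  rewrite [hess f p (e_ j) _]hessC//.
  by move: (D i p) (hess f p _ _) => ? ?; ring.
have -> : \sum_j 1 * (2 * \sum_i (hess f p (e_ j) (e_ i) * hess f p (e_ j) (e_ i)
      + D i p * 'D_(e_ j) (fun y => hess f y (e_ j) (e_ i)) p)) =
    2 * (frob (hess_mx p) (hess_mx p) - lam * gradsq f p).
  under eq_bigr do rewrite mul1r big_split /=.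
  rewrite -mulr_sumr big_split /=; congr (_ * (_ + _)).
    by apply: eq_bigr => i _; apply: eq_bigr => j _; rewrite !mxE.
  rewrite exchange_big /=.
  rewrite (eq_bigr (fun i => - lam * (D i p * D i p) + 2 * lam * F p * (p 0 i * D i p))).
    rewrite big_split -!mulr_sumr -gradsqE /=.
    have -> : \sum_i p 0 i * D i p = 0.
      transitivity (dot p (grad f p)); last by rewrite dotC dot_grad_radial.
      by apply: eq_bigr => i _; rewrite mxE.
    by rewrite mulr0 addr0 mulNr.
  move=> i _; rewrite -mulr_sumr sum_third// derive_lap// dotC dot_delta.
  by move: (D i p) => ?; ring.
have -> : \sum_j 2 * c * (D j p * D j p + F p * hess f p (e_ j) (e_ j)) =
    2 * c * (gradsq f p - lam * (F p * F p)).
  rewrite -mulr_sumr big_split -gradsqE -mulr_sumr /=; congr (_ * (_ + _)).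
  rewrite -/(lap f p) ef// retract_id//; ring.
move: (frob _ _) (gradsq f p) => h g; rewrite natrM -(natr1 n) /=; ring.
Qed.

Lemma trace_hess p : sphere p -> frob 1 (hess_mx p) = - lam * F p.
Proof.
move=> sp; rewrite frob1l; under eq_bigr do rewrite mxE.
by rewrite -/(lap f p) ef//= retract_id.
Qed.

(* The horizontal Hessian of f plus c f times the identity of H(M): the first
   two pairs of terms cancel the known radial and Reeb components of the
   Euclidean Hessian of F. *)
Definition defect c p := hess_mx p + (outer p (grad f p) + outer (grad f p) p
  - (outer (mulI p) (mulI (grad f p)) + outer (mulI (grad f p)) (mulI p))
  + (c * F p) *: (1 - outer p p - outer (mulI p) (mulI p))).

(** The radial and the Reeb entries of the Hessian each account for 2 |grad F|^2. The relation lam =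
    2nc makes [defect] trace-free, so that removing its trace part costs exactly c lam F^2. *)
Lemma frob_defect c p : sphere p -> lam = 2 * n%:R * c ->
  frob (defect c p) (defect c p) =
  frob (hess_mx p) (hess_mx p) - 4 * gradsq f p - c * lam * (F p * F p).
Proof.
move=> sp lamE; have p0 := sphere_neq0 sp; have pp : dot p p = 1 by [].
set v := grad f p; set y := mulI p; set g := mulI v.
have pv : dot p v = 0 by rewrite dotC dot_grad_radial.
have py : dot p y = 0 by exact: dot_mulIr.
have yp : dot y p = 0 by rewrite dotC.
have yy : dot y y = 1 by rewrite dot_mulI.
have vp : dot v p = 0 by rewrite dotC.
have vv : dot v v = gradsq f p by [].
have gg : dot g g = gradsq f p by rewrite dot_mulI.
have vg : dot v g = 0 by exact: dot_mulIr.
have gv : dot g v = 0 by rewrite dotC.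
have vy : dot v y = 0 by rewrite dot_grad// derive_reeb.
have yv : dot y v = 0 by rewrite dotC.
have yg : dot y g = 0 by rewrite dot_mulI.
have gy : dot g y = 0 by rewrite dotC.
have pg : dot p g = 0.
  by rewrite -[LHS]opprK -dot_mulIl -/y yv oppr0.
have gp : dot g p = 0 by rewrite dotC.
have Hvp : hess f p v p = - gradsq f p.
  by rewrite hess_radial// -dot_grad.
have Hpv : hess f p p v = - gradsq f p by rewrite hessC.
have Hgy : hess f p g y = gradsq f p by rewrite hess_reeb.
have Hyg : hess f p y g = gradsq f p by rewrite hessC.
have Hpp : hess f p p p = 0 by rewrite hess_radial// derive_radial oppr0.
have Hyy : hess f p y y = 0 by rewrite hess_reeb// -/v -/g.
have tr := trace_hess sp.
have HC w z : frob (outer w z) (hess_mx p) = hess f p w z.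
  by rewrite frobC frob_hess_outer.
have HC1 : frob (hess_mx p) 1 = - lam * F p by rewrite frobC.
rewrite /defect -/v -/y -/g.
rewrite !(frobDl, frobNl, frobZl) !(frobDr, frobNr, frobZr).
rewrite !(frob_outer, frob_hess_outer, HC, frob1_outer, frob_outer1)//.
rewrite frob11 tr HC1 Hvp Hpv Hgy Hyg Hpp Hyy.
rewrite !(pv, py, yp, yy, vp, vv, gg, vg, gv, vy, yv, yg, gy, pg, gp, pp).
move: (frob _ _) (gradsq f p) => h k; rewrite lamE natrM -(natr1 n) /=; ring.
Qed.

(** The constant c fixed by the eigenvalue is kept apart from the weight c' of F^2 in [pfun], so
    that c' can be lowered on its own. *)
Lemma lap_pfun_defect c c' p : sphere p -> lam = 2 * n%:R * c ->
  \sum_j 'D_(e_ j) ('D_(e_ j) (pfun f c')) p =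
  2 * (frob (defect c p) (defect c p) + (2 * n%:R + 2 - lam + c') * gradsq f p
       + (c - c') * lam * (F p * F p)).
Proof.
move=> sp lamE; rewrite lap_pfun// frob_defect//.
move: (frob _ _) (gradsq f p) => h k; ring.
Qed.

End Eigenfunction.

(** * The equality case *)

Section Rigidity.
Context {R : realType} {n : nat}.
Implicit Types (u v w x y p : ambient R n) (a b c : R).
Local Notation U0 := (@punctured R n).
Local Notation oU0 := (@open_punctured R n).
Local Notation ext f := (f \o @retract R n).
Local Notation e_ i := (delta_mx 0 i : ambient R n).

Lemma sphere_EVT (u : ambient R n -> R) : smooth_on U0 u ->
  exists2 q, sphere q & forall p, sphere p -> u p <= u q.
Proof.
move=> su.
have shE z : (1 <= dot (z - 0) (z - 0) <= 1) = (dot z z == 1 :> R).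
  by rewrite subr0 eq_le andbC.
have [||q qP qmax] := @EVT_shell R n u U0 0 1 1 (e_ ord0) su.
- move=> z /=; rewrite shE => /eqP sz; exact: sphere_neq0.
- by rewrite shE dot_delta2 eqxx.
exists q; first by move: qP; rewrite shE => /eqP.
by move=> p sp; apply: qmax; rewrite shE; apply/eqP.
Qed.

Variables (f : ambient R n -> R) (kf : kerT f).
Let sf : smooth_fun f := kf.1.
Local Notation F := (ext f).

Lemma pfun_max c : exists2 q, sphere q & forall x, x != 0 -> pfun f c x <= pfun f c q.
Proof.
have [q sq qmax] := sphere_EVT (smooth_on_pfun sf c).
exists q => // x x0; rewrite -(pfunZ sf c (ninv_gt0 x0) x0) -retractE.
exact/qmax/sphere_retract.
Qed.

Lemma derive2_pfunZ c (a : R) x v : 0 < a -> x != 0 ->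
  'D_v ('D_v (pfun f c)) (a *: x) = a^-1 * (a^-1 * 'D_v ('D_v (pfun f c)) x).
Proof.
move=> a0 x0; have a0' := lt0r_neq0 a0; have sP := smooth_on_pfun sf c.
have D1 y : y != 0 -> 'D_v (pfun f c) (a *: y) = a^-1 * 'D_v (pfun f c) y.
  move=> y0; have := derive_homog_near (s := 1) v a0' y0 sP.
  by rewrite mul1r; apply => z z0; rewrite mul1r; exact: pfunZ.
exact: (derive_homog_near v a0' x0 (smooth_on_derive v sP) D1).
Qed.

Lemma near_retract p (A : set (ambient R n)) : sphere p -> nbhs p A ->
  \forall x \near p, x != 0 /\ A (retract x).
Proof.
move=> sp Ap; have p0 := sphere_neq0 sp.
have cr : {for p, continuous (@retract R n)}.
  by have := @smooth_on_retract R n 0%N; apply.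
have n1 : nbhs p (@retract R n @^-1` A) by apply: cr; rewrite retract_id.
exact: filterI (open_nbhs_nbhs (conj oU0 p0)) n1.
Qed.

Lemma gradsq_ge0 x : 0 <= gradsq f x. Proof. exact: dot_ge0. Qed.

Lemma pfun_max0 c q : 0 < c -> (forall x, x != 0 -> pfun f c x <= pfun f c q) ->
  pfun f c q = 0 -> ~ nonzero_on_sphere f.
Proof.
move=> c0 qmax q0 [p sp /negP]; apply.
have := qmax p (sphere_neq0 sp); rewrite q0 /pfun sp mul1r /= retract_id// => H.
have H2 : c * (f p * f p) <= 0.
  by rewrite (le_trans _ H)// lerDr gradsq_ge0.
have ff : 0 <= f p * f p by rewrite -expr2 sqr_ge0.
have : c * (f p * f p) == 0 by rewrite eq_le H2 mulr_ge0 // ltW.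
by rewrite mulf_eq0 (gt_eqF c0) /= mulf_eq0 orbb.
Qed.

Variables (lam : R) (ef : forall p, sphere p -> lap f p = - lam * f p).
Hypothesis nz : nonzero_on_sphere f.

(** If the coefficient were positive for c, it would be so for some c' < c. At a maximum of [pfun]
    for c' all terms of [lap_pfun_defect] are then nonnegative with sum <= 0, so F and its gradient
    vanish there; the maximum is 0 and f = 0. *)
Lemma eigenvalue_lower_bound c : 0 < c -> lam = 2 * n%:R * c -> 0 < lam ->
  2 * n%:R + 2 - lam + c <= 0.
Proof.
move=> c0 lamE lam0; rewrite leNgt; apply/negP => gap.
(* The midpoint of m and c keeps c', c - c' and the gradient coefficient all positive. *)
pose m := Num.max 0 (lam - 2 * n%:R - 2).
have m0 : 0 <= m by rewrite le_max lexx.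
have mc : m < c by rewrite gt_max c0 /=; lra.
have ml : lam - 2 * n%:R - 2 <= m by rewrite le_max lexx orbT.
pose c' := (m + c) / 2.
have c'0 : 0 < c' by rewrite /c'; lra.
have c'c : c' < c by rewrite /c'; lra.
have gap' : 0 < 2 * n%:R + 2 - lam + c' by rewrite /c'; lra.
have [q sq qmax] := pfun_max c'; have q0 := sphere_neq0 sq.
have : \sum_j 'D_(e_ j) ('D_(e_ j) (pfun f c')) q <= 0.
  rewrite -oppr_ge0 -sumrN; apply: sumr_ge0 => j _; rewrite oppr_ge0.
  exact: (derive2_at_max oU0 (e_ j) (smooth_on_pfun sf c') q0 qmax).
rewrite (lap_pfun_defect kf ef c' sq lamE).
have fr := frob_ge0 (defect f c q); have g0 := gradsq_ge0 q.
have F0 : 0 <= F q * F q by rewrite -expr2 sqr_ge0.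
move: fr g0 F0 (pfun_max0 c'0 qmax); rewrite /pfun sq mul1r.
move: (frob _ _) (gradsq f q) (F q * F q) => h g s h0 g0 s0 Hz H.
have t1 : 0 <= (2 * n%:R + 2 - lam + c') * g by rewrite mulr_ge0// ltW.
have t2 : 0 <= (c - c') * lam * s by rewrite !mulr_ge0 ?subr_ge0 ?(ltW c'c)// ltW.
have /eqP : (2 * n%:R + 2 - lam + c') * g = 0 by lra.
rewrite mulf_eq0 (gt_eqF gap') /= => /eqP gz.
have /eqP : (c - c') * lam * s = 0 by lra.
rewrite !mulf_eq0 subr_eq0 (gt_eqF c'c) (gt_eqF lam0) /= => /eqP sz.
by apply: Hz nz; rewrite gz sz mulr0 addr0.
Qed.

Section EqualityCase.
Variables (c : R) (c0 : 0 < c) (lamE : lam = 2 * n%:R * c) (lam0 : 0 < lam).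
Hypothesis eqc : 2 * n%:R + 2 - lam + c = 0.

Lemma lap_pfun_ge0 x : x != 0 -> 0 <= \sum_j 'D_(e_ j) ('D_(e_ j) (pfun f c)) x.
Proof.
move=> x0; have N := ninv_gt0 x0; have N0 := lt0r_neq0 N.
have E : \sum_j 'D_(e_ j) ('D_(e_ j) (pfun f c)) x =
    ninv x * (ninv x * \sum_j 'D_(e_ j) ('D_(e_ j) (pfun f c)) (retract x)).
  rewrite !mulr_sumr; apply: eq_bigr => j _.
  by rewrite retractE derive2_pfunZ// !mulVKf.
rewrite E (lap_pfun_defect kf ef c (sphere_retract x0) lamE) eqc subrr.
by rewrite !mul0r !addr0; do !apply: mulr_ge0; rewrite ?(ltW N) ?frob_ge0.
Qed.

Lemma defect_eq0 : exists q, [/\ sphere q, (forall x, x != 0 -> pfun f c x <= pfun f c q) &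
  exists2 W : set (ambient R n), open W &
    W q /\ forall p, W p -> sphere p -> defect f c p = 0].
Proof.
have [q sq qmax] := pfun_max c; have q0 := sphere_neq0 sq.
exists q; split=> //.
(* Within squared distance 4r = 1/4 of the unit vector q there is no origin. *)
pose r : R := 16^-1; have r0 : 0 < r by rewrite invr_gt0.
have UB z : dot (z - q) (z - q) <= 4 * r -> U0 z.
  move=> zq; apply/eqP => z0; move: zq; rewrite z0 sub0r dotNl dotNr opprK sq /r; lra.
have H := strong_maximum oU0 (smooth_on_pfun sf c) r0 UB qmax lap_pfun_ge0 erefl.
pose W := [set z | dot (z - q) (z - q) < r].
have oW : open W.
  rewrite (_ : W = (fun z => dot (z - q) (z - q)) @^-1` [set t | t < r]); last by [].
  by apply: open_comp; [move=> t _; exact: continuous_sqdist|exact: open_lt].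
exists W => //; split; first by rewrite /W/= subrr dot0l.
move=> p Wp sp; apply: frob_eq0.
have : \sum_j 'D_(e_ j) ('D_(e_ j) (pfun f c)) p = 0.
  apply: big1 => j _.
  have cst1 y : W y -> 'D_(e_ j) (pfun f c) y = 0.
    move=> Wy; rewrite (@near_eq_derive _ _ _ _ (fun _ => pfun f c q)) ?derive_cst//.
    have := open_nbhs_nbhs (conj oW Wy).
    by rewrite -nbhs_nearE; apply: filterS => z; exact: H.
  rewrite (@near_eq_derive _ _ _ _ (fun _ => 0)) ?derive_cst//.
  have := open_nbhs_nbhs (conj oW Wp).
  by rewrite -nbhs_nearE; apply: filterS => z; exact: cst1.
rewrite (lap_pfun_defect kf ef c sp lamE) eqc subrr !mul0r !addr0.
by move=> /eqP; rewrite mulf_eq0 pnatr_eq0 /= => /eqP.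
Qed.

(** The equation [defect] = 0 at x/|x| is carried to x by homogeneity, as an explicit formula in x
    that [third_derivative] can differentiate. *)
Lemma hess_of_defect_eq0 x v w : x != 0 -> defect f c (retract x) = 0 ->
  hess f x v w = - (ninv x * ninv x) *
   (dot x v * 'D_w F x + 'D_v F x * dot x w
    - (dot x (mulI v) * 'D_(mulI w) F x + 'D_(mulI v) F x * dot x (mulI w))
    + c * F x * (dot v w - ninv x * ninv x * (dot x v * dot x w)
                 - ninv x * ninv x * (dot x (mulI v) * dot x (mulI w)))).
Proof.
move=> x0 B0; have N := ninv_gt0 x0; have N0 := lt0r_neq0 N.
have ss := sphere_retract x0; have s0 := sphere_neq0 ss.
have E : hess f (retract x) v w = (ninv x)^-1 * ((ninv x)^-1 * hess f x v w).
  by rewrite retractE hessZ.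
have G u : dot (grad f (retract x)) u = (ninv x)^-1 * 'D_u F x.
  by rewrite dot_grad// retractE derive_extZ.
have Fr : F (retract x) = F x by rewrite /= retract_id.
move/(congr1 (fun A => frob A (outer v w))): B0.
rewrite /defect.
rewrite !(frobDl, frobNl, frobZl) !frob_outer frob_hess_outer// frob1_outer.
rewrite !dot_mulIl !G Fr E.
have -> : frob (0 : 'M[R]_(n.+1 + n.+1)) (outer v w) = 0.
  by rewrite -(scale0r (outer v w)) frobZl mul0r.
rewrite !retractE !dotZl.
move: (hess f x v w) ('D_v F x) ('D_w F x) ('D_(mulI v) F x) ('D_(mulI w) F x) (F x) N0.
move: (ninv x) => m h a1 a2 a3 a4 s m0 B0.
have -> : h = m * (m * (m^-1 * (m^-1 * h))) by rewrite !mulVKf.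
move/eqP: B0; rewrite addr_eq0 => /eqP ->; by field.
Qed.

(** Since u is tangent, [ninv] is stationary at p. The factors <x, v>, <x, Jv>, <x, w>, <x, Jw>
    vanish at p, so a term survives only if each such factor in it is differentiated; products of
    two of them contribute nothing. *)
Lemma third_derivative p u v w : sphere p -> (\forall x \near p, defect f c (retract x) = 0) ->
  dot p u = 0 -> dot p v = 0 -> dot p w = 0 ->
  dot p (mulI v) = 0 -> dot p (mulI w) = 0 ->
  'D_u (fun y => hess f y v w) p =
  - (dot u v * 'D_w F p + 'D_v F p * dot u w
     - (dot u (mulI v) * 'D_(mulI w) F p + 'D_(mulI v) F p * dot u (mulI w))
     + c * 'D_u F p * dot v w).
Proof.
move=> sp near0 pu pv pw pIv pIw; have p0 := sphere_neq0 sp.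
have HN : is_derive p u (@ninv R n) 0.
  have H := smooth_on_is_derive u (@smooth_on_ninv R n) p0.
  by apply: (is_derive_eq H); rewrite derive_ninv// pu mul0r oppr0.
have HM : is_derive p u (- ((@ninv R n) * (@ninv R n))) 0.
  have H := is_deriveN (is_deriveM HN HN).
  by apply: (is_derive_eq H); rewrite !scaler0 addr0 oppr0.
have HX z : is_derive p u (fun y => dot y z) (dot u z).
  have H := is_derive_dot (is_derive_id p u) (is_derive_cst z p u).
  by apply: (is_derive_eq H); rewrite dot0r addr0.
have HD z := is_derive_D sf u z p0.
have HF := is_derive_ext sf u p0.
pose NN := (@ninv R n) * (@ninv R n).
have HNN : is_derive p u NN 0.
  have H := is_deriveM HN HN.
  by apply: (is_derive_eq H); rewrite !scaler0 addr0.
have H1 := is_deriveD (is_deriveM (HX v) (HD w)) (is_deriveM (HD v) (HX w)).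
have H2 := is_deriveD (is_deriveM (HX (mulI v)) (HD (mulI w)))
                      (is_deriveM (HD (mulI v)) (HX (mulI w))).
have H3 := is_deriveB (is_deriveB (is_derive_cst (dot v w) p u)
  (is_deriveM HNN (is_deriveM (HX v) (HX w))))
  (is_deriveM HNN (is_deriveM (HX (mulI v)) (HX (mulI w)))).
have H4 := is_deriveM (is_deriveM (is_derive_cst c p u) HF) H3.
have H := is_deriveM HM (is_deriveD (is_deriveB H1 H2) H4).
transitivity ('D_u (- ((@ninv R n) * (@ninv R n)) *
   ((fun y => dot y v) * 'D_w F + 'D_v F * (fun y => dot y w)
    - ((fun y => dot y (mulI v)) * 'D_(mulI w) F + 'D_(mulI v) F * (fun y => dot y (mulI w)))
    + cst c * F * (cst (dot v w) - NN * ((fun y => dot y v) * (fun y => dot y w))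
           - NN * ((fun y => dot y (mulI v)) * (fun y => dot y (mulI w)))))) p).
  apply: near_eq_derive; near=> y; rewrite hess_of_defect_eq0.
  - by rewrite !fctE.
  - by near: y; exact: (open_nbhs_nbhs (conj oU0 p0)).
  - by near: y.
have [_ ->] := H; rewrite !fctE /NN !fctE /= ninv1// pv pw pIv pIw /GRing.scale/=.
move: (hess f p u w) (hess f p u v) (hess f p u (mulI v)) (hess f p u (mulI w)).
move: ('D_v F p) ('D_w F p) ('D_(mulI v) F p) ('D_(mulI w) F p) ('D_u F p) (f (retract p)).
move=> *; ring.
Unshelve. all: by end_near. Qed.

(* With v = grad f, which is nonzero somewhere near the maximum, D_v Hess(Jv, Jv) =
   D_{Jv} Hess(v, Jv); both sides are given by [third_derivative]. *)
Lemma equality_constant : c = 4.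
Proof.
have [q [sq qmax [W oW [Wq WB]]]] := defect_eq0; have q0 := sphere_neq0 sq.
have [[p [Wp sp g0]]|allz] := pselect (exists p, [/\ W p, sphere p & grad f p != 0]); last first.
  (* If grad f vanished on the sphere near q, then lap f q = 0, hence f q = 0 by the eigenvalue
     equation, and the maximum of [pfun] would be 0. *)
  exfalso.
  have gz p : W p -> sphere p -> grad f p = 0.
    by move=> Wp sp; apply/eqP; apply: contrapT => /negP g0; apply: allz; exists p.
  have lapq : lap f q = 0.
    apply: big1 => j _; rewrite /hess.
    rewrite (@near_eq_derive _ _ _ _ (fun _ => 0)) ?derive_cst//.
    have := near_retract sq (open_nbhs_nbhs (conj oW Wq)).
    apply: filterS => y [y0 Wy]; have := gz _ Wy (sphere_retract y0).
    move/rowP => /(_ j); rewrite !mxE retractE derive_extZ//; last exact: ninv_gt0.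
    move=> /eqP; rewrite mulf_eq0 invr_eq0 => /orP[|/eqP//].
    by rewrite gt_eqF// ninv_gt0.
  apply: (pfun_max0 c0 qmax) nz.
  have fq : f q = 0.
    move: lapq; rewrite ef// => /eqP; rewrite mulf_eq0 oppr_eq0 gt_eqF//= => /eqP //.
  by rewrite /pfun /gradsq gz// dot0l mulr0 /= retract_id// fq !mulr0 addr0.
have p0 := sphere_neq0 sp.
have near0 : \forall x \near p, defect f c (retract x) = 0.
  have := near_retract sp (open_nbhs_nbhs (conj oW Wp)).
  by apply: filterS => y [y0 Wy]; apply: WB => //; exact: sphere_retract.
set v := grad f p in g0; pose g := mulI v.
have pv : dot p v = 0 by rewrite dotC dot_grad_radial.
have vIp : dot v (mulI p) = 0 by rewrite dot_grad// derive_reeb.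
have pg : dot p g = 0 by rewrite -[LHS]opprK -dot_mulIl dotC vIp oppr0.
have Ig : mulI g = - v by exact: mulIK.
have pIg : dot p (mulI g) = 0 by rewrite Ig dotNr pv oppr0.
have T1 := third_derivative sp near0 pv pg pg pIg pIg.
have T2 := third_derivative sp near0 pg pv pg pg pIg.
have sym : 'D_v (fun y => hess f y g g) p = 'D_g (fun y => hess f y v g) p.
  exact: (derive_comm v g oU0 (smooth_on_derive g sf) p0).
rewrite sym T2 in T1.
have DE u : 'D_u F p = dot v u by rewrite dot_grad.
have vg : dot v g = 0 by exact: dot_mulIr.
have gg : dot g g = dot v v by rewrite dot_mulI.
have gv : dot g v = 0 by rewrite dotC.
move: T1; rewrite !DE -/g Ig !dotNr vg gg gv.
have vv0 : dot v v != 0 by rewrite dot_eq0.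
move: (dot v v) vv0 => s s0 E.
(* With s = |v|^2 the two third derivatives are (2 - c) s^2 and -2 s^2. *)
have : (c - 4) * (s * s) = 0.
  move/eqP: E; rewrite -subr_eq0 => /eqP <-.
  by ring.
move=> /eqP; rewrite !mulf_eq0 (negPf s0) !orbF subr_eq0 => /eqP.
exact.
Qed.

End EqualityCase.
End Rigidity.

(** With c = k/(2n - 1) the eigenvalue is 2nc and the coefficient 2n + 2 - lam + c equals 2(n + 1) -
    k. In the equality case c = 4 gives 4(2n - 1) = 2n + 2, so n = 1. *)
Lemma lichnerowicz_obata {R : realType} (n : nat) (k : R) : (1 <= n)%N ->
  condition_i n k -> condition_iii n k -> k = 4 /\ n = 1%N.
Proof.
move=> n1 /(condition_iP k n1) /andP[k0 kn] [f [[sf Ef] kf] nz].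
have n1' : (1 : R) <= n%:R by rewrite ler1n.
have d0 : 0 < 2 * n%:R - 1 :> R by lra.
pose c := k / (2 * n%:R - 1).
have c0 : 0 < c by rewrite divr_gt0.
set lam := 2 * n%:R * k / (2 * n%:R - 1) in Ef.
have lamE : lam = 2 * n%:R * c by rewrite /lam /c mulrA.
have lam0 : 0 < lam by rewrite lamE mulr_gt0//; lra.
have ef p : sphere p -> lap f p = - lam * f p.
  by move=> sp; rewrite -sublaplacianE// Ef.
have kc : k = c * (2 * n%:R - 1) by rewrite /c divfK// gt_eqF.
have gapE : 2 * n%:R + 2 - lam + c = 2 * n%:R + 2 - k by rewrite lamE kc; ring.
have := eigenvalue_lower_bound kf ef nz c0 lamE lam0; rewrite gapE subr_le0 => kn'.
have kE : k = 2 * n%:R + 2.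
  by apply/eqP; rewrite eq_le kn' andbT (le_trans kn)// natrM -(natr1 n) mulrDr mulr1.
have eqc : 2 * n%:R + 2 - lam + c = 0 by rewrite gapE kE subrr.
have c4 := equality_constant kf ef nz c0 lamE lam0 eqc.
rewrite c4 kE in kc.
have nE : n%:R = 1 :> R by lra.
by split; [rewrite kE nE; ring|apply/eqP; rewrite -(eqr_nat R) nE].
Qed.

(** * Quadratic forms on the sphere *)

Section QuadraticForm.
Context {R : realType} {n : nat}.
Implicit Types (u v w x y p : ambient R n).
Local Notation U0 := (@punctured R n).
Local Notation oU0 := (@open_punctured R n).
Local Notation ext f := (f \o @retract R n).
Local Notation e_ i := (delta_mx 0 i : ambient R n).

Variables (Q : ambient R n -> ambient R n).
Hypothesis Qsym : forall u v, dot (Q u) v = dot u (Q v).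
Hypothesis QI : forall u, Q (mulI u) = mulI (Q u).

Definition qform x := dot x (Q x).

(** Symmetry with respect to a nondegenerate form forces linearity. *)
Lemma sym_scale (a : R) u : Q (a *: u) = a *: Q u.
Proof. by apply: dotP => w; rewrite Qsym !dotZl Qsym. Qed.

Lemma sym_add u v : Q (u + v) = Q u + Q v.
Proof. by apply: dotP => w; rewrite Qsym !dotDl !Qsym. Qed.

Lemma sym_coord x i : Q x 0 i = dot x (Q (e_ i)).
Proof. by rewrite -dot_delta -Qsym dotC. Qed.

Lemma is_derive_sym x v : is_derive x v Q (Q v).
Proof.
apply/is_derive_rowP => i; under eq_fun do rewrite sym_coord.
have H := is_derive_dot (is_derive_id x v) (is_derive_cst (Q (e_ i)) x v).
by apply: (is_derive_eq H); rewrite dot0r addr0 sym_coord.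
Qed.

Lemma smooth_fun_qform : smooth_fun qform.
Proof.
apply: smooth_fun_dot; first exact: smooth_fun_id.
apply: smooth_fun_rowP => i; under eq_fun do rewrite sym_coord.
by apply: smooth_fun_dot; [exact: smooth_fun_id|exact: smooth_fun_cst].
Qed.

Lemma is_derive_qform x v : is_derive x v qform (2 * dot v (Q x)).
Proof.
have H := is_derive_dot (is_derive_id x v) (is_derive_sym x v).
by apply: (is_derive_eq H); rewrite -[dot x _]Qsym [dot (Q x) v]dotC; ring.
Qed.

Lemma ext_qformE x : ext qform x = ninv x * ninv x * qform x.
Proof.
by rewrite /= /qform retractE sym_scale dotZl dotZr mulrA.
Qed.

Lemma is_derive_ninv x v : x != 0 ->
  is_derive x v (@ninv R n) (- (dot x v * (ninv x * ninv x * ninv x))).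
Proof.
move=> x0; have H := smooth_on_is_derive v (@smooth_on_ninv R n) x0.
by apply: (is_derive_eq H); rewrite derive_ninv//; ring.
Qed.

Lemma derive_ext_qform x v : x != 0 -> 'D_v (ext qform) x =
  2 * (ninv x * ninv x) * dot v (Q x)
  - 2 * dot x v * (ninv x * ninv x * (ninv x * ninv x)) * qform x.
Proof.
move=> x0; have HN := is_derive_ninv v x0.
have [_] := is_deriveM (is_deriveM HN HN) (is_derive_qform x v).
have -> : (@ninv R n) * (@ninv R n) * qform = ext qform.
  by apply/funext => y; rewrite ext_qformE.
move=> ->; rewrite !fctE /GRing.scale/=; move: (ninv x) (qform x) => *; ring.
Qed.

Lemma grad_qform p u : sphere p -> dot (grad qform p) u = 2 * dot u (Q p) - 2 * dot p u * qform p.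
Proof.
move=> sp; have p0 := sphere_neq0 sp; rewrite dot_grad//; last exact: smooth_fun_qform.
by rewrite derive_ext_qform// ninv1// !mulr1.
Qed.

(** T f is twice <ip, Qp>, which equals its own negative because Q is symmetric and commutes with
    i. *)
Lemma kerT_qform : kerT qform.
Proof.
split; first exact: smooth_fun_qform.
move=> p sp; have p0 := sphere_neq0 sp.
rewrite reebE /dS derive_ext_qform// dot_mulIr mulr0 !mul0r subr0.
have -> : dot (mulI p) (Q p) = 0; last by rewrite mulr0.
have E : dot (mulI p) (Q p) = - dot (mulI p) (Q p).
  by rewrite {1}dot_mulIl -QI -Qsym dotC.
by move/eqP: E; rewrite -addr_eq0 -mulr2n mulrn_eq0 => /eqP.
Qed.

Lemma hess_qform p v : sphere p -> hess qform p v v =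
  2 * dot v (Q v) - 8 * dot p v * dot v (Q p) - 2 * dot v v * qform p
  + 8 * (dot p v * dot p v) * qform p.
Proof.
move=> sp; have p0 := sphere_neq0 sp; rewrite /hess.
have HN := is_derive_ninv v p0.
have HNN := is_deriveM HN HN.
have HX : is_derive p v (fun y => dot y v) (dot v v).
  have H := is_derive_dot (is_derive_id p v) (is_derive_cst v p v).
  by apply: (is_derive_eq H); rewrite dot0r addr0.
have HQ : is_derive p v (fun y => dot v (Q y)) (dot v (Q v)).
  have H := is_derive_dot (is_derive_cst v p v) (is_derive_sym p v).
  by apply: (is_derive_eq H); rewrite dot0l add0r.
have H1 := is_deriveM (is_deriveM (is_derive_cst (2 : R) p v) HNN) HQ.
have H2 := is_deriveM (is_deriveM (is_deriveM (is_derive_cst (2 : R) p v) HX)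
             (is_deriveM HNN HNN)) (is_derive_qform p v).
have [_] := is_deriveB H1 H2; rewrite !fctE /= ninv1// /GRing.scale/= => D.
rewrite (derive_near_eq v p0 (fun y hy => derive_ext_qform v hy)) D.
move: (qform p) => *; ring.
Qed.

(** The trace condition is harmonicity of the form, and the constant is d(d + 2n) for degree d =
    2. *)
Lemma lap_qform p : sphere p -> \sum_i dot (e_ i) (Q (e_ i)) = 0 ->
  lap qform p = - (2 * (2 * n.+1)%:R) * qform p.
Proof.
move=> sp tr0; rewrite /lap (eq_bigr _ (fun i _ => hess_qform (e_ i) sp)).
rewrite big_split sumrB sumrB /= -mulr_sumr tr0 mulr0 sub0r.
have -> : \sum_i 8 * dot p (e_ i) * dot (e_ i) (Q p) = 8 * qform p.
  under eq_bigr do rewrite [dot p _]dotC !dot_delta -mulrA.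
  by rewrite -mulr_sumr.
have -> : \sum_i 8 * (dot p (e_ i) * dot p (e_ i)) * qform p = 8 * qform p.
  rewrite -mulr_suml -mulr_sumr; congr (_ * _).
  under eq_bigr do rewrite [dot p _]dotC !dot_delta.
  by rewrite sum_dot sp mulr1.
have -> : \sum_i 2 * dot (e_ i) (e_ i) * qform p = 2 * (2 * n.+1)%:R * qform p.
  under eq_bigr do rewrite dot_delta2 eqxx mulr1n mulr1.
  by rewrite sumr_const card_ord addnn -muln2 -mulr_natr [(2 * n.+1)%N]mulnC; ring.
by ring.
Qed.

(** The Reeb direction ip lies in the kernel of the Hessian: by [hess_reeb], Hess(ip, w) = <J grad
    f, w>, and the gradient vanishes at an eigenvector of Q. *)
Lemma degenerate_qform p (a : R) : sphere p -> Q p = a *: p ->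
  degenerate_critical_point qform p.
Proof.
move=> sp Qp; have p0 := sphere_neq0 sp; have sq := smooth_fun_qform.
have qp : qform p = a by rewrite /qform Qp dotZr sp mulr1.
have g0 : grad qform p = 0.
  apply: dotP => w; rewrite grad_qform// Qp dotZr qp dot0l [dot w p]dotC; ring.
have d0 u : dS qform p u = 0 by rewrite /dS -dot_grad// g0 dot0l.
have tIp : tangent p (mulI p) by rewrite /tangent dot_mulIr.
split; first by split=> // v _; exact: d0.
exists (mulI p); split=> //.
  apply: contra_neq p0 => /(congr1 mulI); rewrite mulIK linear0 => /eqP.
  by rewrite oppr_eq0 => /eqP.
move=> w tw; rewrite /hessian dS_dS//; last by have [] := @extend_vfield R n w.
rewrite d0 add0r hessC// (hess_reeb _ kerT_qform p0) g0.
by rewrite linear0 dot0l.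
Qed.

End QuadraticForm.

(** * Lengthy geodesics *)

Section Geodesics.
Context {R : realType} {n : nat}.
Implicit Types (u v w x y p : ambient R n).
Local Notation e_ i := (delta_mx 0 i : ambient R n).
Local Notation TW := (@tanaka_webster R n).

Lemma tw_extend p u i : sphere p -> horizontal p u ->
  TW (extend u) (extend (e_ i)) p =
  - (p 0 i) *: u + (mulI u 0 i *: mulI p - mulI p 0 i *: cxJ p u).
Proof.
move=> sp [tu hu]; have pu : dot p u = 0 by exact: tu.
rewrite (tanaka_websterE (extend_vfield u) (extend_vfield _) sp) /sphere_tw /round_connection.
rewrite (extend_id tu) hu scale0r addr0.
have tIp : tangent p (mulI p) by rewrite /tangent dot_mulIr.
have pIu : tangent p (mulI u) by rewrite /tangent -[dot p _]opprK -dot_mulIl hu oppr0.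
have dE w : tangent p w -> dot w (extend (e_ i) p) = w 0 i.
  by move=> tw; rewrite dotC /extend dot_tproj// dot_delta.
rewrite !dE//.
have D : dS (extend (e_ i)) p u = - (u 0 i *: p + p 0 i *: u).
  have sc : smooth_fun (fun _ : ambient R n => e_ i) by exact: smooth_fun_cst.
  have sid := @smooth_fun_id R n.
  have sd : smooth_fun (fun x : ambient R n => dot x (e_ i)) by exact: smooth_fun_dot.
  rewrite /extend /tproj (dSB sp _ sc (smooth_funZ sd sid)) dS_cst sub0r.
  rewrite (dSZ sp _ sd sid) (dS_dot sp _ sid sc) (dS_id sp tu) dS_cst dot0r addr0.
  by rewrite [dot u _]dotC [dot p _]dotC !dot_delta.
rewrite D; move: (cxJ p u) (u 0 i) (p 0 i) (mulI u 0 i) (mulI p 0 i) => j a b c d.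
by apply/dotP => w; rewrite ?(dotDl, dotNl, dotZl); ring.
Qed.

(** For a horizontal velocity u the connection terms carry the factors <p, u>, <u, Ju> and theta(u),
    all zero; only the tangential acceleration remains. *)
Lemma cov_along_velocity (gamma : R -> ambient R n) t :
  sphere (gamma t) -> horizontal (gamma t) (derive1 gamma t) ->
  cov_along TW gamma (derive1 gamma) t =
  tproj (gamma t) (\row_i derive1 (fun s => derive1 gamma s 0 i) t).
Proof.
move=> sp hu; have [tu dIu] := hu; rewrite /cov_along big_split /=.
set p := gamma t in sp hu tu dIu *; set u := derive1 gamma t in hu tu dIu *.
have -> : \sum_i u 0 i *: TW (extend u) (extend (e_ i)) p = 0.
  under eq_bigr do rewrite tw_extend// !scalerDr scalerN !scalerA.
  rewrite !big_split sumrN /= -!scaler_suml.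
  have -> : \sum_i u 0 i * - p 0 i = 0.
    transitivity (- dot p u); last by rewrite [dot p u]tu oppr0.
    by rewrite /dot -sumrN; apply: eq_bigr => i _; ring.
  rewrite sum_dot dot_mulIr sum_dot dotC dIu.
  by rewrite !scale0r oppr0 !addr0.
rewrite addr0; set a := \row_i _.
have aE : a = \sum_i a 0 i *: e_ i by rewrite -row_sum_delta.
rewrite [in RHS]aE /tproj dot_sumr scaler_suml -sumrB; apply: eq_bigr => i _.
by rewrite [a 0 i]mxE /extend /tproj scalerBr dotZr scalerA.
Qed.

Lemma is_derive_row0_cst (g : R -> ambient R n) :
  (forall t : R, is_derive t 1 g 0) -> forall t, g t = g 0.
Proof.
move=> dg t; apply/rowP => i.
have di (s : R) : is_derive s 1 (fun r => g r 0 i) 0.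
  have := (is_derive_rowP _ _ _ _).1 (dg s) i; by rewrite mxE.
exact: (@is_derive_0_is_cst R (fun r => g r 0 i) t 0 di).
Qed.

(** Uniqueness without ODE theory: cos(t) g - sin(t) g' and sin(t) g + cos(t) g' have zero
    derivative, and g is recovered from them by a rotation. *)
Lemma great_circle_ode (g g1 g2 : R -> ambient R n) :
  (forall t : R, is_derive t 1 g (g1 t)) -> (forall t : R, is_derive t 1 g1 (g2 t)) ->
  (forall t, g2 t = - g t) -> forall t, g t = cos t *: g 0 + sin t *: g1 0.
Proof.
move=> dg dg1 ode t.
have HA (s : R) : is_derive s 1 (fun r => cos r *: g r - sin r *: g1 r) 0.
  have H := is_deriveB (is_derive_scale (is_derive_cos s) (dg s))
                       (is_derive_scale (is_derive_sin s) (dg1 s)).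
  apply: (is_derive_eq H); rewrite ode; move: (g s) (g1 s) => x y.
  by apply/dotP => w; rewrite ?(dotDl, dotNl, dotZl, dot0l); ring.
have HB (s : R) : is_derive s 1 (fun r => sin r *: g r + cos r *: g1 r) 0.
  have H := is_deriveD (is_derive_scale (is_derive_sin s) (dg s))
                       (is_derive_scale (is_derive_cos s) (dg1 s)).
  apply: (is_derive_eq H); rewrite ode; move: (g s) (g1 s) => x y.
  by apply/dotP => w; rewrite ?(dotDl, dotNl, dotZl, dot0l); ring.
have EA := is_derive_row0_cst HA t; have EB := is_derive_row0_cst HB t.
rewrite cos0 sin0 !scale1r !scale0r subr0 in EA.
rewrite cos0 sin0 !scale1r !scale0r add0r in EB.
rewrite -EA -EB; have := cos2Dsin2 t; move: (g t) (g1 t) (cos t) (sin t) => x y c s cs.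
apply/dotP => w; rewrite ?(dotDl, dotNl, dotZl).
transitivity ((c ^+ 2 + s ^+ 2) * dot x w); first by rewrite cs mul1r.
by ring.
Qed.

(** The geodesic equation annihilates the tangential acceleration, and differentiating <gamma,
    gamma'> = 0 gives normal component -|gamma'|^2 = -1. Hence gamma'' = -gamma. *)
Lemma lengthy_geodesicE (gamma : R -> ambient R n) :
  lengthy_geodesic gamma -> arc_length_param gamma ->
  horizontal (gamma 0) (derive1 gamma 0) /\
  dot (derive1 gamma 0) (derive1 gamma 0) = 1 /\
  forall t, gamma t = cos t *: gamma 0 + sin t *: derive1 gamma 0.
Proof.
move=> [sm sph len geo] arc.
have hor t : horizontal (gamma t) (derive1 gamma t) by apply/levi_distributionP; exact: len.
have unit t : dot (derive1 gamma t) (derive1 gamma t) = 1.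
  by rewrite -(websterE _ _ (sph t)); exact: arc.
split; first exact: hor.
split; first exact: unit.
have d1 (t : R) : is_derive t 1 gamma (derive1 gamma t).
  by rewrite derive1E; exact: smooth_on_is_derive.
have sm1 : smooth_on [set: R] (derive1 gamma).
  rewrite (_ : derive1 gamma = fun t => 'D_1 gamma t); first exact: smooth_on_derive.
  by apply/funext => t; rewrite derive1E.
pose g2 (t : R) := 'D_1 (derive1 gamma) t.
have d2 (t : R) : is_derive t 1 (derive1 gamma) (g2 t) by exact: smooth_on_is_derive.
have g2E t : \row_i derive1 (fun s => derive1 gamma s 0 i) t = g2 t.
  apply/rowP => i; rewrite mxE derive1E.
  by have := (is_derive_rowP _ _ _ _).1 (d2 t) i; case.
apply: (great_circle_ode d1 d2) => t.
have := geo t; rewrite (cov_along_velocity (sph t) (hor t)) g2E /tproj => /eqP.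
rewrite subr_eq0 => /eqP ->.
suff -> : dot (gamma t) (g2 t) = - 1 by rewrite scaleN1r.
have H0 : is_derive t 1 (fun s => dot (gamma s) (derive1 gamma s)) 0.
  rewrite (_ : (fun s => _) = cst 0); first exact: is_derive_cst.
  by apply/funext => s; have [] := hor s.
have := is_derive_eqE (is_derive_dot (d1 t) (d2 t)) H0; rewrite unit => /eqP.
by rewrite addrC addr_eq0 => /eqP.
Qed.

(** The two-parameter family is closed under differentiation, as the induction on [k] requires. *)
Lemma Ck_on_cos_sin k (a b : R) : Ck_on [set: R] k (fun t : R => a * cos t + b * sin t).
Proof.
elim: k a b => [|k IHk] a b.
  move=> t _; apply: differentiable_continuous; apply/derivable1_diffP.
  by apply: derivableD; apply: derivableM.
have dt (t : R) : is_derive t 1 (fun t : R => a * cos t + b * sin t) (b * cos t + (- a) * sin t).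
  have H := is_deriveD (is_deriveM (is_derive_cst a t 1) (is_derive_cos t))
                       (is_deriveM (is_derive_cst b t 1) (is_derive_sin t)).
  by apply: (is_derive_eq H); rewrite !fctE /GRing.scale/=; ring.
split=> [t _|v]; first by apply/derivable1_diffP; have [] := dt t.
apply: (Ck_on_eq openT _ (IHk (v * b) (- (v * a)))) => t _.
have df : differentiable (fun t : R => a * cos t + b * sin t) t.
  by apply/derivable1_diffP; have [] := dt t.
have := deriveDv v (1 : R) 0 df; rewrite addr0 derive0 addr0 [v *: 1]mulr1 => ->.
by have [_ ->] := dt t; rewrite /GRing.scale/=; ring.
Qed.

Lemma great_circle_geodesic p u : sphere p -> horizontal p u -> dot u u = 1 ->
  let gamma (t : R) := cos t *: p + sin t *: u in
  lengthy_geodesic gamma /\ arc_length_param gamma.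
Proof.
move=> sp [tu hu] uu gamma; have pp : dot p p = 1 by exact: sp.
have pu : dot p u = 0 by exact: tu.
have d1 (t : R) : is_derive t 1 gamma (- sin t *: p + cos t *: u).
  have H := is_deriveD (is_derive_scale (is_derive_cos t) (is_derive_cst p t 1))
                       (is_derive_scale (is_derive_sin t) (is_derive_cst u t 1)).
  by apply: (is_derive_eq H); rewrite !scaler0 !addr0.
have g1 t : derive1 gamma t = - sin t *: p + cos t *: u.
  by rewrite derive1E; have [] := d1 t.
have cs (t : R) : cos t * cos t + sin t * sin t = 1 by rewrite -!expr2 cos2Dsin2.
have sph t : sphere (gamma t).
  rewrite /sphere/= /gamma !(dotDl, dotDr, dotZl, dotZr) pp uu [dot u p]dotC pu -[RHS](cs t).
  by ring.
have hor t : horizontal (gamma t) (derive1 gamma t).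
  rewrite g1 /gamma; split; rewrite /tangent ?mulIDl ?mulIZ !(dotDl, dotDr, dotZl, dotZr).
    by rewrite pp uu [dot u p]dotC pu; ring.
  rewrite !dot_mulIl0 hu.
  have -> : dot (mulI u) p = 0 by rewrite dot_mulIl dotC hu oppr0.
  by ring.
split; last first.
  move=> t; rewrite (websterE _ _ (sph t)) g1 !(dotDl, dotDr, dotZl, dotZr).
  by rewrite pp uu [dot u p]dotC pu -[RHS](cs t); ring.
split => //.
- apply: (smooth_onD openT); apply: (smooth_on_scalel openT) => k.
    by apply: (Ck_on_eq openT _ (Ck_on_cos_sin k 1 0)) => t _; rewrite mul1r mul0r addr0.
  by apply: (Ck_on_eq openT _ (Ck_on_cos_sin k 0 1)) => t _; rewrite mul1r mul0r add0r.
- by move=> t; apply/levi_distributionP; exact: hor.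
- move=> t; rewrite (cov_along_velocity (sph t) (hor t)).
  have d2 : is_derive t 1 (derive1 gamma) (- gamma t).
    have H := is_deriveD
      (is_derive_scale (is_deriveN (is_derive_sin t)) (is_derive_cst p t 1))
      (is_derive_scale (is_derive_cos t) (is_derive_cst u t 1)).
    rewrite (_ : derive1 gamma = fun s => - sin s *: p + cos s *: u); last first.
      by apply/funext => s; rewrite g1.
    by apply: (is_derive_eq H); rewrite !scaler0 !addr0 /gamma opprD !scaleNr.
  have -> : \row_i derive1 (fun s => derive1 gamma s 0 i) t = - gamma t.
    apply/rowP => i; rewrite mxE derive1E.
    by have := (is_derive_rowP _ _ _ _).1 d2 i; case.
  by rewrite /tproj dotNr sph scaleN1r opprK addNr.
Qed.

End Geodesics.

(** * The three-sphere *)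

Section Harmonic.
Context {R : realType} {m : nat}.
Local Notation X i := (mpolyX R (mnm1 i) : mpoly m R).

Lemma mderiv_var (k i : 'I_m) : mderiv k (X i) = mpolyC m (i == k)%:R.
Proof.
rewrite mderivX mnm1E; case: eqP => [->|_]; last by rewrite scale0r mpolyC0.
have -> : mnm_sub (mnm1 k) (mnm1 k) = mnm0 by apply/mnmP => l; rewrite mnmBE mnm0E subnn.
by rewrite mpolyX0 scale1r mpolyC1.
Qed.

Lemma mderiv2_varM (k i j : 'I_m) :
  mderiv k (mderiv k (X i * X j)) = mpolyC m (((i == k) && (j == k))%:R *+ 2).
Proof.
rewrite mderivM mderivD !mderivM !mderiv_var !mderivC !(mul0r, mulr0, addr0, add0r).
by rewrite -mpolyCM -natrM mulnb -mpolyCD -mulr2n.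
Qed.

End Harmonic.

Section ThreeSphere.
Context {R : realType}.
Implicit Types (u v w x y p : ambient R 1).
Local Notation e_ i := (delta_mx 0 i : ambient R 1).
Local Notation x1 p := (xcoord p ord0).
Local Notation x2 p := (xcoord p ord_max).
Local Notation y1 p := (ycoord p ord0).
Local Notation y2 p := (ycoord p ord_max).

Lemma sum_ord2 (S : nmodType) (F : 'I_2 -> S) : \sum_j F j = F ord0 + F ord_max.
Proof.
rewrite big_ord_recl big_ord_recl big_ord0 addr0.
by congr (_ + F _); apply: val_inj.
Qed.

Lemma dot4 u v : dot u v = x1 u * x1 v + y1 u * y1 v + (x2 u * x2 v + y2 u * y2 v).
Proof. by rewrite dotE sum_ord2. Qed.

Lemma sphere4 p : sphere p <-> x1 p ^+ 2 + y1 p ^+ 2 + (x2 p ^+ 2 + y2 p ^+ 2) = 1.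
Proof. by rewrite /sphere/= dot4 !expr2. Qed.

Lemma point4_coords (a b c d : R) : let p := point4 a b c d in
  [/\ x1 p = a, y1 p = b, x2 p = c & y2 p = d].
Proof.
by rewrite /point4 /xcoord /ycoord !row_mxEl !row_mxEr !mxE.
Qed.

Lemma point4_ext u v :
  x1 u = x1 v -> y1 u = y1 v -> x2 u = x2 v -> y2 u = y2 v -> u = v.
Proof. by move=> a b c d; apply: dotP => w; rewrite !dot4 a b c d. Qed.

Lemma mulI4 p : [/\ x1 (mulI p) = - y1 p, y1 (mulI p) = x1 p,
  x2 (mulI p) = - y2 p & y2 (mulI p) = x2 p].
Proof. by rewrite !xcoordI !ycoordI. Qed.

Section Form.
Variables a b : R.

(** The complex matrix with rows (a, b) and (b, -a) acting on C^2; it represents [harmH] and is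
    sqrt(a^2 + b^2) times a reflection. *)
Definition refl p : ambient R 1 :=
  point4 (a * x1 p + b * x2 p) (a * y1 p + b * y2 p)
         (b * x1 p - a * x2 p) (b * y1 p - a * y2 p).

Lemma refl4 p : [/\ x1 (refl p) = a * x1 p + b * x2 p, y1 (refl p) = a * y1 p + b * y2 p,
  x2 (refl p) = b * x1 p - a * x2 p & y2 (refl p) = b * y1 p - a * y2 p].
Proof. exact: point4_coords. Qed.

Lemma refl_sym u v : dot (refl u) v = dot u (refl v).
Proof.
have [h1 h2 h3 h4] := refl4 u; have [k1 k2 k3 k4] := refl4 v.
rewrite !dot4 h1 h2 h3 h4 k1 k2 k3 k4; ring.
Qed.

Lemma refl_mulI u : refl (mulI u) = mulI (refl u).
Proof.
have [h1 h2 h3 h4] := refl4 u; have [k1 k2 k3 k4] := refl4 (mulI u).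
have [i1 i2 i3 i4] := mulI4 u; have [j1 j2 j3 j4] := mulI4 (refl u).
apply: point4_ext; rewrite ?k1 ?k2 ?k3 ?k4 ?j1 ?j2 ?j3 ?j4 ?i1 ?i2 ?i3 ?i4 ?h1 ?h2 ?h3 ?h4; ring.
Qed.

Lemma refl_refl u : refl (refl u) = (a ^+ 2 + b ^+ 2) *: u.
Proof.
have [h1 h2 h3 h4] := refl4 u; have [k1 k2 k3 k4] := refl4 (refl u).
apply: point4_ext; rewrite ?k1 ?k2 ?k3 ?k4 ?h1 ?h2 ?h3 ?h4 /xcoord /ycoord [RHS]mxE; ring.
Qed.

Lemma harmHE : harmH a b = qform refl.
Proof.
apply/funext => p; have [h1 h2 h3 h4] := refl4 p.
rewrite /harmH /qform dot4 h1 h2 h3 h4; ring.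
Qed.

Lemma refl_trace : \sum_i dot (e_ i) (refl (e_ i)) = 0.
Proof.
under eq_bigr do rewrite dot_delta.
rewrite big_split_ord /= !sum_ord2.
have H u : [/\ refl u 0 (lshift 2 ord0) = a * x1 u + b * x2 u,
   refl u 0 (lshift 2 ord_max) = b * x1 u - a * x2 u,
   refl u 0 (rshift 2 ord0) = a * y1 u + b * y2 u &
   refl u 0 (rshift 2 ord_max) = b * y1 u - a * y2 u].
  by have [h1 h2 h3 h4] := refl4 u.
have [-> _ _ _] := H (e_ (lshift 2 ord0)).
have [_ -> _ _] := H (e_ (lshift 2 ord_max)).
have [_ _ -> _] := H (e_ (rshift 2 ord0)).
have [_ _ _ ->] := H (e_ (rshift 2 ord_max)).
rewrite /xcoord /ycoord !mxE /=.
ring.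
Qed.

Lemma harmH_kerT : kerT (harmH a b).
Proof. by rewrite harmHE; apply: kerT_qform; [exact: refl_sym|exact: refl_mulI]. Qed.

Lemma harmH_eigen : eigen 1 (- 8) (harmH a b).
Proof.
have kf := harmH_kerT; split; first by have [] := kf.
move=> p sp; rewrite sublaplacianE// harmHE.
rewrite (lap_qform refl_sym sp refl_trace); congr (_ * _).
by rewrite -natrM.
Qed.

Lemma harmH_spherical_harmonic : spherical_harmonic 2 (harmH a b).
Proof.
pose i1 : 'I_(2 + 2) := lshift 2 ord0; pose i2 : 'I_(2 + 2) := lshift 2 ord_max.
pose j1 : 'I_(2 + 2) := rshift 2 ord0; pose j2 : 'I_(2 + 2) := rshift 2 ord_max.
pose X i : mpoly (2 + 2) R := mpolyX R (mnm1 i).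
pose P : mpoly (2 + 2) R := a *: (X i1 * X i1 + X j1 * X j1 - X i2 * X i2 - X j2 * X j2)
  + (2 * b) *: (X i1 * X i2 + X j1 * X j2).
have hX i j : X i * X j \is ishomog1 2 mdeg.
  rewrite /X -mpolyXD dhomogX -[_ == _]/(mdeg (mnm_add (mnm1 i) (mnm1 j)) == 2%N).
  by rewrite mdegD !mdeg1.
exists P; split.
- by rewrite /P rpredD ?rpredZ ?rpredB ?rpredD.
- have L k : mderiv k (mderiv k P) =
     a *: (mpolyC _ (((i1 == k) && (i1 == k))%:R *+ 2)
        + mpolyC _ (((j1 == k) && (j1 == k))%:R *+ 2)
        - mpolyC _ (((i2 == k) && (i2 == k))%:R *+ 2)
        - mpolyC _ (((j2 == k) && (j2 == k))%:R *+ 2))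
     + (2 * b) *: (mpolyC _ (((i1 == k) && (i2 == k))%:R *+ 2)
        + mpolyC _ (((j1 == k) && (j2 == k))%:R *+ 2)).
    rewrite /P !(mderivD, mderivZ, mderivB, mderivN).
    by rewrite !mderiv2_varM.
  rewrite (eq_bigr _ (fun k _ => L k)) big_split_ord /= !sum_ord2.
  rewrite /i1 /i2 /j1 /j2 /=.
  rewrite !mul0rn !mpolyC0 !(subr0, addr0, add0r, sub0r) !scaler0 !addr0.
  by rewrite !scalerN !subrr addr0.
- move=> p sp; rewrite /P !(mevalD, mevalZ, mevalB, mevalN) !mevalM !mevalXU /harmH.
  rewrite -[p 0 i1]/(x1 p) -[p 0 i2]/(x2 p) -[p 0 j1]/(y1 p) -[p 0 j2]/(y2 p).
  by ring.
Qed.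

End Form.
End ThreeSphere.

(** * Maximum points of the harmonic and the geodesics through them *)

Section MaximumPoints.
Context {R : realType}.
Implicit Types (u v w x y p q : ambient R 1).
Local Notation x1 p := (xcoord p ord0).
Local Notation x2 p := (xcoord p ord_max).
Local Notation y1 p := (ycoord p ord0).
Local Notation y2 p := (ycoord p ord_max).

(** For n = 1 and k = 4 the required eigenvalue is -8, that of every [harmH a b]; a = b = 1 serves
    as witness. *)
Lemma sphere_harmonic_conditions :
  [/\ condition_i 1 (4 : R), condition_ii 1 (4 : R) & condition_iii 1 (4 : R)].
Proof.
have E : - (2 * 1%:R * 4 / (2 * 1%:R - 1)) = - 8 :> R by field.
have H := @harmH_eigen R 1 1.
have nz : nonzero_on_sphere (harmH (1 : R) 1).
  have [h1 h2 h3 h4] := point4_coords (1 : R) 0 0 0.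
  exists (point4 1 0 0 0); first by apply/sphere4; rewrite h1 h2 h3 h4; ring.
  rewrite /harmH h1 h2 h3 h4; apply: lt0r_neq0; lra.
split; first by apply/condition_iP => //; apply/andP; split; rewrite ?ltr0n// natrM.
- by rewrite /condition_ii E; exists (harmH 1 1).
- by rewrite /condition_iii E; exists (harmH 1 1) => //; split=> //; exact: harmH_kerT.
Qed.

Variables a b : R.
Hypothesis b0 : b != 0.
Let alpha := Num.sqrt (a ^+ 2 + b ^+ 2).

Let alpha2 : alpha ^+ 2 = a ^+ 2 + b ^+ 2.
Proof. by rewrite sqr_sqrtr// addr_ge0 ?sqr_ge0. Qed.

Let alpha_gt : `|a| < alpha.
Proof.
rewrite -ltr_sqr ?nnegrE ?sqrtr_ge0// alpha2 real_normK ?num_real//.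
by rewrite ltrDl lt0r sqr_ge0 sqrf_eq0 b0.
Qed.

Let alpha_gt0 : 0 < alpha. Proof. exact: le_lt_trans alpha_gt. Qed.
Let alphaB_gt0 : 0 < alpha - a.
Proof. by rewrite subr_gt0 (le_lt_trans _ alpha_gt)// ler_norm. Qed.
Let b2E : b ^+ 2 = (alpha - a) * (alpha + a).
Proof. by rewrite -subr_sqr alpha2; ring. Qed.

(** Q^2 = alpha^2 makes |Qp - alpha p|^2 affine in f(p); nonnegativity bounds f, and vanishing
    characterises the maximum points. *)
Lemma harmH_gap p : sphere p ->
  dot (refl a b p - alpha *: p) (refl a b p - alpha *: p)
  = 2 * alpha * (alpha - harmH a b p).
Proof.
move=> sp; have pp : dot p p = 1 by exact: sp.
rewrite !(dotDl, dotDr, dotNl, dotNr, dotZl, dotZr) refl_sym refl_refl dotZr.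
rewrite -alpha2 harmHE /qform [dot (refl a b p) p]dotC pp.
by ring.
Qed.

Lemma harmH_le p : sphere p -> harmH a b p <= alpha.
Proof.
move=> sp; rewrite -subr_ge0 -(pmulr_rge0 _ (_ : 0 < 2 * alpha)) ?mulr_gt0//.
by rewrite -harmH_gap// dot_ge0.
Qed.

Lemma harmH_eq_max p : sphere p -> harmH a b p = alpha -> refl a b p = alpha *: p.
Proof.
move=> sp qp; apply/eqP; rewrite -subr_eq0 -dot_eq0 harmH_gap// qp subrr mulr0.
by [].
Qed.

Lemma harmH_max_exists : exists2 p, sphere p & harmH a b p = alpha.
Proof.
(* Normalises the eigenvector (b, alpha - a), whose squared length b^2 + (alpha - a)^2 is 2 alpha
   (alpha - a). *)
pose c := (Num.sqrt (2 * alpha * (alpha - a)))^-1.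
have c2 : c ^+ 2 * (2 * alpha * (alpha - a)) = 1.
  rewrite exprVn sqr_sqrtr ?mulr_ge0 ?ltW// mulVf//.
  by rewrite !mulf_neq0 ?lt0r_neq0.
have [h1 h2 h3 h4] := point4_coords (c * b) 0 (c * (alpha - a)) 0.
exists (point4 (c * b) 0 (c * (alpha - a)) 0).
  apply/sphere4; rewrite h1 h2 h3 h4 -[RHS]c2 !exprMn b2E; ring.
rewrite /harmH h1 h2 h3 h4.
transitivity (c ^+ 2 * (a * b ^+ 2 - a * (alpha - a) ^+ 2 + 2 * b ^+ 2 * (alpha - a))).
  by ring.
transitivity (alpha * (c ^+ 2 * (2 * alpha * (alpha - a)))); last by rewrite c2 mulr1.
rewrite b2E; ring.
Qed.

Lemma sup_harmH : sup [set harmH a b x | x in @sphere R 1] = alpha.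
Proof.
have [p sp qp] := harmH_max_exists.
apply/eqP; rewrite eq_le; apply/andP; split.
  by apply: ge_sup; [exists (harmH a b p), p|move=> _ [q sq <-]; exact: harmH_le].
apply: ub_le_sup; last by exists p.
by exists alpha => _ [q sq <-]; exact: harmH_le.
Qed.

Lemma max_point_harmH p : max_point (harmH a b) p <-> sphere p /\ refl a b p = alpha *: p.
Proof.
split=> [[sp pmax]|[sp Qp]].
  split=> //; apply: harmH_eq_max => //; apply/eqP; rewrite eq_le harmH_le//=.
  by have [q sq <-] := harmH_max_exists; exact: pmax.
have qp : harmH a b p = alpha by rewrite harmHE /qform Qp dotZr sp mulr1.
by split=> // q sq; rewrite qp harmH_le.
Qed.

(* The alpha- and (-alpha)-eigenspaces of [refl] are the complex lines spanned
   by (b, alpha - a) and (alpha - a, - b). *)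
Lemma refl_eigenP p (e : R) : e ^+ 2 = alpha ^+ 2 ->
  refl a b p = e *: p <-> b * x2 p = (e - a) * x1 p /\ b * y2 p = (e - a) * y1 p.
Proof.
move=> e2; have [h1 h2 h3 h4] := refl4 a b p.
have eE : b ^+ 2 = (e - a) * (e + a) by rewrite -subr_sqr e2 alpha2; ring.
have X j : xcoord (e *: p) j = e * xcoord p j by rewrite /xcoord mxE.
have Y j : ycoord (e *: p) j = e * ycoord p j by rewrite /ycoord mxE.
split=> [Qp|[hx hy]].
  by split; [move: h1|move: h2]; rewrite Qp ?X ?Y => h; rewrite mulrBl h; ring.
apply: point4_ext; rewrite ?X ?Y ?h1 ?h2 ?h3 ?h4 ?hx ?hy.
- by ring.
- by ring.
- apply: (mulfI b0); transitivity (b ^+ 2 * x1 p - a * (b * x2 p)); first by ring.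
  by rewrite [RHS]mulrCA hx eE; ring.
- apply: (mulfI b0); transitivity (b ^+ 2 * y1 p - a * (b * y2 p)); first by ring.
  by rewrite [RHS]mulrCA hy eE; ring.
Qed.

Lemma refl_horizontal p u : sphere p -> refl a b p = alpha *: p -> horizontal p u ->
  refl a b u = - alpha *: u.
Proof.
move=> sp /(refl_eigenP _ erefl)[hx hy] [].
have [i1 i2 i3 i4] := mulI4 p.
rewrite /tangent !dot4 i1 i2 i3 i4 => tu hu.
(* S + iT is b times the Hermitian pairing of u with p, divided by the conjugate of p_1: [E1] and
   [E2] are the real and imaginary parts of conj(p_1)(S + iT) = 0. *)
pose S := b * x1 u + (alpha - a) * x2 u; pose T := b * y1 u + (alpha - a) * y2 u.
have E1 : x1 p * S + y1 p * T = 0.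
  rewrite -[RHS](mulr0 b) -tu /S /T.
  transitivity (b * (x1 p * x1 u + y1 p * y1 u) + ((alpha - a) * x1 p) * x2 u
     + ((alpha - a) * y1 p) * y2 u); first by ring.
  by rewrite -hx -hy; ring.
have E2 : - y1 p * S + x1 p * T = 0.
  rewrite -[RHS](mulr0 b) -hu /S /T.
  transitivity (b * (- y1 p * x1 u + x1 p * y1 u) - ((alpha - a) * y1 p) * x2 u
     + ((alpha - a) * x1 p) * y2 u); first by ring.
  by rewrite -hx -hy; ring.
(* If p_1 = 0, the eigenvector equation and b != 0 force p_2 = 0. *)
have r0 : x1 p ^+ 2 + y1 p ^+ 2 != 0.
  apply/negP => /eqP r0.
  have /sphere4 := sp; rewrite r0 add0r => s1.
  have : b ^+ 2 * (x2 p ^+ 2 + y2 p ^+ 2) = (alpha - a) ^+ 2 * (x1 p ^+ 2 + y1 p ^+ 2).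
    by rewrite mulrDr -!exprMn hx hy !exprMn -mulrDr.
  by rewrite s1 r0 mulr1 mulr0 => /eqP; rewrite sqrf_eq0 (negPf b0).
have S0 : S = 0.
  apply: (mulfI r0); transitivity (x1 p * (x1 p * S + y1 p * T) - y1 p * (- y1 p * S + x1 p * T)).
    by ring.
  by rewrite E1 E2 !mulr0 subr0.
have T0 : T = 0.
  apply: (mulfI r0); transitivity (y1 p * (x1 p * S + y1 p * T) + x1 p * (- y1 p * S + x1 p * T)).
    by ring.
  by rewrite E1 E2 !mulr0 addr0.
apply/(refl_eigenP _ (sqrrN _)); split; apply: (mulfI (lt0r_neq0 alphaB_gt0)).
  transitivity (b * (S - b * x1 u)); first by rewrite /S; ring.
  by rewrite S0 sub0r; transitivity (- b ^+ 2 * x1 u); [ring|rewrite b2E; ring].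
transitivity (b * (T - b * y1 u)); first by rewrite /T; ring.
by rewrite T0 sub0r; transitivity (- b ^+ 2 * y1 u); [ring|rewrite b2E; ring].
Qed.

Lemma harmH_geodesic (gamma : R -> ambient R 1) (s : R) :
  lengthy_geodesic gamma -> arc_length_param gamma ->
  max_point (harmH a b) (gamma 0) -> harmH a b (gamma s) = alpha * cos (2 * s).
Proof.
move=> geo arc /max_point_harmH[sp Qp].
have [hu [uu ->]] := lengthy_geodesicE geo arc.
have Qu := refl_horizontal sp Qp hu; have [tu _] := hu.
move: (derive1 gamma 0) hu uu Qu tu => u hu uu Qu tu.
have pu : dot (gamma 0) u = 0 by exact: tu.
rewrite harmHE /qform (sym_add (@refl_sym R a b)) !(sym_scale (@refl_sym R a b)) Qp Qu.
rewrite !(dotDl, dotDr, dotZl, dotZr) uu sp pu [dot u _]dotC pu.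
by rewrite [2 * s]mulr_natl mulr2n cosD; ring.
Qed.

(** At time pi/2 a great circle sits at its initial velocity. *)
Lemma geodesic_sphere_half_pi p x : sphere p ->
  geodesic_sphere p (pi / 2) x <-> horizontal p x /\ dot x x = 1.
Proof.
move=> sp; split=> [[gamma [geo arc g0 <-]]|[hx xx]].
  have [hu [uu ->]] := lengthy_geodesicE geo arc.
  by rewrite cos_pihalf sin_pihalf scale0r scale1r add0r -g0.
have [geo arc] := great_circle_geodesic sp hx xx.
exists (fun t => cos t *: p + sin t *: x); split=> //.
  by rewrite cos0 sin0 scale1r scale0r addr0.
by rewrite cos_pihalf sin_pihalf scale0r scale1r add0r.
Qed.

(** Conversely, eigenvectors for -alpha are orthogonal to p and to ip, both of which are
    eigenvectors for alpha. *)
Lemma horizontal_reflP p x : sphere p -> refl a b p = alpha *: p ->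
  horizontal p x <-> refl a b x = - alpha *: x.
Proof.
move=> sp Qp; split=> [|Qx]; first exact: refl_horizontal.
have orth q : refl a b q = alpha *: q -> dot q x = 0.
  move=> Qq; have := refl_sym a b q x; rewrite Qq Qx dotZl dotZr => /eqP.
  rewrite -subr_eq0 mulNr opprK -mulr2n mulrn_eq0 /= mulf_eq0.
  by rewrite (negPf (lt0r_neq0 alpha_gt0)) => /eqP.
by split; rewrite /tangent orth// refl_mulI Qp mulIZ.
Qed.

Lemma geodesic_sphereE p : max_point (harmH a b) p ->
  geodesic_sphere p (pi / 2) =
  [set x | exists lam mu : R,
     lam ^+ 2 + mu ^+ 2 = (alpha - a) / (2 * alpha) /\
     x = point4 lam mu (- (b * lam / (alpha - a))) (- (b * mu / (alpha - a)))].
Proof.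
move=> /max_point_harmH[sp Qp].
have al0 := lt0r_neq0 alpha_gt0; have ab0 := lt0r_neq0 alphaB_gt0.
(* As b^2 = (alpha - a)(alpha + a), the squared length is (s^2 + t^2)(1 + (alpha + a)/(alpha - a)) =
   (s^2 + t^2) 2 alpha/(alpha - a). *)
have nrm (s t : R) : s ^+ 2 + t ^+ 2 +
    ((- (b * s / (alpha - a))) ^+ 2 + (- (b * t / (alpha - a))) ^+ 2) = 1
   <-> s ^+ 2 + t ^+ 2 = (alpha - a) / (2 * alpha).
  rewrite !sqrrN !expr_div_n !exprMn b2E.
  have -> : s ^+ 2 + t ^+ 2 + ((alpha - a) * (alpha + a) * s ^+ 2 / (alpha - a) ^+ 2
     + (alpha - a) * (alpha + a) * t ^+ 2 / (alpha - a) ^+ 2)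
     = (s ^+ 2 + t ^+ 2) * (2 * alpha / (alpha - a)) by field.
  have c0 : 2 * alpha / (alpha - a) != 0 by rewrite !mulf_neq0 ?invr_neq0.
  rewrite -(invf_div (2 * alpha)) -[(2 * alpha / _)^-1]mul1r.
  by split=> [/(canRL (mulfK c0))|->] //; rewrite mulfVK.
apply/seteqP; split=> x.
  move/(geodesic_sphere_half_pi _ sp) =>
    [/(horizontal_reflP _ sp Qp)/(refl_eigenP _ (sqrrN _))[hx hy] xx].
  have solve (s t : R) : b * t = (- alpha - a) * s -> t = - (b * s / (alpha - a)).
    move=> st; apply: (mulfI b0); rewrite st.
    transitivity (- (b ^+ 2 * s / (alpha - a))); last by ring.
    by rewrite b2E; field.
  have E2 := solve _ _ hx; have F2 := solve _ _ hy.
  exists (x1 x), (y1 x); split.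
    by apply/nrm; rewrite -E2 -F2; apply/sphere4.
  have [h1 h2 h3 h4] := point4_coords (x1 x) (y1 x)
    (- (b * x1 x / (alpha - a))) (- (b * y1 x / (alpha - a))).
  by apply: point4_ext; rewrite ?h1 ?h2 ?h3 ?h4.
move=> [lam [mu [/nrm L ->]]].
have [h1 h2 h3 h4] := point4_coords lam mu (- (b * lam / (alpha - a))) (- (b * mu / (alpha - a))).
apply/(geodesic_sphere_half_pi _ sp); split; last first.
  by apply/sphere4; rewrite h1 h2 h3 h4.
apply/(horizontal_reflP _ sp Qp)/(refl_eigenP _ (sqrrN _)); rewrite h1 h2 h3 h4.
have E s : b * - (b * s / (alpha - a)) = (- alpha - a) * s.
  by transitivity (- (b ^+ 2 * s / (alpha - a))); [ring|rewrite b2E; field].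
by split.
Qed.

Lemma geodesic_sphere_degenerate p x : max_point (harmH a b) p ->
  geodesic_sphere p (pi / 2) x -> degenerate_critical_point (harmH a b) x.
Proof.
move=> /max_point_harmH[sp Qp] /(geodesic_sphere_half_pi _ sp)[hx xx].
rewrite harmHE; apply: (degenerate_qform (@refl_sym R a b) (@refl_mulI R a b) xx).
exact: refl_horizontal sp Qp hx.
Qed.

End MaximumPoints.

Theorem proposition1 (R : realType) :
  (forall (n : nat) (k : R), (1 <= n)%N ->
     condition_i n k -> condition_ii n k -> condition_iii n k ->
     k = 4 /\ n = 1%N)
  /\ (condition_i 1 (4 : R) /\ condition_ii 1 (4 : R)
      /\ condition_iii 1 (4 : R))
  /\ (forall a b : R, b != 0 ->
      let f := harmH a b in
      let alpha := sup [set f x | x in @sphere R 1] in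
      [/\ spherical_harmonic 2 f /\ @kerT R 1 f,
          alpha = Num.sqrt (a ^+ 2 + b ^+ 2),
          forall gamma : R -> ambient R 1,
            lengthy_geodesic gamma -> arc_length_param gamma ->
            max_point f (gamma 0) ->
            forall s : R, f (gamma s) = alpha * cos (2 * s)
        & forall x0 : ambient R 1, max_point f x0 ->
            geodesic_sphere x0 (pi / 2) =
              [set x | exists lam mu : R,
                 lam ^+ 2 + mu ^+ 2 = (alpha - a) / (2 * alpha) /\
                 x = point4 lam mu (- (b * lam / (alpha - a)))
                                   (- (b * mu / (alpha - a)))]
            /\ forall x, geodesic_sphere x0 (pi / 2) x ->
                 degenerate_critical_point f x]).
Proof.
split; first by move=> n k n1 hi _; exact: lichnerowicz_obata.
split; first by have [] := @sphere_harmonic_conditions R.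
move=> a b b0 f alpha; rewrite /alpha (sup_harmH a b0); split.
- by split; [exact: harmH_spherical_harmonic|exact: harmH_kerT].
- by [].
- by move=> gamma geo arc mx s; exact: harmH_geodesic.
- move=> x0 mx; split; first exact: geodesic_sphereE.
  by move=> x; exact: geodesic_sphere_degenerate.
Qed.
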